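(* Let $(M^2,g)$ and $(N^2,h)$ be $2$-dimensional Riemannian manifolds, and let $\pi: M^2\times\mathbb{R}\to (N^2,h)$ be a Riemannian submersion, where $M^2\times\mathbb{R}$ carries the product metric. Then $\pi$ is harmonic if and only if locally it is, up to an isometry of the domain, the projection onto the first factor followed by a Riemannian covering map.
   Context: $M^2\times\mathbb{R}$ has the product metric $g+dz^2$. A map $\varphi:(M,g)\to(N,h)$ between Riemannian manifolds is harmonic if its tension field $\tau(\varphi)=\mathrm{Trace}_g\nabla d\varphi$ vanishes identically. *)

(* Defs.v *)
From HB Require Import structures.
From mathcomp Require Import all_boot all_order all_algebra.
From mathcomp Require Import mathcomp_extra boolp classical_sets functions.
From mathcomp Require Import ring lra.
From mathcomp Require Import cardinality reals topology normedtype landau derive.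

Set Implicit Arguments.
Unset Strict Implicit.
Unset Printing Implicit Defensive.

Import Order.TTheory GRing.Theory Num.Theory.
Import numFieldNormedType.Exports.

Local Open Scope classical_set_scope.
Local Open Scope ring_scope.

Definition partial (R : realType) (n : nat) (W : normedModType R) (i : 'I_n)
  (f : 'rV[R]_n -> W) : 'rV[R]_n -> W := 'D_(delta_mx 0 i) f.

(* On an open set, being C^oo amounts to the iterated partial derivatives of
   every order being (Frechet) differentiable. *)
Fixpoint diff_order (R : realType) (n : nat) (W : normedModType R) (k : nat)
    (O : set 'rV[R]_n) (f : 'rV[R]_n -> W) : Prop :=
  if k is k'.+1 then
    (forall x, O x -> differentiable f x) /\
    (forall i, diff_order k' O (partial i f))
  else True.

Definition smooth (R : realType) (n : nat) (W : normedModType R)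
  (O : set 'rV[R]_n) (f : 'rV[R]_n -> W) : Prop := forall k, diff_order k O f.

Section SmoothTheory.
Context {R : realType}.
Implicit Types V W : normedModType R.

Lemma near_eq_differentiable V W (f g : V -> W) (x : V) :
  {near x, f =1 g} -> differentiable f x -> differentiable g x.
Proof.
move=> fg df.
have [df_cont /eqaddoP fo] := (diff_locallyP x f).1 df.
have go : g \o shift x = cst (g x) + 'd f x +o_ (0 : V) id.
  apply/eqaddoP => e e0.
  have fg0 : \forall h \near (0 : V), f (h + x) = g (h + x).
    by move: fg; rewrite (near_shift 0 x)/= subr0.
  have foe := fo e e0.
  near=> h.
  have <- : (f \o shift x - (cst (f x) + 'd f x)) h =
            (g \o shift x - (cst (g x) + 'd f x)) h; last by near: h.
    rewrite !fctE /= (nbhs_singleton fg); congr (_ - _).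
    by near: h.
by apply/diff_locallyP; rewrite (diff_unique df_cont go).
Unshelve. all: by end_near. Qed.

Lemma eq_diff_order n W k (O : set 'rV[R]_n) (f g : 'rV[R]_n -> W) :
  open O -> (forall x, O x -> f x = g x) -> diff_order k O f ->
  diff_order k O g.
Proof.
move=> oO; elim: k f g => //= k IH f g fg [df Df].
have nfg x : O x -> {near x, f =1 g}.
  by move=> Ox; apply: filterS (open_nbhs_nbhs (conj oO Ox)) => y /fg.
split=> [x Ox|i]; first by apply: near_eq_differentiable (nfg _ Ox) (df _ Ox).
by apply: IH (Df i) => x Ox; apply: near_eq_derive; exact: nfg.
Qed.

Lemma diff_order_cst n W k (O : set 'rV[R]_n) (w : W) : open O ->
  diff_order k O (fun _ : 'rV[R]_n => w).
Proof.
move=> oO; elim: k w => //= k IH w; split=> [x _|i]; first exact: differentiable_cst.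
by apply: (eq_diff_order oO _ (IH 0)) => x _; rewrite /partial derive_cst.
Qed.

Lemma diff_orderD n W k (O : set 'rV[R]_n) (f g : 'rV[R]_n -> W) : open O ->
  diff_order k O f -> diff_order k O g -> diff_order k O (fun x => f x + g x).
Proof.
move=> oO; elim: k f g => //= k IH f g [df Df] [dg Dg].
split=> [x Ox|i]; first by apply: differentiableD; [exact: df|exact: dg].
apply: (eq_diff_order oO _ (IH _ _ (Df i) (Dg i))) => x Ox.
by rewrite /partial deriveD//; apply: diff_derivable; [exact: df|exact: dg].
Qed.

Lemma diff_order_sum n W k (O : set 'rV[R]_n) (I : finType)
    (f : I -> 'rV[R]_n -> W) : open O ->
  (forall i, diff_order k O (f i)) -> diff_order k O (fun x => \sum_i f i x).
Proof.
move=> oO fP.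
elim: (index_enum I) => [|i s IH].
  by under eq_fun do rewrite big_nil; exact: diff_order_cst.
by under eq_fun do rewrite big_cons; exact: diff_orderD.
Qed.

Lemma diff_orderZ n W k (O : set 'rV[R]_n) (f : 'rV[R]_n -> W) (c : R) :
  open O -> diff_order k O f -> diff_order k O (fun x => c *: f x).
Proof.
move=> oO; elim: k f => //= k IH f [df Df].
split=> [x Ox|i]; first by apply: differentiableZ; exact: df.
apply: (eq_diff_order oO _ (IH _ (Df i))) => x Ox.
by rewrite /partial deriveZ//; apply: diff_derivable; exact: df.
Qed.

Lemma diff_orderZl n W k (O : set 'rV[R]_n) (f : 'rV[R]_n -> R) (w : W) :
  open O -> diff_order k O f -> diff_order k O (fun x => f x *: w).
Proof.
move=> oO; elim: k f => //= k IH f [df Df].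
split=> [x Ox|i]; first by exact: (@differentiableZl _ _ _ f w x (df x Ox)).
apply: (eq_diff_order oO _ (IH _ (Df i))) => x Ox.
have dfx := df x Ox.
by rewrite /partial !deriveE ?diffZl//; exact: (@differentiableZl _ _ _ f w x dfx).
Qed.

Lemma derive_coord n p q (F : 'rV[R]_n -> 'M[R]_(p, q)) i j (x v : 'rV[R]_n) :
  differentiable F x ->
  'D_v (fun y => F y i j : R) x = ('D_v F x) i j.
Proof.
move=> dF.
have @c : {linear 'M[R]_(p, q) -> R}.
  by exists (fun N : 'M[R]_(_, _) => N i j); do 2![eexists]; do ?[constructor];
     rewrite ?mxE// => ? *; rewrite ?mxE//; move=> ?; rewrite !mxE.
have cc : continuous c by exact: coord_continuous.
rewrite -[LHS]/('D_v (c \o F) x) deriveE; last first.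
  by apply: differentiable_comp => //; exact: linear_differentiable.
rewrite diff_comp//; last exact: linear_differentiable.
by rewrite diff_lin//= deriveE.
Qed.

Lemma diff_order_coord n p q k (O : set 'rV[R]_n) (F : 'rV[R]_n -> 'M[R]_(p, q))
  i j : open O -> diff_order k O F -> diff_order k O (fun x => F x i j : R).
Proof.
move=> oO; elim: k F => //= k IH F [dF DF]; split=> [x Ox|l].
  by have := differentiable_comp (dF x Ox) (differentiable_coord (F x) i j).
apply: (eq_diff_order oO _ (IH _ (DF l))) => x Ox.
by rewrite /partial derive_coord//; exact: dF.
Qed.

Lemma diff_order_mx n p q k (O : set 'rV[R]_n) (F : 'rV[R]_n -> 'M[R]_(p, q)) :
  open O -> (forall i j, diff_order k O (fun x => F x i j : R)) ->
  diff_order k O F.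
Proof.
move=> oO FP.
have -> : F = fun x => \sum_i \sum_j F x i j *: delta_mx i j.
  by apply/funext => x; exact: matrix_sum_delta.
by do 2 (apply: diff_order_sum => // ?); exact: diff_orderZl.
Qed.

Lemma diff_order_comp_linear n m W k (O : set 'rV[R]_n) (f : 'rV[R]_n -> W)
    (L : {linear 'rV[R]_m -> 'rV[R]_n}) : continuous L -> open O ->
  diff_order k O f -> diff_order k (L @^-1` O) (f \o L).
Proof.
move=> cL oO; have oLO : open (L @^-1` O).
  by move/continuousP: cL; apply.
have dL x : differentiable L x by exact: linear_differentiable.
elim: k f => //= k IH f [df Df]; split=> [x Ox|i].
  by apply: differentiable_comp => //; exact: df.
pose g x := \sum_j (L (delta_mx 0 i)) 0 j *: (partial j f \o L) x.
apply: (@eq_diff_order _ _ _ _ g) => // [x Ox|].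
  rewrite /partial deriveE; last by apply: differentiable_comp => //; exact: df.
  rewrite diff_comp//; last exact: df.
  rewrite diff_lin//= [X in 'd f _ X]row_sum_delta linear_sum.
  apply: eq_bigr => j _; rewrite linearZ /= /partial deriveE//; exact: df.
apply: diff_order_sum => // j.
by apply: diff_orderZ => //; exact: IH.
Qed.

End SmoothTheory.

(* [param a] is the inverse of the chart [coord a : dom a -> 'rV_n], and
   [metric a x] is the Gram matrix at [param a x] of the coordinate frame of
   [a]; only values on [dom a], resp. on its image, are meaningful. Tangent
   vectors are row vectors, so differentials act on them as [v *m 'J f x]. *)
Record riemannian_manifold (R : realType) (n : nat) := RiemannianManifold {
  carrier :> topologicalType;
  chart : Type;
  dom : chart -> set carrier;
  coord : chart -> carrier -> 'rV[R]_n;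
  param : chart -> 'rV[R]_n -> carrier;
  metric : chart -> 'rV[R]_n -> 'M[R]_n;
  manifold_hausdorff : hausdorff_space carrier;
  manifold_second_countable : @second_countable carrier;
  dom_cover : forall p, exists a, dom a p;
  dom_open : forall a, open (dom a);
  coord_open : forall a, open (coord a @` dom a);
  coordK : forall a p, dom a p -> param a (coord a p) = p;
  coord_continuous_at : forall a p, dom a p -> {for p, continuous (coord a)};
  param_continuous_at : forall a x, (coord a @` dom a) x ->
    {for x, continuous (param a)};
  transition_smooth : forall a b,
    smooth (coord a @` (dom a `&` dom b)) (coord b \o param a);
  metric_smooth : forall a, smooth (coord a @` dom a) (metric a);
  metric_sym : forall a x, (coord a @` dom a) x -> (metric a x)^T = metric a x;
  metric_posdef : forall a x (v : 'rV[R]_n), (coord a @` dom a) x -> v != 0 ->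
    0 < (v *m metric a x *m v^T) 0 0;
  metric_transition : forall a b p, dom a p -> dom b p ->
    let J := 'J (coord b \o param a) (coord a p) in
    metric a (coord a p) = J *m metric b (coord b p) *m J^T }.

Section ProductLine.
Context {R : realType} {n : nat} (M : riemannian_manifold R n).
Implicit Types a b : chart M.

Definition line_dom a : set (M * R)%type := [set p | dom a p.1].
Definition line_coord a (p : M * R) : 'rV[R]_(n + 1) :=
  row_mx (coord a p.1) p.2%:M.
Definition line_param a (x : 'rV[R]_(n + 1)) : (M * R)%type :=
  (param a (lsubmx x), rsubmx x 0 0).
Definition line_metric a (x : 'rV[R]_(n + 1)) : 'M[R]_(n + 1) :=
  block_mx (metric a (lsubmx x)) 0 0 1%:M.

Lemma line_image a (A : set M) :
  line_coord a @` [set p | A p.1] = lsubmx @^-1` (coord a @` A).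
Proof.
apply/seteqP; split=> [_ [p Ap <-]|x [p Ap pE]] /=.
  by exists p.1; rewrite // row_mxKl.
exists (p, rsubmx x 0 0) => //=.
by rewrite /line_coord/= pE -mx11_scalar hsubmxK.
Qed.

Lemma line_hausdorff : hausdorff_space (M * R)%type.
Proof.
move=> [p x] [q y] cl; congr (_, _).
  apply: (manifold_hausdorff (r := M)) => A B pA qB.
  have pA' : nbhs (p, x) (A `*` setT).
    by exists (A, setT); [split=> //; exact: filterT|move=> ? []].
  have qB' : nbhs (q, y) (B `*` setT).
    by exists (B, setT); [split=> //; exact: filterT|move=> ? []].
  by have [[r z] [[Ar _] [Br _]]] := cl _ _ pA' qB'; exists r.
apply: (@Rhausdorff R) => A B xA yB.
have xA' : nbhs (p, x) (setT `*` A).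
  by exists (setT, A); [split=> //; exact: filterT|move=> ? []].
have yB' : nbhs (q, y) (setT `*` B).
  by exists (setT, B); [split=> //; exact: filterT|move=> ? []].
by have [[r z] [[_ Az] [_ Bz]]] := cl _ _ xA' yB'; exists z.
Qed.

Lemma open_setX (X Y : topologicalType) (A : set X) (B : set Y) :
  open A -> open B -> open (A `*` B).
Proof.
move=> oA oB; rewrite openE => -[x y] [/= Ax By].
by exists (A, B) => //; split; exact: open_nbhs_nbhs.
Qed.

Lemma line_second_countable : @second_countable (M * R)%type.
Proof.
have [B Bc [Bo Bb]] := manifold_second_countable M.
pose I (q : rat * rat) : set R := `]ratr q.1, ratr q.2[%classic.
exists [set AB.1 `*` I AB.2 | AB in B `*` [set: rat * rat]].
  apply: sub_countable (card_image_le _ _) _.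
  by apply: countableX => //; exact: countableP.
split=> [_ [[A q] /= [BA _] <-]|[p x] U [[V W] /= [pV xW] VWU]].
  by apply: open_setX; [exact: Bo|exact: itv_open].
have [A [BA Ap] AV] := Bb p V pV.
have [e /= e0 eW] := (nbhs_ballP x W).1 xW.
have [q1] : exists q : rat, ratr q \in `]x - e, x[.
  by apply: rat_in_itvoo; rewrite ltrBlDr ltrDl.
have [q2] : exists q : rat, ratr q \in `]x, x + e[.
  by apply: rat_in_itvoo; rewrite ltrDl.
rewrite !in_itv/= => /andP[xq2 q2e] /andP[eq1 q1x].
exists (A `*` I (q1, q2)).
  split; first by exists (A, (q1, q2)).
  by split=> //=; rewrite /I/= in_itv/= q1x.
move=> [p' x'] [/= Ap']; rewrite /I/= in_itv/= => /andP[q1x' x'q2].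
apply: VWU; split=> /=; first exact: AV.
apply: eW; rewrite -ball_normE/= ltr_norml ltrBrDl ltrBlDl.
by rewrite -ltrBlDl; apply/andP; split; lra.
Qed.

Lemma line_transitionE a b x : (line_coord b \o line_param a) x =
  row_mx ((coord b \o param a) (lsubmx x)) (rsubmx x).
Proof. by rewrite /line_coord /= -mx11_scalar. Qed.

Lemma lsubmx_continuous :
  continuous (lsubmx : 'rV[R]_(n + 1) -> 'rV[R]_n).
Proof. exact: continuous_lsubmx. Qed.

Lemma open_lsubmx (O : set 'rV[R]_n) : open O ->
  open (lsubmx @^-1` O : set 'rV[R]_(n + 1)).
Proof. by move/continuousP: lsubmx_continuous; exact. Qed.

Lemma diff_order_lsubmx (W : normedModType R) k (O : set 'rV[R]_n)
    (f : 'rV[R]_n -> W) : open O -> diff_order k O f ->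
  diff_order k (lsubmx @^-1` O : set 'rV[R]_(n + 1)) (f \o lsubmx).
Proof.
move=> oO fO.
exact: (diff_order_comp_linear (L := [the {linear _ -> _} of lsubmx])
          lsubmx_continuous oO fO).
Qed.

Lemma diff_order_entry k (O : set 'rV[R]_(n + 1)) (j : 'I_(n + 1)) :
  open O -> diff_order k O (fun x => x 0 j : R).
Proof.
move=> oO; case: k => // k; split=> [x _|i]; first exact: differentiable_coord.
pose c : R := (delta_mx 0 i : 'rV[R]_(n + 1)) 0 j.
apply: (eq_diff_order oO _ (diff_order_cst k c oO)) => x _.
by rewrite /partial (derive_coord (F := id))// derive_id.
Qed.

Lemma transition_open a b : open (coord a @` (dom a `&` dom b)).
Proof.
have -> : coord a @` (dom a `&` dom b) =
    (coord a @` dom a) `&` param a @^-1` dom b.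
  apply/seteqP; split=> [_ [p [ap bp] <-]|x [[p ap <-]]] /=.
    by split; [exists p|rewrite coordK].
  by rewrite coordK// => bp; exists p.
rewrite openE => x [ax bx]; apply: filterI.
  by apply: open_nbhs_nbhs; split=> //; exact: coord_open.
apply: (param_continuous_at ax).
by apply: open_nbhs_nbhs; split=> //; exact: dom_open.
Qed.

Lemma line_transition_smooth a b :
  smooth (line_coord a @` (line_dom a `&` line_dom b))
         (line_coord b \o line_param a).
Proof.
move=> k; rewrite (line_image a (dom a `&` dom b)).
have oO := open_lsubmx (@transition_open a b).
apply: diff_order_mx => // i j; rewrite (ord1 i) {i}.
case: (split_ordP j) => l ->.
  apply: (eq_diff_order oO _ (diff_order_coord 0 l oO
    (diff_order_lsubmx (@transition_open a b) (@transition_smooth _ _ M a b k)))).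
  by move=> x _; rewrite line_transitionE row_mxEl.
apply: (eq_diff_order oO _ (diff_order_entry k (rshift n l) oO)).
by move=> x _; rewrite line_transitionE row_mxEr mxE.
Qed.

Lemma line_metric_smooth a :
  smooth (line_coord a @` line_dom a) (line_metric a).
Proof.
move=> k; rewrite line_image.
have oO := open_lsubmx (@coord_open _ _ M a).
apply: diff_order_mx => // i j.
case: (split_ordP i) => i' ->; case: (split_ordP j) => j' ->.
- apply: (eq_diff_order oO _ (diff_order_coord i' j' oO
    (diff_order_lsubmx (@coord_open _ _ M a) (@metric_smooth _ _ M a k)))).
  by move=> x _; rewrite /line_metric block_mxEul.
- apply: (eq_diff_order oO _ (diff_order_cst k (0 : R) oO)).
  by move=> x _; rewrite /line_metric block_mxEur mxE.
- apply: (eq_diff_order oO _ (diff_order_cst k (0 : R) oO)).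
  by move=> x _; rewrite /line_metric block_mxEdl mxE.
- apply: (eq_diff_order oO _ (diff_order_cst k ((1%:M : 'M[R]_1) i' j') oO)).
  by move=> x _; rewrite /line_metric block_mxEdr.
Qed.

Lemma line_jacobian a b (x : 'rV[R]_(n + 1)) :
  (coord a @` (dom a `&` dom b)) (lsubmx x) ->
  'J (line_coord b \o line_param a) x =
  block_mx ('J (coord b \o param a) (lsubmx x)) 0 0 1%:M.
Proof.
move=> abx.
have dT : differentiable (coord b \o param a) (lsubmx x).
  by have [+ _] := @transition_smooth _ _ M a b 1; exact.
have dT' : differentiable (line_coord b \o line_param a) x.
  have [+ _] := @line_transition_smooth a b 1; apply.
  by rewrite (line_image a (dom a `&` dom b)).
have dl : differentiable (lsubmx : 'rV[R]_(n + 1) -> 'rV[R]_n) x.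
  exact: differentiable_lsubmx.
apply/row_matrixP => i; rewrite !rowE -deriveEjacobian//.
set v := delta_mx 0 i; rewrite -(hsubmxK v) mul_row_block !mulmx0 addr0 add0r.
rewrite mulmx1 hsubmxK -deriveEjacobian//.
apply/rowP => j; rewrite -derive_coord//.
case: (split_ordP j) => l ->.
  under eq_fun do rewrite line_transitionE row_mxEl.
  rewrite row_mxEl (derive_coord _ _ (F := (coord b \o param a) \o lsubmx)).
    rewrite !deriveE//; last exact: differentiable_comp.
    rewrite diff_comp//= (@diff_lin _ _ _ [the {linear _ -> _} of lsubmx])//.
    exact: lsubmx_continuous.
  exact: differentiable_comp.
under eq_fun do rewrite line_transitionE row_mxEr mxE.
rewrite row_mxEr mxE.
by have -> := derive_coord (F := id) 0 (rshift n l) v (ex_diff (is_diff_def := is_diff_id x)); rewrite derive_id.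
Qed.

Lemma line_metric_transition a b p : line_dom a p -> line_dom b p ->
  let J := 'J (line_coord b \o line_param a) (line_coord a p) in
  line_metric a (line_coord a p) = J *m line_metric b (line_coord b p) *m J^T.
Proof.
move=> ap bp /=; rewrite line_jacobian ?row_mxKl; last by exists p.1.
rewrite /line_metric !row_mxKl tr_block_mx !mulmx_block.
rewrite !(mulmx0, mul0mx, trmx0, addr0, add0r, mulmx1, mul1mx, trmx1).
by rewrite -metric_transition.
Qed.

Lemma line_metric_posdef a x (v : 'rV[R]_(n + 1)) :
  (line_coord a @` line_dom a) x -> v != 0 ->
  0 < (v *m line_metric a x *m v^T) 0 0.
Proof.
rewrite line_image -{1 2 3}(hsubmxK v) => ax v0.
rewrite /line_metric mul_row_block tr_row_mx mul_row_col.
rewrite !(mulmx0, addr0, add0r, mulmx1) mxE.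
set u := lsubmx v in v0 *; set w := rsubmx v in v0 *.
have -> : (w *m w^T) 0 0 = w 0 0 ^+ 2 by rewrite mxE big_ord1 [w^T _ _]mxE expr2.
have [u0|u0] := eqVneq u 0.
  rewrite u0 !mul0mx mxE add0r exprn_even_gt0//=.
  apply: contra v0; rewrite u0 => /eqP w0; apply/eqP.
  by rewrite (mx11_scalar w) w0 raddf0 row_mx0.
by rewrite ltr_wpDr ?sqr_ge0// metric_posdef.
Qed.

Lemma line_dom_cover p : exists a, line_dom a p.
Proof. by have [a] := dom_cover p.1; exists a. Qed.

Lemma line_dom_open a : open (line_dom a).
Proof.
have -> : line_dom a = dom a `*` setT by apply/seteqP; split=> p //= [].
by apply: open_setX; [exact: dom_open|exact: openT].
Qed.

Lemma line_coord_open a : open (line_coord a @` line_dom a).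
Proof. by rewrite line_image; exact/open_lsubmx/coord_open. Qed.

Lemma line_coordK a p : line_dom a p -> line_param a (line_coord a p) = p.
Proof.
case: p => p z ap.
by rewrite /line_param row_mxKl row_mxKr coordK// mxE.
Qed.

Lemma line_coord_continuous a p : line_dom a p ->
  {for p, continuous (line_coord a)}.
Proof.
case: p => p z ap A /nbhs_ballP[e /= e0 eA].
exists ([set q | ball (coord a p) e (coord a q)], ball z e) => /=.
  split; last exact: nbhsx_ballx.
  by apply: (coord_continuous_at ap); exact: nbhsx_ballx.
move=> [q t] [/= [_ pq] zt]; apply: eA; split=> // i j.
rewrite /line_coord /= !mxE; case: split_ordP => l _; first exact: pq.
by rewrite !mxE (ord1 i) (ord1 l) !mulr1n.
Qed.

Lemma line_param_continuous a x : (line_coord a @` line_dom a) x ->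
  {for x, continuous (line_param a)}.
Proof.
rewrite line_image => ax.
have cl : {for x, continuous (fun y => param a (lsubmx y))}.
  exact: (continuous_comp (@lsubmx_continuous x) (param_continuous_at ax)).
have cr : {for x, continuous (fun y : 'rV[R]_(n + 1) => rsubmx y 0 0 : R)}.
  have -> : (fun y : 'rV[R]_(n + 1) => rsubmx y 0 0 : R) =
      (fun y : 'rV[R]_(n + 1) => y 0 (rshift n 0)).
    by apply/funext => y; rewrite mxE.
  exact: coord_continuous.
exact: (cvg_pair cl cr).
Qed.

Lemma line_metric_sym a x : (line_coord a @` line_dom a) x ->
  (line_metric a x)^T = line_metric a x.
Proof.
rewrite line_image => ax.
by rewrite /line_metric tr_block_mx !trmx0 trmx1 metric_sym.
Qed.

(* M x R with the product metric g + dz^2. *)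
Definition product_line : riemannian_manifold R (n + 1) :=
  RiemannianManifold line_hausdorff line_second_countable line_dom_cover
    line_dom_open line_coord_open line_coordK line_coord_continuous
    line_param_continuous line_transition_smooth line_metric_smooth
    line_metric_sym line_metric_posdef line_metric_transition.

End ProductLine.

Section Maps.
Context {R : realType} {m n : nat}.
Variables (E : riemannian_manifold R m) (N : riemannian_manifold R n).
Implicit Types (f : E -> N) (a : chart E) (b : chart N) (p : E).

Definition local_rep a b f : 'rV[R]_m -> 'rV[R]_n := coord b \o f \o param a.

Definition smooth_at f p : Prop :=
  {for p, continuous f} /\
  forall a b, dom a p -> dom b (f p) ->
    exists2 O : set 'rV[R]_m, open_nbhs (coord a p) O &
      smooth O (local_rep a b f).

Definition smooth_on (U : set E) f : Prop := forall p, U p -> smooth_at f p.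

Definition inner a p (u v : 'rV[R]_m) : R :=
  (u *m metric a (coord a p) *m v^T) 0 0.

End Maps.

Section RiemannianMaps.
Context {R : realType} {m n : nat}.
Variables (E : riemannian_manifold R m) (N : riemannian_manifold R n).
Implicit Types (f : E -> N) (a : chart E) (b : chart N) (p : E).

Definition differential a b f p : 'M[R]_(m, n) :=
  'J (local_rep a b f) (coord a p).

Definition horizontal a b f p (u : 'rV[R]_m) : Prop :=
  forall w, w *m differential a b f p = 0 -> inner a p u w = 0.

Definition riemannian_submersion f : Prop :=
  smooth_on setT f /\
  forall p a b, dom a p -> dom b (f p) ->
    let J := differential a b f p in
    row_full J /\
    forall u v, horizontal a b f p u -> horizontal a b f p v ->
      inner b (f p) (u *m J) (v *m J) = inner a p u v.

Definition metric_preserving_at f p : Prop :=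
  forall a b, dom a p -> dom b (f p) ->
    let J := differential a b f p in
    forall u v, inner b (f p) (u *m J) (v *m J) = inner a p u v.

(* [christoffel c l i j] is the symbol Gamma^l_(ij) of the Levi-Civita
   connection in the chart [c]. *)
Definition christoffel (k : nat) (L : riemannian_manifold R k) (c : chart L)
    (l i j : 'I_k) (x : 'rV[R]_k) : R :=
  2^-1 * \sum_r invmx (metric c x) l r *
    (partial i (fun y => metric c y j r : R) x
     + partial j (fun y => metric c y i r : R) x
     - partial r (fun y => metric c y i j : R) x).

(* Components (nabla d f)(d_i, d_j)^c of the second fundamental form, with
   respect to the Levi-Civita connections of E and N. *)
Definition second_fundamental_form a b f (c : 'I_n) (i j : 'I_m)
    (x : 'rV[R]_m) : R :=
  let F d : 'rV[R]_m -> R := fun y => local_rep a b f y 0 d in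
  partial i (partial j (F c)) x
  - (\sum_k christoffel a k i j x * partial k (F c) x)
  + \sum_d \sum_e christoffel b c d e (local_rep a b f x)
                  * partial i (F d) x * partial j (F e) x.

Definition tension a b f (c : 'I_n) (x : 'rV[R]_m) : R :=
  \sum_i \sum_j invmx (metric a x) i j * second_fundamental_form a b f c i j x.

Definition harmonic f : Prop :=
  smooth_on setT f /\
  forall p a b c, dom a p -> dom b (f p) -> tension a b f c (coord a p) = 0.

End RiemannianMaps.

Section LocalIsometries.
Context {R : realType} {n : nat}.
Variables (E N : riemannian_manifold R n).

(* [f] restricts to a Riemannian isometry (metric-preserving diffeomorphism)
   from [U] onto [V]; nothing is asked of it outside [U]. *)
Definition isometry_between (U : set E) (V : set N) (f : E -> N) : Prop :=
  [/\ open U, open V, smooth_on U f,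
      (forall p, U p -> metric_preserving_at f p) &
      exists g : N -> E,
        [/\ set_fun U V f, set_fun V U g, {in U, cancel f g},
            {in V, cancel g f} & smooth_on V g]].

(* The restriction of [f] to [W] is a topological covering map onto [B]. *)
Definition covering_between (W : set E) (B : set N) (f : E -> N) : Prop :=
  f @` W = B /\
  forall q, B q -> exists O : set N, [/\ open O, O q, O `<=` B &
    exists (I : Type) (S : I -> set E),
      [/\ W `&` f @^-1` O = \bigcup_i S i,
          trivIset setT S,
          forall i, open (S i) &
          forall i, [/\ set_bij (S i) O f,
            {within S i, continuous f} &
            forall A, open A -> A `<=` S i -> open (f @` A)]]].

(* In equal dimensions, a smooth metric-preserving map is a local isometry. *)
Definition riemannian_covering (W : set E) (B : set N) (f : E -> N) : Prop :=
  [/\ open W, open B, smooth_on W f,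
      (forall p, W p -> metric_preserving_at f p) & covering_between W B f].

End LocalIsometries.

(* Main.v *)
(* Let [V] be the unit vertical field of the submersion, [w] its metric dual and
   [h] the metric of [N]: the domain metric is [w^2 + pi^* h].  Pairing the
   tension field with the differential of a horizontal vector [Z] gives
   [- dw (V, Z)], so harmonicity means [i_V dw = 0]; together with [w(V) = 1] this
   says that [V] is a Killing field.

   On [M x R] write [V = X + theta d_z].  Killing's equation and [|V| = 1] force
   [theta] to be constant and [X] to be independent of [z], hence [X] is a Killing
   field of constant length with closed dual on [M].  If [X = 0] then [V = +- d_z].
   Otherwise the dual forms of [X / |X|] and of its rotate by a right angle are
   closed, so by Poincare's lemma they are the differentials of flat coordinates
   in which [X] is constant, and a rotation of the flat space [M x R] takes [V] to
   [d_z].  After this isometry [pi] does not depend on [z] and descends to a local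
   isometry of surfaces.  Conversely, for a local isometry [Phi] followed by
   the projection and a local isometry of surfaces, [w] is up to sign the exact
   form [Phi^* dz]. *)

From HB Require Import structures.
From mathcomp Require Import all_boot all_order all_algebra.
From mathcomp Require Import boolp classical_sets functions.
From mathcomp Require Import reals ereal realfun.
From mathcomp Require Import measure lebesgue_measure lebesgue_integral ftc.
From mathcomp Require Import topology normedtype sequences landau derive.
From mathcomp Require Import ring lra.
Require Import Defs.

Set Implicit Arguments.
Unset Strict Implicit.
Unset Printing Implicit Defensive.

Import Order.TTheory GRing.Theory Num.Theory.
Import numFieldNormedType.Exports.

Local Open Scope classical_set_scope.
Local Open Scope ring_scope.

(** The argument runs in one chart on a ball: convexity turns vanishing derivatives into constancy,
    and for the sup norm the ball is a product, so its slices are balls of the surface. The vertical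
    field is the normalised cross product of the columns of the Jacobian, which settles its sign
    smoothly. The tension field only tests [dw (V, Z)] for horizontal [Z]; antisymmetry supplies
    [Z = V]. Killing's equation makes the second [z]-derivative of [X] orthogonal to everything, so
    differentiating [|V| = 1] twice along the line leaves [|X_z|^2 = 0]. As [|X|^2 = 1 - theta^2] is
    then constant, [X] is identically zero or nowhere zero, and no mixed case arises. On the surface
    [i_V dw = 0] says only that [X] times the curl of its dual vanishes, which is closedness where
    [X] is nonzero. The rotated dual of [X] has the area density times the components of [X] as
    coefficients, so its closedness is the vanishing divergence of a Killing field. The covering
    asked for is onto an open image, so a local inverse makes it one-sheeted. *)

Section Calculus.
Context {R : realType}.

(** Uniqueness of the differential: an epsilon estimate against a candidate linear map yields
    differentiability and the value of the differential together. It serves the local inverse and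
    the primitive in Poincare's lemma. *)
Lemma littleo_diff (V W : normedModType R) (f : V -> W) (L : {linear V -> W})
    (x : V) : continuous L ->
  (forall e : R, 0 < e -> \forall h \near (0 : V),
     `|f (h + x) - f x - L h| <= e * `|h|) ->
  differentiable f x /\ 'd f x = L :> (V -> W).
Proof.
move=> cL Lo.
have fo : f \o shift x = cst (f x) + L +o_ (0 : V) id.
  apply/eqaddoP => e e0; have := Lo e e0; apply: filterS => h.
  by rewrite !fctE opprD addrA.
have dE := diff_unique cL fo.
split=> //; apply/diff_locallyP; split; first by rewrite dE.
by rewrite dE.
Qed.

Lemma derive_partial n (W : normedModType R) (f : 'rV[R]_n -> W) (x v : 'rV[R]_n) :
  differentiable f x -> 'D_v f x = \sum_i v 0 i *: partial i f x.
Proof.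
move=> df; rewrite deriveE// {1}[v]row_sum_delta linear_sum.
by apply: eq_bigr => i _; rewrite linearZ/= /partial deriveE.
Qed.

Lemma jacobianE n m (f : 'rV[R]_n -> 'rV[R]_m) x i j : differentiable f x ->
  'J f x i j = partial i (fun y => f y 0 j : R) x.
Proof.
move=> df; rewrite /partial derive_coord// deriveEjacobian//.
by rewrite -rowE [RHS]mxE.
Qed.

Lemma row_jacobian n m (f : 'rV[R]_n -> 'rV[R]_m) x i : differentiable f x ->
  row i ('J f x) = partial i f x.
Proof. by move=> df; rewrite rowE; exact: esym (deriveEjacobian _ df). Qed.

(** Differentials act on row vectors from the right, so the Jacobian of the inner map stands on the
    left. *)
Lemma jacobian_comp n m p (f : 'rV[R]_n -> 'rV[R]_m) (g : 'rV[R]_m -> 'rV[R]_p) x :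
  differentiable f x -> differentiable g (f x) ->
  'J (g \o f) x = 'J f x *m 'J g (f x).
Proof.
move=> df dg; apply/row_matrixP => i.
have dgf : differentiable (g \o f) x by exact: differentiable_comp.
rewrite row_mul; apply: eq_trans (row_jacobian i dgf) _.
rewrite /partial (deriveE _ dgf) diff_comp//=.
apply: eq_trans (esym (deriveE _ dg)) _.
apply: eq_trans (deriveEjacobian _ dg) _; congr (_ *m _).
by rewrite -(deriveE _ df); exact: esym (row_jacobian i df).
Qed.

Lemma near_eq_jacobian n m (f g : 'rV[R]_n -> 'rV[R]_m) (x : 'rV[R]_n) :
  differentiable f x -> {near x, f =1 g} -> 'J f x = 'J g x.
Proof.
move=> df fg; have dg := near_eq_differentiable fg df.
apply/row_matrixP => i; apply: eq_trans (row_jacobian i df) _.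
by apply: eq_trans _ (esym (row_jacobian i dg)); exact: near_eq_derive.
Qed.

Lemma jacobian_id n (x : 'rV[R]_n) : 'J id x = 1%:M.
Proof.
apply/row_matrixP => i; rewrite [RHS]rowE mulmx1.
apply: eq_trans (row_jacobian i (ex_diff (is_diff_def := is_diff_id x))) _.
exact: derive_id.
Qed.

Lemma partial_comp n m (f : 'rV[R]_n -> 'rV[R]_m) (g : 'rV[R]_m -> R) x i :
  differentiable f x -> differentiable g (f x) ->
  partial i (g \o f) x = \sum_j 'J f x i j * partial j g (f x).
Proof.
move=> df dg; have dgf : differentiable (g \o f) x by exact: differentiable_comp.
rewrite /partial (deriveE _ dgf) diff_comp//= -(deriveE _ dg) -(deriveE _ df).
rewrite (derive_partial _ dg); apply: eq_bigr => j _.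
by rewrite jacobianE// /partial derive_coord.
Qed.

Section PartialRules.
Context {n : nat}.
Implicit Types (f g : 'rV[R]_n -> R) (x : 'rV[R]_n) (i : 'I_n).

Lemma partialD f g i x : differentiable f x -> differentiable g x ->
  partial i (fun y => f y + g y) x = partial i f x + partial i g x.
Proof. by move=> df dg; rewrite /partial deriveD//; exact: diff_derivable. Qed.

Lemma partialN f i x : differentiable f x ->
  partial i (fun y => - f y) x = - partial i f x.
Proof. by move=> df; rewrite /partial deriveN//; exact: diff_derivable. Qed.

Lemma partialB f g i x : differentiable f x -> differentiable g x ->
  partial i (fun y => f y - g y) x = partial i f x - partial i g x.
Proof. by move=> df dg; rewrite /partial deriveB//; exact: diff_derivable. Qed.

Lemma partialM f g i x : differentiable f x -> differentiable g x ->
  partial i (fun y => f y * g y) x = partial i f x * g x + f x * partial i g x.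
Proof.
move=> df dg; rewrite /partial (_ : (fun y => _) = f * g)//.
rewrite deriveM; [|exact: diff_derivable|exact: diff_derivable].
by rewrite addrC; congr (_ + _); rewrite /GRing.scale/= mulrC.
Qed.

Lemma partialV f i x : f x != 0 -> differentiable f x ->
  partial i (fun y => (f y)^-1) x = - (f x)^-1 * (f x)^-1 * partial i f x.
Proof.
move=> f0 df; rewrite /partial deriveV//; last exact: diff_derivable.
by rewrite /GRing.scale/= !mulNr -invfM -expr2.
Qed.

Lemma partial_cst c i x : partial i (fun=> c : R) x = 0.
Proof. exact: derive_cst. Qed.

Lemma partial_sum (I : finType) (f : I -> 'rV[R]_n -> R) i x :
  (forall k, differentiable (f k) x) ->
  partial i (fun y => \sum_k f k y) x = \sum_k partial i (f k) x.
Proof.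
move=> df.
(* The induction must carry differentiability of the partial sums along with the formula. *)
suff [] : differentiable (fun y => \sum_k f k y) x /\
  partial i (fun y => \sum_k f k y) x = \sum_k partial i (f k) x by [].
elim: (index_enum I) => [|k s [IH1 IH2]].
  under eq_fun do rewrite big_nil.
  by rewrite big_nil partial_cst; split=> //; exact: differentiable_cst.
under eq_fun do rewrite big_cons.
by rewrite big_cons partialD// IH2; split=> //; exact: differentiableD.
Qed.

Lemma near_eq_partial (W : normedModType R) (f g : 'rV[R]_n -> W) i x :
  {near x, f =1 g} -> partial i f x = partial i g x.
Proof. exact: near_eq_derive. Qed.

Lemma open_eq_partial (W : normedModType R) (O : set 'rV[R]_n)
    (f g : 'rV[R]_n -> W) i x : open O -> O x -> (forall y, O y -> f y = g y) ->
  partial i f x = partial i g x.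
Proof.
move=> oO Ox fg; apply: near_eq_partial.
by apply: filterS (open_nbhs_nbhs (conj oO Ox)) => y /fg.
Qed.

End PartialRules.
End Calculus.

(** * Closure properties of smooth maps *)

Section Smooth.
Context {R : realType}.
Implicit Types (V W : normedModType R) (n : nat).

Lemma diff_orderSP n W k (O : set 'rV[R]_n) (f : 'rV[R]_n -> W) :
  diff_order k.+1 O f -> (forall x, O x -> differentiable f x) /\
                         (forall i, diff_order k O (partial i f)).
Proof. by []. Qed.

Lemma diff_orderS n W k (O : set 'rV[R]_n) (f : 'rV[R]_n -> W) :
  diff_order k.+1 O f -> diff_order k O f.
Proof.
by elim: k f => // k IH f [df Df]; split=> // i; exact: IH (Df i).
Qed.

Lemma diff_order_sub n W k (O O' : set 'rV[R]_n) (f : 'rV[R]_n -> W) :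
  O' `<=` O -> diff_order k O f -> diff_order k O' f.
Proof.
move=> O'O; elim: k f => //= k IH f [df Df].
by split=> [x /O'O/df|i]//; exact: IH.
Qed.

Lemma diff_orderM n k (O : set 'rV[R]_n) (f g : 'rV[R]_n -> R) : open O ->
  diff_order k O f -> diff_order k O g -> diff_order k O (fun x => f x * g x).
Proof.
move=> oO; elim: k f g => // k IH f g fk gk.
have [df Df] := diff_orderSP fk; have [dg Dg] := diff_orderSP gk.
split=> [x Ox|i]; first by apply: differentiableM; [exact: df|exact: dg].
apply: (eq_diff_order oO (f := fun x => partial i f x * g x + f x * partial i g x)).
  by move=> x Ox; rewrite partialM//; [exact: df|exact: dg].
by apply: diff_orderD => //; apply: IH; rewrite //; exact: diff_orderS.
Qed.

(** Induction on the order: a partial of [f^-1] is a product of [f^-1] with itself and a partial of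
    [f], all of order [k] by the induction hypothesis. *)
Lemma diff_orderV n k (O : set 'rV[R]_n) (f : 'rV[R]_n -> R) : open O ->
  (forall x, O x -> f x != 0) ->
  diff_order k O f -> diff_order k O (fun x => (f x)^-1).
Proof.
move=> oO f0; elim: k => // k IH fk; have [df Df] := diff_orderSP fk.
split=> [x Ox|i]; first by apply: differentiableV; [exact: df|exact: f0].
have fV := IH (diff_orderS fk).
apply: (eq_diff_order oO
  (f := fun x => (-1) *: ((f x)^-1 * (f x)^-1 * partial i f x))).
  move=> x Ox; rewrite partialV//; [|exact: f0|exact: df].
  by rewrite scaleN1r !mulNr.
by apply: diff_orderZ => //; do 2 (apply: diff_orderM => //).
Qed.

Lemma smoothS n W (O O' : set 'rV[R]_n) (f : 'rV[R]_n -> W) :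
  O' `<=` O -> smooth O f -> smooth O' f.
Proof. by move=> O'O fO k; exact: diff_order_sub O'O (fO k). Qed.

Lemma eq_smooth n W (O : set 'rV[R]_n) (f g : 'rV[R]_n -> W) : open O ->
  (forall x, O x -> f x = g x) -> smooth O f -> smooth O g.
Proof. by move=> oO fg fO k; exact: eq_diff_order fg (fO k). Qed.

Lemma smooth_differentiable n W (O : set 'rV[R]_n) (f : 'rV[R]_n -> W) x :
  smooth O f -> O x -> differentiable f x.
Proof. by move=> fO; exact: (fO 1).1. Qed.

Lemma smooth_continuous n W (O : set 'rV[R]_n) (f : 'rV[R]_n -> W) x :
  smooth O f -> O x -> {for x, continuous f}.
Proof. by move=> fO Ox; exact/differentiable_continuous/smooth_differentiable/Ox. Qed.

Lemma smooth_partial n W (O : set 'rV[R]_n) (f : 'rV[R]_n -> W) i :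
  smooth O f -> smooth O (partial i f).
Proof. by move=> fO k; exact: (fO k.+1).2. Qed.

Section Rules.
Context {n : nat} (O : set 'rV[R]_n) (oO : open O).
Implicit Types (f g : 'rV[R]_n -> R).

Lemma smooth_cst W (w : W) : smooth O (fun=> w).
Proof. by move=> k; exact: diff_order_cst. Qed.

Lemma smoothD W (f g : 'rV[R]_n -> W) : smooth O f -> smooth O g ->
  smooth O (fun x => f x + g x).
Proof. by move=> fO gO k; exact: diff_orderD. Qed.

Lemma smoothZ W (f : 'rV[R]_n -> W) c : smooth O f -> smooth O (fun x => c *: f x).
Proof. by move=> fO k; exact: diff_orderZ. Qed.

Lemma smoothN W (f : 'rV[R]_n -> W) : smooth O f -> smooth O (fun x => - f x).
Proof.
by move=> fO; apply: eq_smooth (smoothZ (-1) fO) => // x _; rewrite scaleN1r.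
Qed.

Lemma smoothB W (f g : 'rV[R]_n -> W) : smooth O f -> smooth O g ->
  smooth O (fun x => f x - g x).
Proof. by move=> fO gO; apply: smoothD => //; exact: smoothN. Qed.

Lemma smooth_sum W (I : finType) (f : I -> 'rV[R]_n -> W) :
  (forall i, smooth O (f i)) -> smooth O (fun x => \sum_i f i x).
Proof. by move=> fO k; apply: diff_order_sum => // i; exact: fO. Qed.

Lemma smoothM f g : smooth O f -> smooth O g -> smooth O (fun x => f x * g x).
Proof. by move=> fO gO k; exact: diff_orderM. Qed.

Lemma smooth_prod (I : finType) (f : I -> 'rV[R]_n -> R) :
  (forall i, smooth O (f i)) -> smooth O (fun x => \prod_i f i x).
Proof.
move=> fO; elim: (index_enum I) => [|i s IH].
  by under eq_fun do rewrite big_nil; exact: smooth_cst.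
by under eq_fun do rewrite big_cons; exact: smoothM.
Qed.

Lemma smoothV f : (forall x, O x -> f x != 0) -> smooth O f ->
  smooth O (fun x => (f x)^-1).
Proof. by move=> f0 fO k; exact: diff_orderV. Qed.

Lemma smooth_coord p q (F : 'rV[R]_n -> 'M[R]_(p, q)) i j :
  smooth O F -> smooth O (fun x => F x i j : R).
Proof. by move=> FO k; exact: diff_order_coord. Qed.

Lemma smooth_mx p q (F : 'rV[R]_n -> 'M[R]_(p, q)) :
  (forall i j, smooth O (fun x => F x i j : R)) -> smooth O F.
Proof. by move=> FO k; apply: diff_order_mx => // i j; exact: FO. Qed.

Lemma smooth_id : smooth O (fun x : 'rV[R]_n => x).
Proof.
move=> [|k]//; split=> [x _|i].
  exact: (ex_diff (is_diff_def := is_diff_id x)).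
apply: (eq_diff_order oO _ (diff_order_cst k (delta_mx 0 i : 'rV[R]_n) oO)) => x _.
by rewrite /partial derive_id.
Qed.

Lemma smooth_mulmx p q r (F : 'rV[R]_n -> 'M[R]_(p, q))
    (G : 'rV[R]_n -> 'M[R]_(q, r)) :
  smooth O F -> smooth O G -> smooth O (fun x => F x *m G x).
Proof.
move=> FO GO; apply: smooth_mx => i j.
under eq_fun do rewrite mxE.
by apply: smooth_sum => k; apply: smoothM; exact: smooth_coord.
Qed.

Lemma smooth_trmx p q (F : 'rV[R]_n -> 'M[R]_(p, q)) :
  smooth O F -> smooth O (fun x => (F x)^T).
Proof.
move=> FO; apply: smooth_mx => i j.
by under eq_fun do rewrite mxE; exact: smooth_coord.
Qed.

Lemma smooth_det p (F : 'rV[R]_n -> 'M[R]_p) :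
  smooth O F -> smooth O (fun x => \det (F x)).
Proof.
move=> FO; rewrite /determinant; apply: smooth_sum => s.
apply: smoothM; first exact: smooth_cst.
by apply: smooth_prod => i; exact: smooth_coord.
Qed.

(** Cramer's rule: the entries are cofactors divided by the determinant. *)
Lemma smooth_invmx p (F : 'rV[R]_n -> 'M[R]_p) :
  (forall x, O x -> F x \in unitmx) -> smooth O F ->
  smooth O (fun x => invmx (F x)).
Proof.
move=> FU FO; apply: smooth_mx => i j.
apply: (eq_smooth (f := fun x => (\det (F x))^-1 * cofactor (F x) j i)) => //.
  by move=> x Ox; rewrite /invmx FU// !mxE.
apply: smoothM.
  apply: smoothV; last exact: smooth_det.
  by move=> x /FU; rewrite unitmxE unitfE.
rewrite /cofactor; apply: smoothM; first exact: smooth_cst.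
apply: smooth_det.
apply: smooth_mx => k l; under eq_fun do rewrite !mxE.
exact: smooth_coord.
Qed.

Lemma smooth_jacobian p (F : 'rV[R]_n -> 'rV[R]_p) :
  smooth O F -> smooth O (fun x => 'J F x : 'M[R]_(n, p)).
Proof.
move=> FO; apply: smooth_mx => i j.
apply: (eq_smooth (f := partial i (fun y => F y 0 j : R))) => //.
  by move=> x Ox; rewrite jacobianE//; exact: smooth_differentiable FO Ox.
exact/smooth_partial/smooth_coord.
Qed.

End Rules.

(** The induction keeps [f] fixed and varies [g]: the chain rule writes a partial of [g \o f] with
    coefficients from [f] and factors [partial j g \o f], to which the induction hypothesis
    applies. *)
Lemma diff_order_comp_real n m k (O : set 'rV[R]_n) (O' : set 'rV[R]_m)
    (f : 'rV[R]_n -> 'rV[R]_m) (g : 'rV[R]_m -> R) : open O ->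
  (forall x, O x -> O' (f x)) -> diff_order k O f -> diff_order k O' g ->
  diff_order k O (g \o f).
Proof.
move=> oO fO; elim: k g => // k IH g fk gk.
have [df Df] := diff_orderSP fk; have [dg Dg] := diff_orderSP gk.
split=> [x Ox|i].
  by apply: differentiable_comp; [exact: df|exact/dg/fO].
apply: (@eq_diff_order _ _ _ _ _
  (fun x => \sum_j partial i f x 0 j * (partial j g \o f) x)) => //.
  move=> x Ox; have dfx := df x Ox; have dgx := dg _ (fO x Ox).
  rewrite partial_comp//; apply: eq_bigr => j _.
  by rewrite jacobianE// /partial derive_coord.
apply: diff_order_sum => // j; apply: diff_orderM => //.
  exact: diff_order_coord.
by apply: IH => //; exact: diff_orderS.
Qed.

Lemma smooth_comp n m p q (O : set 'rV[R]_n) (O' : set 'rV[R]_m)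
    (f : 'rV[R]_n -> 'rV[R]_m) (g : 'rV[R]_m -> 'M[R]_(p, q)) : open O -> open O' ->
  (forall x, O x -> O' (f x)) -> smooth O f -> smooth O' g -> smooth O (g \o f).
Proof.
move=> oO oO' fO fs gs; apply: smooth_mx => // i j k.
apply: (diff_order_comp_real (g := fun y => g y i j) oO fO (fs k)).
exact: smooth_coord gs k.
Qed.

Lemma smooth_comp_real n m (O : set 'rV[R]_n) (O' : set 'rV[R]_m)
    (f : 'rV[R]_n -> 'rV[R]_m) (g : 'rV[R]_m -> R) : open O ->
  (forall x, O x -> O' (f x)) -> smooth O f -> smooth O' g -> smooth O (g \o f).
Proof. by move=> oO fO fs gs k; exact: diff_order_comp_real (fs k) (gs k). Qed.

End Smooth.

(** * Mean value estimates and Schwarz's theorem *)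

(** Row vectors as a complete normed space, for the fixed point argument in the inverse function
    theorem. *)
HB.instance Definition _ (R : realType) n := Complete.copy 'rV[R]_n 'rV[R]_n.

Section MeanValue.
Context {R : realType}.

Lemma mx_norm_entry m n (A : 'M[R]_(m, n)) i j : `|A i j| <= `|A|.
Proof.
rewrite [leRHS]mx_normrE.
exact: (le_bigmax _ (fun ij => `|A ij.1 ij.2|) (i, j)).
Qed.

Lemma mx_norm_leP m n (A : 'M[R]_(m, n)) (c : R) : 0 <= c ->
  (forall i j, `|A i j| <= c) -> `|A| <= c.
Proof.
move=> c0 Ac; rewrite [leLHS]mx_normrE.
by apply: bigmax_le => // -[i j] _; exact: Ac.
Qed.

Lemma norm_delta_mx n (i : 'I_n) : `|delta_mx 0 i : 'rV[R]_n| <= 1.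
Proof.
apply: mx_norm_leP => // k l; rewrite mxE.
by case: (_ && _); rewrite ?normr1 ?normr0.
Qed.

Lemma norm_mulmx_le n m (A : 'M[R]_(n, m)) (v : 'rV[R]_n) :
  `|v *m A| <= n%:R * `|A| * `|v|.
Proof.
apply: mx_norm_leP => [|k l]; first by rewrite !mulr_ge0.
rewrite mxE; apply: (le_trans (ler_norm_sum _ _ _)).
apply: (@le_trans _ _ (\sum_(j < n) `|A| * `|v|)).
  apply: ler_sum => j _; rewrite normrM mulrC.
  by apply: ler_pM => //; exact: mx_norm_entry.
by rewrite sumr_const card_ord -[leLHS]mulr_natl mulrA.
Qed.

Lemma ball_segment n (c x y : 'rV[R]_n) (r t : R) : ball c r x -> ball c r y ->
  0 <= t <= 1 -> ball c r (x + t *: (y - x)).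
Proof.
rewrite -ball_normE/= => cx cy /andP[t0 t1].
have -> : c - (x + t *: (y - x)) = (1 - t) *: (c - x) + t *: (c - y).
  by apply/matrixP => i j; rewrite !mxE; ring.
apply: (le_lt_trans (ler_normD _ _)).
rewrite !normrZ (ger0_norm t0) ger0_norm ?subr_ge0//.
(* The strict inequality is taken from the second term of the convex combination, which needs [t]
   positive. *)
have [-> |tN0] := eqVneq t 0; first by rewrite subr0 mul0r addr0 mul1r.
have tp : 0 < t by rewrite lt_neqAle eq_sym tN0.
apply: (@lt_le_trans _ _ ((1 - t) * r + t * r)); last by rewrite -mulrDl subrK mul1r.
by apply: ler_ltD; [rewrite ler_wpM2l ?subr_ge0// ltW|rewrite ltr_pM2l].
Qed.

Lemma is_derive_line n (f : 'rV[R]_n -> R) (x v : 'rV[R]_n) (t : R) :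
  differentiable f (x + t *: v) ->
  is_derive t 1 (fun s : R => f (x + s *: v)) ('D_v f (x + t *: v)).
Proof.
move=> df; have dv : derivable f (x + t *: v) v by exact: diff_derivable.
have E : (fun h : R => h^-1 *: (f (x + (h *: (1 : R) + t) *: v) - f (x + t *: v))) =
         (fun h : R => h^-1 *: (f (h *: v + (x + t *: v)) - f (x + t *: v))).
  apply/funext => h; congr (_ *: (f _ - _)).
  by rewrite [h *: 1]mulr1 scalerDl addrCA.
by split; [rewrite /derivable E|rewrite /derive E].
Qed.

Lemma mvt_line n (f : 'rV[R]_n -> R) (x v : 'rV[R]_n) (h : R) : 0 < h ->
  (forall t : R, 0 <= t <= h -> differentiable f (x + t *: v)) ->
  exists2 t : R, 0 < t < h & f (x + h *: v) - f x = h * 'D_v f (x + t *: v).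
Proof.
move=> h0 df.
have [||t] := MVT (f := fun s : R => f (x + s *: v))
  (df := fun t => 'D_v f (x + t *: v)) h0.
- move=> t; rewrite in_itv/= => /andP[t0 th]; apply: is_derive_line.
  by apply: df; rewrite !ltW.
- apply: derivable_within_continuous => t; rewrite in_itv/= => th.
  by have [] := is_derive_line (df t th).
rewrite in_itv/= scale0r addr0 subr0 => th ->.
by exists t => //; rewrite mulrC.
Qed.

(** No order between [s] and [t] is assumed, and the intermediate point is no farther from [s] than
    [t] is; this proximity turns Lipschitz bounds into quadratic errors in Poincare's lemma. *)
Lemma mean_value (f df : R -> R) (a b s t : R) :
  (forall x, a < x < b -> is_derive x 1 f (df x)) ->
  a < s < b -> a < t < b ->
  exists x, [/\ a < x < b, `|x - s| <= `|t - s| & f t - f s = (t - s) * df x].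
Proof.
move=> dff.
have core u v : u <= v -> a < u < b -> a < v < b ->
    exists2 x, u <= x <= v & f v - f u = (v - u) * df x.
  move=> uv /andP[au ub] /andP[av vb].
  have inab x : u <= x <= v -> a < x < b.
    by move=> /andP[ux xv]; rewrite (lt_le_trans au ux) (le_lt_trans xv vb).
  have [||x] := MVT_segment (f := f) (df := df) uv.
  - by move=> x; rewrite in_itv/= => /andP[? ?]; apply/dff/inab; rewrite !ltW.
  - apply: derivable_within_continuous => x; rewrite in_itv/= => xuv.
    by have [] := dff x (inab x xuv).
  by rewrite in_itv/= => xuv ->; exists x => //; rewrite mulrC.
move=> hs ht; have /andP[as_ sb] := hs; have /andP[at_ tb] := ht.
have [st|/ltW ts] := leP s t.
  have [x /andP[sx xt] E] := core s t st hs ht; exists x; split=> //.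
    by rewrite (lt_le_trans as_ sx) (le_lt_trans xt tb).
  by rewrite !ger0_norm ?subr_ge0// lerD2r.
have [x /andP[tx xs] E] := core t s ts ht hs; exists x; split.
- by rewrite (lt_le_trans at_ tx) (le_lt_trans xs sb).
- by rewrite distrC (distrC t) !ger0_norm ?subr_ge0// lerD2l lerN2.
- by rewrite -opprB E -mulNr opprB.
Qed.

Lemma mvt_partial n (f : 'rV[R]_n -> R) (x : 'rV[R]_n) i (h : R) : 0 < h ->
  (forall t : R, 0 <= t <= h -> differentiable f (x + t *: delta_mx 0 i)) ->
  exists2 t : R, 0 < t < h &
    f (x + h *: delta_mx 0 i) - f x = h * partial i f (x + t *: delta_mx 0 i).
Proof. exact: mvt_line. Qed.

(** The factor [n] comes from the sup norm: the derivative along [y - x] is a sum of [n] terms, each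
    at most [C * |y - x|]. *)
Lemma lipschitz_on_ball n (g : 'rV[R]_n -> R) (c : 'rV[R]_n) (r C : R) :
  0 <= C -> (forall x, ball c r x -> differentiable g x) ->
  (forall x, ball c r x -> forall i, `|partial i g x| <= C) ->
  forall x y, ball c r x -> ball c r y -> `|g y - g x| <= n%:R * C * `|y - x|.
Proof.
move=> C0 dg gC x y cx cy.
have [|t /andP[t0 t1]] := mvt_line (f := g) (x := x) (v := y - x) ltr01.
  by move=> t t01; apply: dg; exact: ball_segment.
have cz : ball c r (x + t *: (y - x)) by apply: ball_segment; rewrite // !ltW.
rewrite scale1r subrKC mul1r => ->; rewrite (derive_partial _ (dg _ cz)).
apply: (le_trans (ler_norm_sum _ _ _)).
apply: (@le_trans _ _ (\sum_(i < n) C * `|y - x|)); last first.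
  by rewrite sumr_const card_ord -[leLHS]mulr_natl mulrA.
apply: ler_sum => i _; rewrite normrZ mulrC; apply: ler_pM => //; first exact: gC.
exact: mx_norm_entry.
Qed.

Lemma lipschitz_mx_on_ball n m (g : 'rV[R]_n -> 'rV[R]_m) (c : 'rV[R]_n) (r C : R) :
  0 <= C -> (forall x, ball c r x -> differentiable g x) ->
  (forall x, ball c r x -> forall i j, `|'J g x i j| <= C) ->
  forall x y, ball c r x -> ball c r y -> `|g y - g x| <= n%:R * C * `|y - x|.
Proof.
move=> C0 dg gC x y cx cy; apply: mx_norm_leP => [|k j].
  by rewrite !mulr_ge0.
rewrite (ord1 k) {k} [(g y - g x) 0 j]mxE [(- g x) 0 j]mxE.
apply: (@lipschitz_on_ball _ (fun y => g y 0 j : R) c r) => // z cz.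
  exact: differentiable_comp (dg z cz) (differentiable_coord (g z) 0 j).
by move=> i; rewrite -jacobianE; [exact: gC|exact: dg].
Qed.

Lemma smooth_locally_lipschitz n (O : set 'rV[R]_n) (f : 'rV[R]_n -> R) c :
  open O -> smooth O f -> O c -> exists (r L : R), [/\ 0 < r, 0 <= L, ball c r `<=` O &
    forall x y, ball c r x -> ball c r y -> `|f y - f x| <= L * `|y - x|].
Proof.
move=> oO fO Oc.
(* Near [c] each partial stays within 1 of its value at [c]; [S] dominates all these bounds at
   once. *)
pose S := \sum_i (`|partial i f c| + 1).
have S0 : 0 <= S by apply: sumr_ge0 => i _; exact: addr_ge0.
have : nbhs c (O `&` [set x | forall i, `|partial i f x| < `|partial i f c| + 1]).
  apply: filterI; first exact: open_nbhs_nbhs.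
  apply: (filter_forall (F := nbhs c)
    (f := fun i => [set x | `|partial i f x| < `|partial i f c| + 1])) => i.
  have ci := smooth_continuous (smooth_partial i fO) Oc.
  move/cvgrPdist_lt: ci => /(_ 1 ltr01); apply: filterS => x /= cx.
  have := ler_distD (partial i f c) (partial i f x) 0.
  by rewrite !subr0 distrC => /le_lt_trans; apply; rewrite addrC ltrD2l.
move=> /nbhs_ballP[r /= r0 rO]; exists r, (n%:R * S).
split=> //; [by rewrite mulr_ge0|by move=> x /rO[]|].
apply: lipschitz_on_ball => //.
  by move=> x /rO[Ox _]; exact: smooth_differentiable fO Ox.
move=> x /rO[_ /= Sx] i; apply: le_trans (ltW (Sx i)) _.
rewrite /S (bigD1 i)//= lerDl; apply: sumr_ge0 => j _; exact: addr_ge0.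
Qed.

Lemma differentiable_shift (V W : normedModType R) (f : V -> W) (x v : V) :
  differentiable f (x + v) -> differentiable (fun y => f (y + v)) x.
Proof.
move=> df; have dv : differentiable (shift v) x.
  by apply: differentiableD => //; exact: differentiable_cst.
exact: (@differentiable_comp _ _ _ _ (shift v) f x dv df).
Qed.

Lemma partial_shift n (f : 'rV[R]_n -> R) (x v : 'rV[R]_n) i :
  partial i (fun y => f (y + v)) x = partial i f (x + v).
Proof.
rewrite /partial /derive /=.
by under eq_fun do rewrite -addrA.
Qed.

(** Two mean value theorems, along [e_i] for the difference of [f] in direction [e_j], then along
    [e_j] for [partial i f]. The left side is symmetric in [i] and [j], which is the point. The
    condition [2 * h < r] keeps the parallelogram in the ball, also when [i = j]. *)
Lemma second_difference n (O : set 'rV[R]_n) (f : 'rV[R]_n -> R) (x : 'rV[R]_n)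
    i j (r h : R) : open O -> smooth O f -> ball x r `<=` O -> 0 < h -> 2 * h < r ->
  exists2 p, ball x r p &
    f (x + h *: delta_mx 0 i + h *: delta_mx 0 j) - f (x + h *: delta_mx 0 i)
    - f (x + h *: delta_mx 0 j) + f x = h ^+ 2 * partial j (partial i f) p.
Proof.
move=> oO fO rO h0 hr; set ei := delta_mx 0 i; set ej := delta_mx 0 j.
have inr s t : 0 <= s <= h -> 0 <= t <= h -> ball x r (x + s *: ei + t *: ej).
  move=> /andP[s0 sh] /andP[t0 th]; rewrite -ball_normE/= -addrA opprD addNKr normrN.
  apply: le_lt_trans hr; apply: (le_trans (ler_normD _ _)).
  rewrite !normrZ !ger0_norm// mulrDl mul1r; apply: lerD.
    by rewrite -[leRHS]mulr1; apply: ler_pM => //; exact: norm_delta_mx.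
  by rewrite -[leRHS]mulr1; apply: ler_pM => //; exact: norm_delta_mx.
have hh : 0 <= h <= h by rewrite ltW ?lexx.
have zh : 0 <= (0 : R) <= h by rewrite lexx ltW.
have df y : ball x r y -> differentiable f y.
  by move=> /rO; exact: smooth_differentiable fO.
have dg s : 0 <= s <= h ->
    differentiable (fun y => f (y + h *: ej) - f y) (x + s *: ei).
  move=> sh; apply: differentiableB; last first.
    by apply: df; have := inr s 0 sh zh; rewrite scale0r addr0.
  by apply: differentiable_shift; exact/df/inr.
have [s sh E1] := mvt_partial h0 dg.
have sh' : 0 <= s <= h by move/andP: sh => [? ?]; rewrite !ltW.
have dpf t : 0 <= t <= h -> differentiable (partial i f) (x + s *: ei + t *: ej).
  by move=> th; apply: smooth_differentiable (smooth_partial i fO) _; exact/rO/inr.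
have [t th E2] := mvt_partial h0 dpf.
have th' : 0 <= t <= h by move/andP: th => [? ?]; rewrite !ltW.
exists (x + s *: ei + t *: ej); first exact: inr.
rewrite expr2 -mulrA -E2; move: E1.
rewrite (@partialB _ _ (fun y => f (y + h *: ej)) f); last 2 first.
- by apply: differentiable_shift; exact/df/inr.
- by apply: df; have := inr s 0 sh' zh; rewrite scale0r addr0.
rewrite partial_shift.
move=> <-; rewrite -/ei; ring.
Qed.

Lemma dist_half_disjoint (s t u : R) :
  `|s - u| < (s - t) / 2 -> `|t - u| < (s - t) / 2 -> False.
Proof. by rewrite !ltr_norml => /andP[? ?] /andP[? ?]; lra. Qed.

Lemma partialC n (O : set 'rV[R]_n) (f : 'rV[R]_n -> R) (x : 'rV[R]_n) i j :
  open O -> smooth O f -> O x ->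
  partial i (partial j f) x = partial j (partial i f) x.
Proof.
move=> oO fO Ox; apply/eqP; rewrite eq_le.
(* One inequality for arbitrary [i] and [j] gives the other by exchanging them. *)
wlog suff : i j / partial i (partial j f) x <= partial j (partial i f) x.
  by move=> le_; apply/andP; split; exact: le_.
rewrite leNgt; apply/negP => lt_.
set a := partial i _ x in lt_; set b := partial j _ x in lt_.
have e0 : 0 < (a - b) / 2 by rewrite divr_gt0// subr_gt0.
have ca := smooth_continuous (smooth_partial i (smooth_partial j fO)) Ox.
have cb := smooth_continuous (smooth_partial j (smooth_partial i fO)) Ox.
have : nbhs x (O `&` [set y | `|a - partial i (partial j f) y| < (a - b) / 2]
   `&` [set y | `|b - partial j (partial i f) y| < (a - b) / 2]).
  apply: filterI; first apply: filterI.
  - exact: open_nbhs_nbhs.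
  - by move/cvgrPdist_lt: ca; exact.
  - by move/cvgrPdist_lt: cb; exact.
move=> /nbhs_ballP[r /= r0 rO].
have h0 : 0 < r / 4 by rewrite divr_gt0.
have hr : 2 * (r / 4) < r by lra.
have rO' : ball x r `<=` O by move=> y /rO[[]].
have [p rp Ep] := second_difference i j oO fO rO' h0 hr.
have [q rq Eq] := second_difference j i oO fO rO' h0 hr.
have [[_ _] /= Bp] := rO p rp; have [[_ /= Aq] _] := rO q rq.
have r2 : (r / 4) ^+ 2 != 0 by rewrite lt0r_neq0// exprn_gt0.
have swp : x + (r / 4) *: delta_mx 0 j + (r / 4) *: delta_mx 0 i =
           x + (r / 4) *: delta_mx 0 i + (r / 4) *: delta_mx 0 j by exact: addrAC.
rewrite swp in Eq.
(* Exchanging [i] and [j] does not change the second difference, so the two mixed partials agree at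
   [p] and [q]; yet there they lie within half the gap of the different values [b] and [a]. *)
have pq : partial j (partial i f) p = partial i (partial j f) q.
  apply: (mulfI r2); apply: eq_trans (esym Ep) _; apply: eq_trans _ Eq.
  by congr (_ + f x); exact: addrAC.
by rewrite pq in Bp; exact: dist_half_disjoint Aq Bp.
Qed.

End MeanValue.

(** * Inverse function theorem *)

Section InverseFunction.
Context {R : realType} {n : nat}.

Lemma differentiable_littleo (V W : normedModType R) (f : V -> W) (x : V) (e : R) :
  differentiable f x -> 0 < e ->
  \forall h \near (0 : V), `|f (h + x) - f x - 'd f x h| <= e * `|h|.
Proof.
move=> df e0; have [_ /eqaddoP fo] := (diff_locallyP x f).1 df.
by have := fo e e0; apply: filterS => h; rewrite !fctE opprD addrA.
Qed.

Lemma mulmxr_continuous m p (B : 'M[R]_(m, p)) :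
  continuous (mulmxr B : 'rV[R]_m -> 'rV[R]_p).
Proof.
move=> x; apply: (smooth_continuous (O := setT)) => //.
by apply: smooth_mulmx; [exact: openT|exact/smooth_id/openT|exact/smooth_cst/openT].
Qed.

Lemma mulmx_jacobian m (f : 'rV[R]_n -> 'rV[R]_m) x v : differentiable f x ->
  v *m 'J f x = 'd f x v.
Proof. by move=> df; rewrite -(deriveE _ df); exact: esym (deriveEjacobian _ df). Qed.

Lemma jacobianB m (f g : 'rV[R]_n -> 'rV[R]_m) x :
  differentiable f x -> differentiable g x ->
  'J (fun y => f y - g y) x = 'J f x - 'J g x.
Proof.
move=> df dg; have dfg : differentiable (fun y => f y - g y) x.
  exact: differentiableB.
apply/row_matrixP => i; rewrite [RHS]raddfB/=.
apply: eq_trans (row_jacobian i dfg) _.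
rewrite /partial deriveB; [|exact: diff_derivable|exact: diff_derivable].
by congr (_ - _); apply/esym/row_jacobian.
Qed.

Lemma jacobian_mulmxr m (B : 'M[R]_(n, m)) x : 'J (fun y => y *m B) x = B.
Proof.
pose L : {linear 'rV[R]_n -> 'rV[R]_m} := mulmxr B.
have cL : continuous L by exact: mulmxr_continuous.
apply/row_matrixP => i; rewrite rowE (mulmx_jacobian (f := L)).
  by rewrite (diff_lin _ cL) /= -rowE.
exact: linear_differentiable.
Qed.

Section LocalInverse.
Variables (f : 'rV[R]_n -> 'rV[R]_n) (U : set 'rV[R]_n) (K : R) (g : 'rV[R]_n -> 'rV[R]_n).
Hypotheses (oU : open U) (oV : open (f @` U)) (fU : smooth U f).
Hypothesis K0 : 0 <= K.
Hypothesis fK : forall x y, U x -> U y -> `|y - x| <= K * `|f y - f x|.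
Hypothesis Jf : forall x, U x -> 'J f x \in unitmx.
Hypothesis gK : forall x, U x -> g (f x) = x.

(** The bound [fK] turns an error small against [|y - x|] into one small against [|f y - f x|], so
    inverting the linear approximation of [f] gives that of [g]. *)
Lemma local_inverse_diff x : U x ->
  differentiable g (f x) /\ 'J g (f x) = invmx ('J f x).
Proof.
move=> Ux; set J := 'J f x; have JU : J \in unitmx by exact: Jf.
have dfx : differentiable f x by exact: smooth_differentiable fU Ux.
pose L : {linear 'rV[R]_n -> 'rV[R]_n} := mulmxr (invmx J).
have cL : continuous L by exact: mulmxr_continuous.
have [|dg dgE] := @littleo_diff _ _ _ g L (f x) cL.
  (* [C] collects the factors lost on the way, the norm of the inverse matrix and the Lipschitz
     constant of the inverse; the added 1 keeps it positive. *)
  move=> e e0; set C := n%:R * `|invmx J| * K + 1.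
  have C0 : 0 < C by rewrite ltr_wpDl// !mulr_ge0.
  have eC : 0 < e / C by rewrite divr_gt0.
  have /nbhs_ballP[d /= d0 dP] := differentiable_littleo dfx eC.
  have Vx : \forall h \near (0 : 'rV[R]_n), (f @` U) (h + f x).
    have : \forall y \near f x, (f @` U) y.
      by apply: open_nbhs_nbhs; split=> //; exists x.
    by rewrite (near_shift 0 (f x))/= subr0.
  (* For [h] below this bound the preimage is within [d] of [x]; [K + 1] avoids dividing by zero. *)
  have Kd : 0 < d / (K + 1) by rewrite divr_gt0// ltr_wpDl.
  near=> h.
  have [y Uy fy] : (f @` U) (h + f x) by near: h.
  have hE : h = f y - f x by rewrite fy addrK.
  have yx := fK Ux Uy; rewrite -hE in yx.
  have /dP : ball 0 d (y - x).
    rewrite -ball_normE/= sub0r normrN; apply: le_lt_trans yx _.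
    apply: (@le_lt_trans _ _ (K * (d / (K + 1)))).
      rewrite ler_wpM2l// ltW//; near: h; exact: nbhs0_lt.
    by rewrite mulrA ltr_pdivrMr ?ltr_wpDl// mulrC ltr_pM2l// ltrDl.
  rewrite /= subrK -hE -(mulmx_jacobian _ dfx) -/J => hP.
  rewrite -fy !gK// /mulmxr.
  have -> : y - x - h *m invmx J = - ((h - (y - x) *m J) *m invmx J).
    by rewrite mulmxBl mulmxK// opprB.
  rewrite normrN; apply: le_trans (norm_mulmx_le _ _) _.
  apply: (@le_trans _ _ (n%:R * `|invmx J| * (e / C * (K * `|h|)))).
    rewrite ler_wpM2l ?mulr_ge0//; apply: (le_trans hP).
    by rewrite ler_wpM2l// ltW.
  have nC : n%:R * `|invmx J| * K * C^-1 <= 1.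
    by rewrite ler_pdivrMr// mul1r /C lerDl.
  apply: (@le_trans _ _ (e * `|h| * (n%:R * `|invmx J| * K * C^-1))).
    by move: (C^-1) => c; rewrite le_eqVlt; apply/orP; left; apply/eqP; ring.
  by rewrite ler_piMr// mulr_ge0// ltW.
split=> //; apply/row_matrixP => i; rewrite rowE (mulmx_jacobian _ dg) dgE /=.
by rewrite -rowE.
Unshelve. all: by end_near. Qed.

(** Bootstrapping: the partials of [g] are entries of the inverse Jacobian of [f] composed with [g],
    so order [k] for [g] gives order [k] for its partials. *)
Lemma local_inverse_smooth : smooth (f @` U) g.
Proof.
have dg y : (f @` U) y -> differentiable g y.
  by move=> [x Ux <-]; exact: (local_inverse_diff Ux).1.
have gV y : (f @` U) y -> U (g y) by move=> [x Ux <-]; rewrite gK.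
elim=> // k IH; split=> // i.
apply: diff_order_mx => // i' j.
apply: (@eq_diff_order _ _ _ _ _ ((fun x => invmx ('J f x) i j) \o g)) => //.
  move=> y [x Ux <-]; rewrite /= gK// (ord1 i').
  have [dgx <-] := local_inverse_diff Ux.
  by rewrite -(row_jacobian i dgx) [RHS]mxE.
apply: (diff_order_comp_real (f := g) oV gV IH).
have := smooth_invmx oU Jf (smooth_jacobian oU fU).
by move=> /(smooth_coord oU i j); exact.
Qed.

End LocalInverse.

Lemma inverse_function (O : set 'rV[R]_n) (f : 'rV[R]_n -> 'rV[R]_n) x0 :
  open O -> smooth O f -> O x0 -> 'J f x0 \in unitmx ->
  exists (U : set 'rV[R]_n) (g : 'rV[R]_n -> 'rV[R]_n),
    [/\ open U, U x0, U `<=` O & open (f @` U)] /\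
    [/\ forall x, U x -> g (f x) = x, smooth (f @` U) g &
        forall x, U x -> 'J f x \in unitmx].
Proof.
move=> oO fO Ox0 J0; set B := invmx ('J f x0).
have sJ := smooth_jacobian oO fO.
(* Newton's map with the derivative frozen at [x0]: the fixed points of [T + y *m B] are the
   solutions of [f x = y], and [T] has zero Jacobian at [x0]. *)
pose T x := x - f x *m B.
have sT : smooth O T.
  apply: smoothB => //; first exact: smooth_id.
  by apply: smooth_mulmx => //; exact: smooth_cst.
have JT x : O x -> 'J T x = 1%:M - 'J f x *m B.
  move=> Ox; have dfx := smooth_differentiable fO Ox.
  have dB z : differentiable (fun y : 'rV[R]_n => y *m B) z.
    by apply: (linear_differentiable (f := mulmxr B)); exact: mulmxr_continuous.
  rewrite jacobianB; last 2 first.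
  - exact: (ex_diff (is_diff_def := is_diff_id x)).
  - exact: (differentiable_comp dfx (dB _)).
  rewrite jacobian_id; congr (_ - _).
  by rewrite (jacobian_comp dfx (dB _)) jacobian_mulmxr.
(* Chosen so that [n * C <= 1/2], the contraction constant of [T]; the successor keeps the
   denominator nonzero for [n = 0]. *)
pose C : R := (2 * n.+1%:R)^-1.
have C0 : 0 < C by rewrite invr_gt0 mulr_gt0.
have nC : n%:R * C <= 2^-1.
  rewrite /C invfM mulrCA ler_piMr// ler_pdivrMr// mul1r ler_nat//.
have sJT := smooth_jacobian oO sT.
have JT0 : 'J T x0 = 0 by rewrite JT// mulmxV// subrr.
have [r r0 rP] : exists2 r : R, 0 < r & forall x, ball x0 r x ->
    [/\ O x, \det ('J f x) != 0 & `|'J T x| < C].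
  have : nbhs x0 (O `&` [set x | \det ('J f x) != 0] `&` [set x | `|'J T x| < C]).
    apply: filterI; first apply: filterI; first exact: open_nbhs_nbhs.
      have cdet := smooth_continuous (smooth_det oO sJ) Ox0.
      apply: (cdet [set y | y != 0]); apply: open_nbhs_nbhs.
      split; first exact: open_neq.
      by move: J0; rewrite unitmxE unitfE.
    have := smooth_continuous sJT Ox0; move/cvgrPdist_lt => /(_ C C0).
    by apply: filterS => x; rewrite JT0 sub0r normrN.
  by move=> /nbhs_ballP[r /= r0 rP]; exists r => // x /rP[[]].
pose U := ball x0 r.
have UO : U `<=` O by move=> x /rP[].
have oU : open U by exact: ball_open.
have TU x y : U x -> U y -> `|T y - T x| <= 2^-1 * `|y - x|.
  move=> Ux Uy; apply: le_trans (_ : n%:R * C * `|y - x| <= _); last first.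
    by rewrite ler_wpM2r.
  apply: (lipschitz_mx_on_ball (c := x0) (r := r)) => //; first exact: ltW.
    by move=> z /UO; exact: smooth_differentiable sT.
  move=> z /rP[_ _ /ltW zC] i j; apply: le_trans zC; exact: mx_norm_entry.
pose K := n%:R * `|B|; have K0 : 0 <= K by rewrite mulr_ge0.
(* [y - x] is the increment of [T] plus that of [f] times [B]; the first is at most half of
   [|y - x|] and is absorbed. *)
have fK x y : U x -> U y -> `|y - x| <= 2 * K * `|f y - f x|.
  move=> Ux Uy; have := TU x y Ux Uy.
  have := norm_mulmx_le B (f y - f x); rewrite -/K => a b.
  have : `|y - x| <= `|T y - T x| + `|(f y - f x) *m B|.
    apply: le_trans (ler_normD _ _); rewrite le_eqVlt; apply/orP; left; apply/eqP.
    congr `|_|; rewrite /T mulmxBl; move: (f x *m B) (f y *m B) => u v.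
    by apply/matrixP => i j; rewrite !mxE; ring.
  lra.
have fI x y : U x -> U y -> f x = f y -> x = y.
  move=> Ux Uy fxy; apply/eqP; rewrite eq_sym -subr_eq0 -normr_le0.
  by apply: le_trans (fK _ _ Ux Uy) _; rewrite fxy subrr normr0 mulr0.
have oV : open (f @` U).
  rewrite openE => _ [x1 Ux1 <-].
  have [s s0 sU] : exists2 s : R, 0 < s & forall x, `|x - x1| <= s -> U x.
    have /nbhs_ballP[s /= s0 sU] : nbhs x1 U by exact: open_nbhs_nbhs.
    exists (s / 2); first by rewrite divr_gt0.
    move=> x xs; apply: sU; rewrite -ball_normE/= distrC; apply: le_lt_trans xs _; lra.
  (* With this radius [K * |y - f x1| <= s / 2], so that [S], which contracts by one half, maps the
     closed ball [D] to itself. *)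
  apply/nbhs_ballP; exists (s / (2 * (K + 1))) => /=.
    by rewrite divr_gt0// mulr_gt0// ltr_wpDl.
  move=> y; rewrite -ball_normE/= distrC => yx1.
  pose D : set 'rV[R]_n := [set x | `|x - x1| <= s].
  pose S x := T x + y *m B.
  have SD x x' : D x -> D x' -> `|S x' - S x| <= 2^-1 * `|x' - x|.
    move=> Dx Dx'; rewrite (_ : S x' - S x = T x' - T x); last by rewrite /S opprD addrACA subrr addr0.
    by apply: TU; exact: sU.
  have D1 : D x1 by rewrite /D/= subrr normr0 ltW.
  have fS : set_fun D D S.
    move=> x Dx; rewrite /D/=.
    have -> : S x - x1 = (S x - S x1) + (y - f x1) *m B.
      rewrite /S /T mulmxBl; move: (f x *m B) (y *m B) (f x1 *m B) => u v w.
      by apply/matrixP => i j; rewrite !mxE; ring.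
    apply: le_trans (ler_normD _ _) _; have := SD _ _ D1 Dx.
    have := norm_mulmx_le B (y - f x1); rewrite -/K => a b.
    have c : K * `|y - f x1| <= s / 2.
      apply: (@le_trans _ _ (K * (s / (2 * (K + 1))))); first by rewrite ler_wpM2l// ltW.
      rewrite mulrA ler_pdivrMr ?mulr_gt0 ?ltr_wpDl//.
      by rewrite (_ : s / 2 * (2 * (K + 1)) = K * s + s) ?lerDl ?(ltW s0)//; field.
    by move: Dx; rewrite /D/=; lra.
  have [p Dp pE] : exists2 p, D p & p = S p.
    have [F SF] := Pfun fS.
    have [|||p Dp pE] := @banach_fixed_point _ _ D F.
    - exists (2^-1)%:nng; split=> /=; first by lra.
      by move=> [a b] [/= Da Db]; rewrite -SF; exact: SD.
    - have : closed (closed_ball x1 s) by exact: closed_ball_closed.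
      rewrite closed_ballE// (_ : closed_ball_ _ _ _ = D)//.
      by apply/funext => z; rewrite /closed_ball_/D/= distrC.
    - by exists x1.
    - by exists p; rewrite // SF.
  exists p; first exact: sU.
  have : (y - f p) *m B = 0.
    move: pE; rewrite /S /T -addrA [- _ + _]addrC -mulmxBl => pE.
    by apply: (addrI p); rewrite addr0 -pE.
  move=> /(congr1 (mulmx^~ ('J f x0))); rewrite mulmxKV// mul0mx => /eqP.
  by rewrite subr_eq0 => /eqP.
exists U; exists (fun y => xget x0 (U `&` [set x | f x = y])).
have gK x : U x -> xget x0 (U `&` [set z | f z = f x]) = x.
  by move=> Ux; case: xgetP => [z _ [Uz /= zx]|/(_ x)[]]//; exact: fI.
have JU x : U x -> 'J f x \in unitmx by move=> /rP[_ ? _]; rewrite unitmxE unitfE.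
split; first by split=> //; exact: ballxx.
split=> //; apply: (@local_inverse_smooth f U (2 * K)) => //.
- exact: smoothS fO.
- by rewrite mulr_ge0.
Qed.
End InverseFunction.

(** * Poincare's lemma in the plane *)

Section Poincare.
Context {R : realType}.

(** Integrating from the left end [a] lets the fundamental theorem apply on both sides of [t0]; the
    value at [t0] is then subtracted. *)
Lemma antiderivative (f : R -> R) (a b t0 : R) : a < t0 < b ->
  (forall t, a <= t <= b -> {for t, continuous f}) ->
  exists2 F : R -> R, F t0 = 0 & forall t, a < t < b -> is_derive t 1 F (f t).
Proof.
move=> /andP[at0 t0b] cf.
have fi : (@lebesgue_measure R).-integrable `[a, b]%classic (EFin \o f).
  apply: continuous_compact_integrable; first exact: segment_compact.
  apply: continuous_in_subspaceT => t; rewrite inE/= in_itv/=; exact: cf.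
pose F (x : R) := (\int[@lebesgue_measure R]_(t in `[a, x]) f t)%R.
exists (fun x => F x - F t0); first by rewrite subrr.
move=> t /andP[at_ tb].
have [|dF FE] := continuous_FTC1_closed tb fi at_; first by apply: cf; rewrite !ltW.
rewrite -[f t]subr0; apply: is_deriveB.
exact: DeriveDef dF (etrans (esym (derive1E F t)) FE).
Qed.

Lemma ord2P (i : 'I_2) : i = 0 \/ i = 1.
Proof. by case: i => [[|[|i]] Hi]//; [left|right]; apply/val_inj. Qed.

Definition plane_point (c : 'rV[R]_2) (s t : R) : 'rV[R]_2 :=
  c + s *: delta_mx 0 0 + t *: delta_mx 0 1.

Lemma plane_pointE0 c (s t : R) : plane_point c s t 0 0 = c 0 0 + s.
Proof. by rewrite /plane_point !mxE/= mulr1 mulr0 addr0. Qed.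

Lemma plane_pointE1 c (s t : R) : plane_point c s t 0 1 = c 0 1 + t.
Proof. by rewrite /plane_point !mxE/= mulr1 mulr0 addr0. Qed.

Lemma plane_pointK c (x : 'rV[R]_2) : plane_point c (x 0 0 - c 0 0) (x 0 1 - c 0 1) = x.
Proof.
by apply/rowP => i; have [->|->] := ord2P i;
  rewrite ?plane_pointE0 ?plane_pointE1 subrKC.
Qed.

Lemma mxBE m n (x y : 'M[R]_(m, n)) i j : (x - y) i j = x i j - y i j.
Proof. by rewrite !mxE. Qed.

Lemma norm_row2_le (x : 'rV[R]_2) (e : R) : 0 <= e ->
  `|x 0 0| <= e -> `|x 0 1| <= e -> `|x| <= e.
Proof.
move=> e0 x0 x1; apply: mx_norm_leP => // i j; rewrite (ord1 i).
by have [->|->] := ord2P j.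
Qed.

Lemma plane_point_dist c s t s' t' (e : R) : 0 <= e ->
  `|s' - s| <= e -> `|t' - t| <= e ->
  `|plane_point c s' t' - plane_point c s t| <= e.
Proof.
move=> e0 se te; apply: norm_row2_le => //; rewrite mxBE.
  by rewrite !plane_pointE0 opprD addrACA subrr add0r.
by rewrite !plane_pointE1 opprD addrACA subrr add0r.
Qed.

Lemma ball_plane_point c s t (r : R) : `|s| < r -> `|t| < r ->
  ball c r (plane_point c s t).
Proof.
move=> sr tr; rewrite -ball_normE/= distrC.
apply: (@le_lt_trans _ _ (Num.max `|s| `|t|)); last by rewrite gt_max sr.
rewrite -[X in _ - X](_ : plane_point c 0 0 = _); last first.
  by rewrite /plane_point !scale0r !addr0.
apply: plane_point_dist; rewrite ?subr0; first by rewrite le_max normr_ge0.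
  by rewrite le_max lexx.
by rewrite le_max lexx orbT.
Qed.

Lemma is_derive_plane0 (f : 'rV[R]_2 -> R) c s t :
  differentiable f (plane_point c s t) ->
  is_derive s 1 (fun s => f (plane_point c s t)) (partial 0 f (plane_point c s t)).
Proof.
have E z : plane_point c z t = (c + t *: delta_mx 0 1) + z *: delta_mx 0 0.
  by rewrite /plane_point addrAC.
rewrite E => df; under [X in is_derive _ _ X]eq_fun do rewrite E.
exact: is_derive_line.
Qed.

Lemma is_derive_plane1 (f : 'rV[R]_2 -> R) c s t :
  differentiable f (plane_point c s t) ->
  is_derive t 1 (fun t => f (plane_point c s t)) (partial 1 f (plane_point c s t)).
Proof. exact: is_derive_line. Qed.

(** No differentiation under the integral sign: [est] bounds the increment of [u] minus its expected
    linear part by [C * k ^ 2], which gives the differential of [u] at once. Higher smoothness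
    follows, since the partials of [u] are the given smooth functions. *)
Lemma poincare (O : set 'rV[R]_2) (f0 f1 : 'rV[R]_2 -> R) c :
  open O -> smooth O f0 -> smooth O f1 -> O c ->
  (forall x, O x -> partial 0 f1 x = partial 1 f0 x) ->
  exists (r : R) (u : 'rV[R]_2 -> R), [/\ 0 < r, ball c r `<=` O,
    smooth (ball c r) u & forall x, ball c r x ->
      partial 0 u x = f0 x /\ partial 1 u x = f1 x].
Proof.
move=> oO s0 s1 Oc clos.
have [r0 [L0 [r00 L00 r0O lip0]]] := smooth_locally_lipschitz oO s0 Oc.
have [r1 [L1 [r10 L10 r1O lip1]]] := smooth_locally_lipschitz oO s1 Oc.
have [r2 [L2 [r20 L20 r2O lip2]]] :=
  smooth_locally_lipschitz oO (smooth_partial 0 s1) Oc.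
(* Strictly below the three radii, so that the closed square of half-side [r] lies in the three open
   balls; [antiderivative] needs closed intervals. *)
have [r [rp rr0 rr1 rr2]] : exists r, [/\ 0 < r, r < r0, r < r1 & r < r2].
  exists (Num.min r0 (Num.min r1 r2) / 2).
  have m0 : 0 < Num.min r0 (Num.min r1 r2) by rewrite !lt_min r00 r10.
  have : Num.min r0 (Num.min r1 r2) / 2 < Num.min r0 (Num.min r1 r2) by lra.
  by rewrite !lt_min => /and3P[]; split=> //; rewrite divr_gt0.
have clb s t : -r <= s <= r -> -r <= t <= r ->
    ball c r0 (plane_point c s t) /\ ball c r1 (plane_point c s t) /\
    ball c r2 (plane_point c s t).
  rewrite -!ler_norml => sr tr.
  by split; [|split]; apply: ball_plane_point; apply: le_lt_trans rr0 ||
    apply: le_lt_trans rr1 || apply: le_lt_trans rr2.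
have inO s t : -r <= s <= r -> -r <= t <= r -> O (plane_point c s t).
  by move=> sr tr; have [/r0O] := clb s t sr tr.
have rr : -r < 0 < r by rewrite oppr_lt0 rp.
have rrW : -r <= 0 <= r by rewrite !ltW//; case/andP: rr.
have W s : -r < s < r -> -r <= s <= r by move=> /andP[? ?]; rewrite !ltW.
have [A A0 dA] : exists2 F : R -> R, F 0 = 0 &
    forall t, -r < t < r -> is_derive t 1 F (f0 (plane_point c t 0)).
  apply: antiderivative => // t tr.
  have df : differentiable f0 (plane_point c t 0).
    by apply: smooth_differentiable s0 _; exact: inO.
  apply: differentiable_continuous; apply/derivable1_diffP.
  by have [] := is_derive_plane0 df.
have [B BP] : {B : R -> R -> R & forall s, -r < s < r -> B s 0 = 0 /\
    forall t, -r < t < r -> is_derive t 1 (B s) (f1 (plane_point c s t))}.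
  apply: (@choice _ _ (fun s F => -r < s < r -> F 0 = 0 /\
    forall t, -r < t < r -> is_derive t 1 F (f1 (plane_point c s t)))) => s.
  (* For [s] out of range no integral is wanted, and the zero function is the default. *)
  have [sr|] := boolP (-r < s < r); last by move=> _; exists (fun=> 0).
  have [|F F0 dF] := @antiderivative (fun t => f1 (plane_point c s t)) _ _ _ rr.
    move=> t tr.
    have df : differentiable f1 (plane_point c s t).
      by apply: smooth_differentiable s1 _; apply: inO => //; exact: W.
    apply: differentiable_continuous; apply/derivable1_diffP.
    by have [] := is_derive_plane1 df.
  by exists F.
(* [u] integrates [f0] along the axis, then [f1] along the vertical line. *)
pose u (x : 'rV[R]_2) := A (x 0 0 - c 0 0) + B (x 0 0 - c 0 0) (x 0 1 - c 0 1).
(* The three errors of [est]: [f1] along the vertical step, [f0] along the axis, and the defect [D]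
   over a height at most [r]. *)
pose C := L1 + L0 + r * L2.
have C0 : 0 <= C by rewrite !addr_ge0// mulr_ge0// ltW.
have est s t h l : -r < s < r -> -r < t < r -> -r < s + h < r -> -r < t + l < r ->
    forall k, `|h| <= k -> `|l| <= k ->
    `|A (s + h) + B (s + h) (t + l) - (A s + B s t)
      - (h * f0 (plane_point c s t) + l * f1 (plane_point c s t))| <= C * k * k.
  move=> sr tr shr tlr k hk lk.
  have k0 : 0 <= k by apply: le_trans hk.
  have [t1 [t1r t1t E1]] := mean_value (BP (s + h) shr).2 tr tlr.
  have [s1' [s1r s1s E2]] := mean_value dA sr shr.
  (* [D] is the defect in [B (s + h) t - B s t = h * (f0 (s, t) - f0 (s, 0))]. Closedness replaces
     [partial 1 f0] by [partial 0 f1] in its derivative, which becomes [h] times an increment of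
     [partial 0 f1], hence of second order. *)
  pose D t := B (s + h) t - B s t
              - h * (f0 (plane_point c s t) - f0 (plane_point c s 0)).
  have dD z : -r < z < r -> is_derive z 1 D (f1 (plane_point c (s + h) z)
      - f1 (plane_point c s z) - h * (partial 1 f0 (plane_point c s z) - 0)).
    move=> zr; apply: is_deriveB.
      by apply: is_deriveB; [exact: (BP _ shr).2|exact: (BP _ sr).2].
    apply: is_deriveZ; apply: is_deriveB; apply: is_derive_plane1.
    by apply: smooth_differentiable s0 _; apply: inO; exact: W.
  have [t2 [t2r t2t E3]] := mean_value dD rr tr.
  have D0 : D 0 = 0 by rewrite /D (BP _ shr).1 (BP _ sr).1 !subrr mulr0 subr0.
  have dz z : -r < z < r -> is_derive z 1 (fun z => f1 (plane_point c z t2))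
      (partial 0 f1 (plane_point c z t2)).
    move=> zr; apply: is_derive_plane0.
    by apply: smooth_differentiable s1 _; apply: inO; exact: W.
  have [s2 [s2r s2s E4]] := mean_value dz sr shr.
  rewrite D0 !subr0 -clos in E3; last by apply: inO; exact: W.
  rewrite E4 addrAC subrr add0r -mulrBr in E3.
  rewrite addrAC subrr add0r in E1; rewrite addrAC subrr add0r in E2.
  rewrite addrAC subrr add0r in t1t; rewrite addrAC subrr add0r in s1s.
  rewrite addrAC subrr add0r in s2s.
  have sshk : `|s + h - s| <= k by rewrite addrAC subrr add0r.
  have zk : `|(0 : R) - 0| <= k by rewrite subrr normr0.
  have zk2 : `|t2 - t2| <= k by rewrite subrr normr0.
  have F1 : `|f1 (plane_point c (s + h) t1) - f1 (plane_point c s t)| <= L1 * k.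
    apply: le_trans (lip1 _ _ (clb _ _ (W _ sr) (W _ tr)).2.1
      (clb _ _ (W _ shr) (W _ t1r)).2.1) _.
    by rewrite ler_wpM2l//; apply: plane_point_dist => //; exact: le_trans lk.
  have F0 : `|f0 (plane_point c s1' 0) - f0 (plane_point c s 0)| <= L0 * k.
    apply: le_trans (lip0 _ _ (clb _ _ (W _ sr) rrW).1 (clb _ _ (W _ s1r) rrW).1) _.
    by rewrite ler_wpM2l//; apply: plane_point_dist => //; exact: le_trans hk.
  have F2 : `|partial 0 f1 (plane_point c s2 t2) - partial 0 f1 (plane_point c s t2)|
      <= L2 * k.
    apply: le_trans (lip2 _ _ (clb _ _ (W _ sr) (W _ t2r)).2.2
      (clb _ _ (W _ s2r) (W _ t2r)).2.2) _.
    by rewrite ler_wpM2l//; apply: plane_point_dist => //; exact: le_trans hk.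
  have -> : A (s + h) + B (s + h) (t + l) - (A s + B s t)
      - (h * f0 (plane_point c s t) + l * f1 (plane_point c s t)) =
      l * (f1 (plane_point c (s + h) t1) - f1 (plane_point c s t)) +
      h * (f0 (plane_point c s1' 0) - f0 (plane_point c s 0)) + D t.
    rewrite !mulrBr -E1 -E2 /D.
    move: (f0 _) (f1 _) (f0 _) (A _) (A _) (B _ _) (B _ _) (B _ _) => v1 v2 v3 v4 v5 v6 v7 v8.
    by ring.
  rewrite E3; apply: (le_trans (ler_normD _ _)).
  apply: (@le_trans _ _ (k * (L1 * k) + k * (L0 * k) + r * (k * (L2 * k)))).
    apply: lerD; [apply: (le_trans (ler_normD _ _)); apply: lerD|]; rewrite !normrM.
    - exact: ler_pM.
    - exact: ler_pM.
    - apply: ler_pM => //; last exact: ler_pM.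
      by move/andP: tr => [? ?]; rewrite ler_norml !ltW.
  by rewrite /C le_eqVlt; apply/orP; left; apply/eqP; ring.
have cb x : ball c r x -> -r < x 0 0 - c 0 0 < r /\ -r < x 0 1 - c 0 1 < r.
  rewrite -ball_normE/= distrC => xr.
  rewrite -!ltr_norml; split; apply: le_lt_trans xr.
    by have := mx_norm_entry (x - c) 0 0; rewrite mxBE.
  by have := mx_norm_entry (x - c) 0 1; rewrite mxBE.
have du x : ball c r x -> differentiable u x /\ forall v, 'd u x v = v 0 0 * f0 x + v 0 1 * f1 x.
  move=> cx.
  have Llin : linear (fun v : 'rV[R]_2 => v 0 0 * f0 x + v 0 1 * f1 x : R).
    by move=> a v w; rewrite !mxE /GRing.scale/=; ring.
  pose Lb := GRing.isLinear.Build _ _ _ _ (fun v : 'rV[R]_2 => v 0 0 * f0 x + v 0 1 * f1 x : R) Llin.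
  pose L : {linear 'rV[R]_2 -> R} := HB.pack (fun v : 'rV[R]_2 => v 0 0 * f0 x + v 0 1 * f1 x : R) Lb.
  have cL : continuous L.
    move=> v; apply: (smooth_continuous (O := setT)) => //.
    apply: smoothD; first exact: openT; (apply: smoothM; first exact: openT).
    - exact/smooth_coord/smooth_id/openT/openT.
    - exact/smooth_cst/openT.
    - exact/smooth_coord/smooth_id/openT/openT.
    - exact/smooth_cst/openT.
  have [|dux duE] := @littleo_diff _ _ _ u L x cL; last by split=> // v; rewrite duE.
  move=> e e0.
  have bx : \forall h \near (0 : 'rV[R]_2), ball c r (h + x).
    have : \forall y \near x, ball c r y.
      by apply: open_nbhs_nbhs; split=> //; exact: ball_open.
    by rewrite (near_shift 0 x)/= subr0.
  have eC : 0 < e / (C + 1) by rewrite divr_gt0// ltr_wpDl.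
  have nk : \forall k \near (0 : 'rV[R]_2), `|k| < e / (C + 1) by exact: nbhs0_lt.
  near=> k.
  have [sr tr] := cb x cx.
  have /cb[shr tlr] : ball c r (k + x) by near: k.
  have kx j : (k + x) 0 j - c 0 j = x 0 j - c 0 j + k 0 j by rewrite mxE; ring.
  rewrite !kx in shr tlr.
  have := est _ _ _ _ sr tr shr tlr `|k| (mx_norm_entry _ _ _) (mx_norm_entry _ _ _).
  rewrite plane_pointK /u !kx => /le_trans; apply.
  rewrite ler_wpM2r//; have : `|k| < e / (C + 1) by near: k.
  rewrite ltr_pdivlMr ?ltr_wpDl// mulrDr mulr1 mulrC => /ltW; apply: le_trans.
  by rewrite lerDl.
have pu x : ball c r x -> partial 0 u x = f0 x /\ partial 1 u x = f1 x.
  move=> /du[dux duE]; rewrite /partial !(deriveE _ dux) !duE !mxE/=.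
  by split; ring.
have rO : ball c r `<=` O.
  by move=> x cx; apply: r0O; apply: le_ball cx; exact: ltW.
exists r, u; split=> // -[//|k]; split=> [x /du[]//|i].
have [->|->] := ord2P i.
  apply: (eq_diff_order (f := f0)); first exact: ball_open.
    by move=> x /pu[].
  exact: diff_order_sub rO (s0 k).
apply: (eq_diff_order (f := f1)); first exact: ball_open.
  by move=> x /pu[].
exact: diff_order_sub rO (s1 k).
Unshelve. all: by end_near. Qed.

End Poincare.

(** * The tension field of a Riemannian submersion *)

Section Metric.
Context {R : realType} {n : nat} (L : riemannian_manifold R n).
Implicit Types (c : chart L) (x : 'rV[R]_n).

Definition chart_image c : set 'rV[R]_n := coord c @` dom c.

(** A nonzero kernel vector would have length zero. *)
Lemma metric_unit c x : chart_image c x -> metric c x \in unitmx.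
Proof.
move=> cx; rewrite -row_free_unit -kermx_eq0; apply/eqP/row_matrixP => i.
rewrite row0; apply/eqP; apply/negPn/negP => v0.
have := metric_posdef cx v0.
by rewrite -row_mul mulmx_ker row0 mul0mx mxE ltxx.
Qed.

Lemma metric_symE c x i j : chart_image c x -> metric c x i j = metric c x j i.
Proof. by move=> cx; rewrite -[in LHS](metric_sym cx) mxE. Qed.

Lemma smooth_metric c : smooth (chart_image c) (metric c).
Proof. exact: metric_smooth. Qed.

Lemma open_chart_image c : open (chart_image c).
Proof. exact: coord_open. Qed.

Lemma differentiable_metric c x i j : chart_image c x ->
  differentiable (fun y => metric c y i j : R) x.
Proof.
move=> cx; apply: (smooth_differentiable (O := chart_image c)) => //.
by apply: smooth_coord; [exact: open_chart_image|exact: smooth_metric].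
Qed.

Lemma partial_metric_sym c x k i j : chart_image c x ->
  partial k (fun y => metric c y i j : R) x = partial k (fun y => metric c y j i : R) x.
Proof.
move=> cx; apply: (open_eq_partial k (open_chart_image (c := c)) cx) => y cy.
exact: metric_symE.
Qed.

(** Lowering the upper index cancels the inverse metric and leaves the Christoffel symbols of the
    first kind. *)
Lemma christoffel_lower c x i j l : chart_image c x ->
  \sum_k christoffel c k i j x * metric c x k l =
  2^-1 * (partial i (fun y => metric c y j l : R) x
     + partial j (fun y => metric c y i l : R) x
     - partial l (fun y => metric c y i j : R) x).
Proof.
move=> cx; rewrite /christoffel.
set S := fun r => partial i (fun y => metric c y j r : R) x
     + partial j (fun y => metric c y i r : R) x
     - partial r (fun y => metric c y i j : R) x.
transitivity (2^-1 * \sum_r S r * (invmx (metric c x) *m metric c x) r l).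
  under eq_bigr do rewrite -mulrA; rewrite -mulr_sumr; congr (_ * _).
  under eq_bigr do rewrite mulr_suml.
  rewrite exchange_big; apply: eq_bigr => r _ /=; rewrite mxE mulr_sumr.
  apply: eq_bigr => k _.
  have -> : invmx (metric c x) k r = invmx (metric c x) r k.
    by rewrite -[in LHS](metric_sym cx) -trmx_inv mxE.
  by rewrite mulrAC mulrC.
congr (_ * _); rewrite mulVmx ?metric_unit// (bigD1 l)//= !mxE eqxx mulr1.
by rewrite big1 ?addr0// => r /negPf rl; rewrite mxE rl mulr0.
Qed.

End Metric.

Lemma big_ord2 (V : nmodType) (g : 'I_2 -> V) : \sum_i g i = g 0 + g 1.
Proof. by rewrite big_ord_recl big_ord1; congr (_ + g _); exact/val_inj. Qed.

(** Koszul's formula for a pulled back metric, as an identity between numbers at one point. [u],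
    [v], [w] stand for the first derivatives of the map in directions [i], [j], [l]; [A], [B], [C]
    for its second derivatives [ij], [il], [jl], the primed ones with the order exchanged; [g], [h],
    [H] for the Christoffel symbols, metric and metric derivatives of the target; [q] for the
    Christoffel term of the domain. *)
Lemma koszul_pairing (R : realFieldType) (h : 'I_2 -> 'I_2 -> R)
    (g H : 'I_2 -> 'I_2 -> 'I_2 -> R) (u v w q A A' B B' C C' : 'I_2 -> R) :
  h 1 0 = h 0 1 -> (forall e, H e 1 0 = H e 0 1) ->
  (forall d e r, g 0 d e * h 0 r + g 1 d e * h 1 r =
     2^-1 * (H d e r + H e d r - H r d e)) ->
  A' =1 A -> B' =1 B -> C' =1 C ->
  2 * \sum_c \sum_d h c d *
    (A c - q c + \sum_d \sum_e g c d e * u d * v e) * w d =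
  \sum_c \sum_d (A c * h c d * w d
     + v c * (u 0 * H 0 c d + u 1 * H 1 c d) * w d + v c * h c d * B d)
  + \sum_c \sum_d (A' c * h c d * w d
     + u c * (v 0 * H 0 c d + v 1 * H 1 c d) * w d + u c * h c d * C d)
  - \sum_c \sum_d (B' c * h c d * v d
     + u c * (w 0 * H 0 c d + w 1 * H 1 c d) * v d + u c * h c d * C' d)
  - 2 * \sum_c \sum_d q c * h c d * w d.
Proof.
move=> h10 H10 lower AA BB CC; rewrite !big_ord2 !AA !BB !CC h10 !H10.
pose K d e r := g 0 d e * h 0 r + g 1 d e * h 1 r.
have KE d e r : K d e r = 2^-1 * (H d e r + H e d r - H r d e) by exact: lower.
(* Expanding until the symbols occur only in lowered form [K], where the first-kind formula
   applies. *)
transitivity (2 * ((A 0 - q 0) * (h 0 0 * w 0 + h 0 1 * w 1)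
    + (A 1 - q 1) * (h 0 1 * w 0 + h 1 1 * w 1)
  + (K 0 0 0 * u 0 * v 0 * w 0 + K 0 0 1 * u 0 * v 0 * w 1
   + K 0 1 0 * u 0 * v 1 * w 0 + K 0 1 1 * u 0 * v 1 * w 1
   + K 1 0 0 * u 1 * v 0 * w 0 + K 1 0 1 * u 1 * v 0 * w 1
   + K 1 1 0 * u 1 * v 1 * w 0 + K 1 1 1 * u 1 * v 1 * w 1))).
  by rewrite /K h10; ring.
by rewrite !KE !H10; field.
Qed.

(** One index [k] of the Lie derivative of the pulled back metric, regrouped so that, after
    summation over [k], each term contains either the Lie derivative of the differential of the map
    or the differential applied to the field. Both vanish for a vertical field. *)
Lemma lie_pairing (R : comPzRingType) (h : 'I_2 -> 'I_2 -> R)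
    (H : 'I_2 -> 'I_2 -> 'I_2 -> R) (A B a b q : 'I_2 -> R) (v x y : R) :
  h 1 0 = h 0 1 ->
  v * (\sum_c \sum_d (A c * h c d * b d + a c * (q 0 * H 0 c d + q 1 * H 1 c d) * b d
      + a c * h c d * B d))
    + x * (\sum_c \sum_d q c * h c d * b d) + y * (\sum_c \sum_d q c * h c d * a d)
  = \sum_c \sum_d ((v * A c + x * q c) * h c d * b d
     + a c * (H 0 c d * (v * q 0) + H 1 c d * (v * q 1)) * b d
     + a c * h c d * (v * B d + y * q d)).
Proof. by move=> h10; rewrite !big_ord2 h10; ring. Qed.

Lemma sum_affine (R : comPzRingType) (I : finType) (X Y Z W : I -> R) (h a b s t : R) :
  \sum_k (X k * h * b + a * (s * Y k + t * Z k) * b + a * h * W k) =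
  (\sum_k X k) * h * b + a * (s * \sum_k Y k + t * \sum_k Z k) * b
  + a * h * \sum_k W k.
Proof.
rewrite 2!big_split/= -!mulr_suml -!mulr_sumr; congr (_ + _ * _ * _ + _).
by rewrite big_split/= -!mulr_sumr.
Qed.

Section Tension.
Context {R : realType} {m : nat}.
Variables (E : riemannian_manifold R m) (N : riemannian_manifold R 2).
Variables (a : chart E) (b : chart N) (f : E -> N) (O : set 'rV[R]_m).
Variables (w : 'rV[R]_m -> 'rV[R]_m) (x : 'rV[R]_m).
Let F := local_rep a b f.
Hypotheses (oO : open O) (Oa : O `<=` chart_image a) (Ox : O x).
Hypotheses (sF : smooth O F) (Fb : forall y, O y -> chart_image b (F y)).
Hypothesis sw : smooth O w.
Hypothesis GE : forall y, O y ->
  metric a y = (w y)^T *m w y + 'J F y *m metric b (F y) *m ('J F y)^T.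

Let Fc c : 'rV[R]_m -> R := fun y => F y 0 c.
Let h := metric b (F x).
Let p i c := partial i (Fc c) x.
Let pp i j c := partial i (partial j (Fc c)) x.
Let H e c d := partial e (fun y => metric b y c d : R) (F x).
Let dw i l := partial i (fun y => w y 0 l : R) x.
Let B c i j := second_fundamental_form a b f c i j x.

Let dF y : O y -> differentiable F y.
Proof. by move=> Oy; exact: smooth_differentiable sF Oy. Qed.

Let sFc c : smooth O (Fc c).
Proof. by apply: smooth_coord. Qed.

Let dpF i c y : O y -> differentiable (partial i (Fc c)) y.
Proof. by move=> Oy; exact: smooth_differentiable (smooth_partial i (sFc c)) Oy. Qed.

Let dwl l y : O y -> differentiable (fun y => w y 0 l : R) y.
Proof. by move=> Oy; apply: smooth_differentiable Oy; exact: smooth_coord. Qed.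

Let dh c d : differentiable (fun y => metric b (F y) c d : R) x.
Proof.
exact: (differentiable_comp (dF Ox) (differentiable_metric c d (Fb Ox))).
Qed.

Let dhE e c d : partial e (fun y => metric b (F y) c d : R) x =
  p e 0 * H 0 c d + p e 1 * H 1 c d.
Proof.
rewrite (partial_comp _ (dF Ox) (differentiable_metric c d (Fb Ox))).
rewrite big_ord_recl big_ord1 !jacobianE; try exact: dF.
by rewrite (_ : lift ord0 ord0 = 1)//; exact/val_inj.
Qed.

Let pull k l y : R := \sum_c \sum_d
  partial k (Fc c) y * metric b (F y) c d * partial l (Fc d) y.

Let metricE k l y : O y -> metric a y k l = w y 0 k * w y 0 l + pull k l y.
Proof.
move=> Oy; rewrite GE// mxE; congr (_ + _).
  by rewrite mxE big_ord1 !mxE.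
rewrite mxE /pull exchange_big; apply: eq_bigr => d _.
rewrite [(_ *m _) k d]mxE [_^T d l]mxE mulr_suml.
by apply: eq_bigr => c _; rewrite !(jacobianE _ _ (dF Oy)).
Qed.

Let dpull1 k c d : differentiable (fun y => partial k (Fc c) y * metric b (F y) c d) x.
Proof. by apply: differentiableM; [exact: dpF|exact: dh]. Qed.

Let dpull2 k l c d : differentiable
  (fun y => partial k (Fc c) y * metric b (F y) c d * partial l (Fc d) y) x.
Proof. by apply: differentiableM; [exact: dpull1|exact: dpF]. Qed.

Let dpull3 k l c : differentiable
  (fun y => \sum_d partial k (Fc c) y * metric b (F y) c d * partial l (Fc d) y) x.
Proof.
under eq_fun do rewrite big_ord_recl big_ord1.
by apply: differentiableD; exact: dpull2.
Qed.

Let dpull k l : differentiable (pull k l) x.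
Proof.
rewrite /pull; under eq_fun do rewrite big_ord_recl big_ord1.
by apply: differentiableD; exact: dpull3.
Qed.

Let pull_derive i k l : partial i (pull k l) x = \sum_c \sum_d
  (pp i k c * h c d * p l d + p k c * (p i 0 * H 0 c d + p i 1 * H 1 c d) * p l d
   + p k c * h c d * pp i l d).
Proof.
rewrite /pull partial_sum; last exact: dpull3.
apply: eq_bigr => c _; rewrite partial_sum; last exact: dpull2.
apply: eq_bigr => d _.
rewrite partialM; [|exact: dpull1|exact: dpF].
rewrite partialM; [|exact: dpF|exact: dh].
by rewrite dhE mulrDl.
Qed.

Let metric_derive i k l : partial i (fun y => metric a y k l : R) x =
  dw i k * w x 0 l + w x 0 k * dw i l + partial i (pull k l) x.
Proof.
rewrite (open_eq_partial i oO Ox (g := fun y => w y 0 k * w y 0 l + pull k l y)).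
  rewrite partialD; [|by apply: differentiableM; exact: dwl|exact: dpull].
  by rewrite partialM; [|exact: dwl|exact: dwl].
by move=> y; exact: metricE.
Qed.

Let hx : chart_image b (F x). Proof. exact: Fb. Qed.

(* The second fundamental form paired with [df (d_l)], by polarization of the
   derivative of the pulled back metric. *)
Let pairing i j l : 2 * \sum_c \sum_d h c d * B c i j * p l d =
  partial i (pull j l) x + partial j (pull i l) x - partial l (pull i j) x
  - 2 * \sum_k christoffel a k i j x * pull k l x.
Proof.
have ppC k q c : pp k q c = pp q k c by exact: (partialC k q oO (sFc c) Ox).
rewrite !pull_derive.
have lower d e r : christoffel b 0 d e (F x) * h 0 r + christoffel b 1 d e (F x) * h 1 r
    = 2^-1 * (H d e r + H e d r - H r d e).
  by have := christoffel_lower d e r hx; rewrite big_ord2.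
have h10 : h 1 0 = h 0 1 by exact: metric_symE.
have H10 e : H e 1 0 = H e 0 1 by exact: partial_metric_sym.
have -> : \sum_k christoffel a k i j x * pull k l x =
   \sum_c \sum_d (\sum_k christoffel a k i j x * p k c) * h c d * p l d.
  rewrite /pull; under eq_bigr do rewrite mulr_sumr.
  rewrite exchange_big; apply: eq_bigr => c _ /=.
  under eq_bigr do rewrite mulr_sumr.
  rewrite exchange_big; apply: eq_bigr => d _ /=; rewrite 2!mulr_suml.
  by apply: eq_bigr => k _; rewrite !mulrA.
have key := @koszul_pairing _ h (fun c d e => christoffel b c d e (F x)) H
  (p i) (p j) (p l) (fun c => \sum_k christoffel a k i j x * p k c)
  (pp i j) (pp j i) (pp i l) (pp l i) (pp j l) (pp l j) h10 H10 lower
  (ppC j i) (ppC l i) (ppC l j).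
apply: etrans key.
congr (_ * _); apply: eq_bigr => c _; apply: eq_bigr => d _; congr (_ * _ * _).
Qed.

Let S i j l := \sum_c \sum_d h c d * B c i j * p l d.
Let curl i l := dw i l - dw l i.

(** The pulled back metric is the domain metric minus [w] tensor [w]. The polarised derivative of
    the former cancels the Christoffel symbols of the domain, and only derivatives of [w] remain. *)
Let pairing_form i j l : 2 * S i j l =
  (2 * (\sum_k christoffel a k i j x * w x 0 k) - dw i j - dw j i) * w x 0 l
  - w x 0 j * curl i l - w x 0 i * curl j l.
Proof.
have mE e k r : partial e (pull k r) x = partial e (fun y => metric a y k r : R) x
    - (dw e k * w x 0 r + w x 0 k * dw e r).
  by rewrite metric_derive addrC addKr.
have -> : 2 * S i j l = _ := pairing i j l.
have -> : \sum_k christoffel a k i j x * pull k l x =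
    \sum_k christoffel a k i j x * metric a x k l
    - (\sum_k christoffel a k i j x * w x 0 k) * w x 0 l.
  rewrite mulr_suml -sumrB; apply: eq_bigr => k _.
  by rewrite (metricE _ _ Ox) -mulrA -mulrBr addrC addKr.
rewrite !mE christoffel_lower; last exact: Oa.
rewrite /curl; move: (\sum_k _) (partial i _ _) (partial j _ _) (partial l _ _).
move: (dw i j) (dw j i) (dw i l) (dw l i) (dw j l) (dw l j).
by move: (w x 0 i) (w x 0 j) (w x 0 l) => *; field.
Qed.

(** The part of [pairing_form] proportional to [w_l] dies against a [Z] with [w(Z) = 0]. The other
    two parts are exchanged by [i] and [j], so their traces agree and the factor 2 cancels. *)
Lemma tension_pairing (Z : 'rV[R]_m) : \sum_l Z 0 l * w x 0 l = 0 ->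
  \sum_c \sum_d tension a b f c x * metric b (F x) c d * (Z *m 'J F x) 0 d =
  - \sum_i (w x *m invmx (metric a x)) 0 i * \sum_l Z 0 l *
     (partial i (fun y => w y 0 l : R) x - partial l (fun y => w y 0 i : R) x).
Proof.
move=> Zw; set G := invmx (metric a x).
have Gsym i j : G i j = G j i.
  by rewrite /G -[in RHS](metric_sym (Oa Ox)) -trmx_inv [RHS]mxE.
pose D i := \sum_l Z 0 l * curl i l.
have SZ i j : 2 * \sum_l Z 0 l * S i j l = - (w x 0 j * D i + w x 0 i * D j).
  rewrite mulr_sumr; under eq_bigr do rewrite mulrCA pairing_form.
  set Q := _ - _ - _.
  transitivity (Q * (\sum_l Z 0 l * w x 0 l) - (w x 0 j * D i + w x 0 i * D j)).
    rewrite /D !mulr_sumr -big_split -sumrB; apply: eq_bigr => l _ /=.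
    move: Q (curl i l) (curl j l) (Z 0 l) (w x 0 l) (w x 0 i) (w x 0 j) => *; ring.
  by rewrite Zw mulr0 add0r.
have two_inj (s t : R) : 2 * s = 2 * t -> s = t by apply: mulfI; rewrite pnatr_eq0.
transitivity (\sum_i \sum_j G i j * \sum_l Z 0 l * S i j l).
  transitivity (\sum_c \sum_d \sum_i \sum_j \sum_l
      G i j * B c i j * h c d * (Z 0 l * p l d)).
    apply: eq_bigr => c _; apply: eq_bigr => d _.
    rewrite /tension !mulr_suml; apply: eq_bigr => i _.
    rewrite !mulr_suml; apply: eq_bigr => j _.
    rewrite [(Z *m _) 0 d]mxE mulr_sumr; apply: eq_bigr => l _.
    by rewrite (jacobianE _ _ (dF Ox)).
  under eq_bigr do rewrite exchange_big.
  rewrite exchange_big; apply: eq_bigr => i _ /=.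
  under eq_bigr do rewrite exchange_big.
  rewrite exchange_big; apply: eq_bigr => j _ /=.
  under eq_bigr do rewrite exchange_big.
  rewrite exchange_big mulr_sumr; apply: eq_bigr => l _ /=.
  rewrite /S !mulr_sumr; apply: eq_bigr => c _.
  rewrite !mulr_sumr; apply: eq_bigr => d _.
  by move: (B c i j) (p l d) (h c d) (G i j) (Z 0 l) => *; ring.
apply: two_inj; rewrite mulr_sumr.
transitivity (- \sum_i \sum_j (G i j * w x 0 j * D i + G i j * w x 0 i * D j)).
  rewrite -sumrN; apply: eq_bigr => i _; rewrite mulr_sumr -sumrN; apply: eq_bigr => j _.
  rewrite mulrCA SZ.
  by move: (G i j) (D i) (D j) (w x 0 i) (w x 0 j) => *; ring.
rewrite mulrN; congr (- _).
have VD : \sum_i \sum_j G i j * w x 0 j * D i = \sum_i (w x *m G) 0 i * D i.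
  apply: eq_bigr => i _; rewrite mxE mulr_suml; apply: eq_bigr => j _.
  by rewrite Gsym [G j i * _]mulrC.
under eq_bigr do rewrite big_split/=.
rewrite big_split/= VD [X in _ + X]exchange_big/=.
rewrite -[2 * _]/(_ * _) mulr2n mulrDl mul1r; congr (_ + _).
rewrite -VD; apply: eq_bigr => i _; apply: eq_bigr => j _; by rewrite Gsym.
Qed.

(** Positive definiteness gives [w(v) != 0], so any [Z] becomes horizontal by subtracting a multiple
    of [v], without changing [Z *m 'J F x]. Hence the tension vector is orthogonal to the whole
    image of the differential. *)
Lemma closed_form_tension (v : 'rV[R]_m) c : row_full ('J F x) ->
  v != 0 -> v *m 'J F x = 0 ->
  (forall i l, partial i (fun y => w y 0 l : R) x = partial l (fun y => w y 0 i : R) x) ->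
  tension a b f c x = 0.
Proof.
move=> Jfull v0 vJ closed; set s := \sum_l v 0 l * w x 0 l.
have s0 : s != 0.
  apply: contraTneq (metric_posdef (Oa Ox) v0) => sE.
  rewrite GE// mulmxDr mulmxDl !mulmxA vJ !mul0mx addr0.
  suff -> : v *m (w x)^T = 0 by rewrite !mul0mx mxE ltxx.
  apply/matrixP => i j; rewrite !mxE (ord1 i).
  by rewrite -[RHS]sE; apply: eq_bigr => l _; rewrite mxE (ord1 j).
pose t := \row_c tension a b f c x.
have tZ (Z : 'rV[R]_m) : \sum_c \sum_d tension a b f c x * h c d * (Z *m 'J F x) 0 d = 0.
  pose k := (\sum_l Z 0 l * w x 0 l) / s.
  have Zk : \sum_l (Z - k *: v : 'rV[R]_m) 0 l * w x 0 l = 0.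
    rewrite (eq_bigr (fun l => Z 0 l * w x 0 l - k * (v 0 l * w x 0 l))); last first.
      by move=> l _; rewrite !mxE; ring.
    by rewrite sumrB -mulr_sumr -/s divfK// subrr.
  have := tension_pairing Zk; rewrite mulmxBl -scalemxAl vJ scaler0 subr0 => ->.
  rewrite big1 ?oppr0// => i _; rewrite big1 ?mulr0// => l _.
  by rewrite closed subrr mulr0.
(* By surjectivity the tension vector is itself in the image, so it is orthogonal to itself. *)
have /submxP[Z tE] : (t <= 'J F x)%MS by exact: submx_full.
have t0 : t = 0.
  apply/eqP/negPn/negP => t0; have := metric_posdef hx t0.
  suff -> : (t *m metric b (F x) *m t^T) 0 0 = 0 by rewrite ltxx.
  rewrite -[RHS](tZ Z) -tE mxE exchange_big; apply: eq_bigr => d _.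
  rewrite mxE mulr_suml; apply: eq_bigr => e _.
  by rewrite [t 0 e]mxE [t^T d 0]mxE.
by have := congr1 (fun r : 'rV[R]_2 => r 0 c) t0; rewrite !mxE.
Qed.

(** [tension_pairing] gives [dw (v, Z) = 0] for horizontal [Z], antisymmetry gives it for [Z = v],
    and each coordinate vector is a sum of two such vectors. *)
Lemma tension_free_curl (v : 'rV[R]_m) l : v *m 'J F x = 0 ->
  w x = v *m metric a x -> \sum_l v 0 l * w x 0 l = 1 ->
  (forall c, tension a b f c x = 0) ->
  \sum_i v 0 i * (partial i (fun y => w y 0 l : R) x - partial l (fun y => w y 0 i : R) x) = 0.
Proof.
move=> vJ wE vw1 tau0.
have vE : w x *m invmx (metric a x) = v by rewrite wE mulmxK// metric_unit//; exact: Oa.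
pose D i (Z : 'rV[R]_m) := \sum_l Z 0 l * curl i l.
have vD (Z : 'rV[R]_m) : \sum_l Z 0 l * w x 0 l = 0 -> \sum_i v 0 i * D i Z = 0.
  move=> Zw; have := tension_pairing Zw; rewrite vE => Ev.
  apply/eqP; rewrite -oppr_eq0 -Ev; apply/eqP.
  by apply: big1 => c _; apply: big1 => d _; rewrite tau0 !mul0r.
have vv : \sum_i v 0 i * D i v = 0.
  (* Exchanging the two summation indices changes the sign of the curl. *)
  set s := LHS; suff : s = - s by move/eqP; rewrite -addr_eq0 -mulr2n mulrn_eq0 => /eqP.
  rewrite /s -sumrN /D.
  under eq_bigr do rewrite mulr_sumr; rewrite exchange_big; apply: eq_bigr => i _ /=.
  rewrite mulr_sumr -sumrN; apply: eq_bigr => j _; rewrite /curl.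
  by move: (dw i j) (dw j i) (v 0 i) (v 0 j) => *; ring.
pose e : 'rV[R]_m := delta_mx 0 l; pose k := \sum_i e 0 i * w x 0 i.
have Zk : \sum_i (e - k *: v : 'rV[R]_m) 0 i * w x 0 i = 0.
  rewrite (eq_bigr (fun i => e 0 i * w x 0 i - k * (v 0 i * w x 0 i))); last first.
    by move=> i _; rewrite !mxE; ring.
  by rewrite sumrB -mulr_sumr vw1 mulr1 subrr.
have := vD _ Zk; rewrite (eq_bigr (fun i => v 0 i * curl i l - k * (v 0 i * D i v))).
  by rewrite sumrB -mulr_sumr vv mulr0 subr0.
move=> i _; rewrite mulrCA -mulrBr; congr (_ * _).
rewrite /D mulr_sumr.
rewrite (eq_bigr (fun j => e 0 j * curl i j - k * (v 0 j * curl i j))); last first.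
  by move=> j _; rewrite !mxE; ring.
rewrite sumrB; congr (_ - _).
rewrite (bigD1 l)//= big1 ?addr0; first by rewrite mxE !eqxx mul1r.
by move=> j /negPf jl; rewrite mxE jl andbF mul0r.
Qed.

(** The Lie derivative along [V] kills both summands of the metric: [w] by Cartan's formula, and the
    pulled back metric because [V] is annihilated by the differential of the map. *)
Lemma killing_equation (V : 'rV[R]_m -> 'rV[R]_m) i j : smooth O V ->
  (forall y, O y -> V y *m 'J F y = 0) ->
  (forall y, O y -> \sum_k V y 0 k * w y 0 k = 1) ->
  (forall l, \sum_k V x 0 k *
    (partial k (fun y => w y 0 l : R) x - partial l (fun y => w y 0 k : R) x) = 0) ->
  \sum_k (V x 0 k * partial k (fun y => metric a y i j : R) x
    + partial i (fun y => V y 0 k : R) x * metric a x k j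
    + partial j (fun y => V y 0 k : R) x * metric a x k i) = 0.
Proof.
move=> sV VJ Vw curlV.
pose dV e k := partial e (fun y => V y 0 k : R) x.
have dVk k y : O y -> differentiable (fun y => V y 0 k : R) y.
  by move=> Oy; apply: smooth_differentiable Oy; exact: smooth_coord.
(* The equation [df V = 0] differentiated in direction [e], with the second derivatives
   exchanged. *)
have lieF e c : \sum_k (V x 0 k * pp k e c + dV e k * p k c) = 0.
  rewrite -[RHS](partial_cst 0 e x).
  rewrite -(open_eq_partial e oO Ox (f := fun y => \sum_k V y 0 k * partial k (Fc c) y)).
    rewrite partial_sum => [|k]; last by apply: differentiableM; [exact: dVk|exact: dpF].
    apply: eq_bigr => k _; rewrite partialM; [|exact: dVk|exact: dpF].
    rewrite (partialC e k oO (sFc c) Ox); exact: addrC.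
  move=> y Oy; have := congr1 (fun A : 'rV[R]_2 => A 0 c) (VJ y Oy).
  rewrite [LHS]mxE [RHS]mxE => V0; apply: etrans V0; apply: eq_bigr => k _.
  by rewrite (jacobianE _ _ (dF Oy)).
(* Cartan's formula: [L_V w = i_V dw + d (w(V))], with [w(V)] constantly 1. *)
have liew e : \sum_k (V x 0 k * dw k e + dV e k * w x 0 k) = 0.
  have dVw : \sum_k (dV e k * w x 0 k + V x 0 k * dw e k) = 0.
    rewrite -[RHS](partial_cst 1 e x).
    rewrite -(open_eq_partial e oO Ox (f := fun y => \sum_k V y 0 k * w y 0 k))//.
    rewrite partial_sum => [|k]; last by apply: differentiableM; [exact: dVk|exact: dwl].
    by apply: eq_bigr => k _; rewrite partialM; [|exact: dVk|exact: dwl].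
  transitivity (\sum_k (V x 0 k * (dw k e - dw e k)
      + (dV e k * w x 0 k + V x 0 k * dw e k))).
    apply: eq_bigr => k _.
    move: (dw k e) (dw e k) (V x 0 k) (w x 0 k) (dV e k) => *; ring.
  by rewrite big_split/= dVw addr0; exact: curlV.
have VF c : \sum_k V x 0 k * p k c = 0.
  have := congr1 (fun A : 'rV[R]_2 => A 0 c) (VJ x Ox).
  rewrite [LHS]mxE [RHS]mxE => V0; apply: etrans V0; apply: eq_bigr => k _.
  by rewrite (jacobianE _ _ (dF Ox)).
have h10 : h 1 0 = h 0 1 by exact: metric_symE.
have lieP : \sum_k (V x 0 k * partial k (pull i j) x + dV i k * pull k j x
    + dV j k * pull k i x) = 0.
  transitivity (\sum_k \sum_c \sum_d ((V x 0 k * pp k i c + dV i k * p k c) * h c d * p j d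
      + p i c * (H 0 c d * (V x 0 k * p k 0) + H 1 c d * (V x 0 k * p k 1)) * p j d
      + p i c * h c d * (V x 0 k * pp k j d + dV j k * p k d))).
    apply: eq_bigr => k _; rewrite pull_derive.
    exact: (lie_pairing H (pp k i) (pp k j) (p i) (p j) (p k) (V x 0 k) (dV i k) (dV j k) h10).
  rewrite exchange_big; apply: big1 => c _ /=.
  rewrite exchange_big; apply: big1 => d _ /=.
  apply: etrans (sum_affine (fun k => V x 0 k * pp k i c + dV i k * p k c)
    (fun k => V x 0 k * p k 0) (fun k => V x 0 k * p k 1)
    (fun k => V x 0 k * pp k j d + dV j k * p k d) _ _ _ _ _) _.
  by rewrite (lieF i c) (lieF j d) (VF 0) (VF 1) !(mulr0, mul0r, addr0).
transitivity (\sum_k ((V x 0 k * dw k i + dV i k * w x 0 k) * w x 0 j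
    + w x 0 i * (V x 0 k * dw k j + dV j k * w x 0 k)
    + (V x 0 k * partial k (pull i j) x + dV i k * pull k j x + dV j k * pull k i x))).
  apply: eq_bigr => k _; rewrite metric_derive !(metricE _ _ Ox) /dV.
  move: (partial _ (pull i j) x) (pull k j x) (pull k i x) (dw k i) (dw k j).
  move: (partial i _ x) (partial j _ x) (V x 0 k) (w x 0 i) (w x 0 j) (w x 0 k) => *; ring.
rewrite big_split/= lieP addr0 big_split/= -mulr_suml -mulr_sumr.
by rewrite (liew i) (liew j) mul0r mulr0 addr0.
Qed.

End Tension.

(** * Local representatives and changes of charts *)

Section Charts.
Context {R : realType} {n : nat} (L : riemannian_manifold R n).
Implicit Types (a b : chart L) (p : L) (x : 'rV[R]_n).

Lemma chart_imageP a x : chart_image a x ->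
  dom a (param a x) /\ coord a (param a x) = x.
Proof. by move=> [p ap <-]; rewrite coordK. Qed.

Lemma chart_image_coord a p : dom a p -> chart_image a (coord a p).
Proof. by exists p. Qed.

Lemma near_coord a p (A : set L) : dom a p -> nbhs p A ->
  \forall x \near coord a p,
    [/\ chart_image a x, dom a (param a x), coord a (param a x) = x & A (param a x)].
Proof.
move=> ap pA; have ax := chart_image_coord ap.
have : nbhs (coord a p) (chart_image a `&` param a @^-1` A).
  apply: filterI; first by apply: open_nbhs_nbhs; split=> //; exact: open_chart_image.
  by apply: (param_continuous_at ax); rewrite coordK.
by apply: filterS => x [/[dup] ax' /chart_imageP[? ?] ?].
Qed.

Lemma near_param a p (O : set 'rV[R]_n) : dom a p -> nbhs (coord a p) O ->
  \forall q \near p, dom a q /\ O (coord a q).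
Proof.
move=> ap Op; apply: filterI.
  by apply: open_nbhs_nbhs; split=> //; exact: dom_open.
exact: coord_continuous_at ap _ Op.
Qed.

Lemma open_param a (O : set 'rV[R]_n) : open O ->
  open [set p | dom a p /\ O (coord a p)].
Proof.
move=> oO; rewrite openE => p [ap Op]; apply: near_param => //.
exact: open_nbhs_nbhs.
Qed.

End Charts.

Lemma nbhs_open_sub (T : topologicalType) (x : T) (P : set T) : nbhs x P ->
  exists O, [/\ open O, O x & O `<=` P].
Proof.
move=> xP; exists P^°; split; [exact: open_interior|exact: xP|exact: interior_subset].
Qed.

Lemma bilinear_mx_inj (R : realType) n (A B : 'M[R]_n) :
  (forall u v : 'rV[R]_n, (u *m A *m v^T) 0 0 = (u *m B *m v^T) 0 0) -> A = B.
Proof.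
move=> AB; apply/matrixP => i j; have := AB (delta_mx 0 i) (delta_mx 0 j).
by rewrite -!rowE trmx_delta -!colE !mxE.
Qed.

Section SmoothMaps.
Context {R : realType} {m n : nat}.
Variables (E : riemannian_manifold R m) (N : riemannian_manifold R n).
Implicit Types (f : E -> N) (a : chart E) (b : chart N) (p : E).

Lemma near_local_rep a b a0 b0 f p : {for p, continuous f} ->
  dom a p -> dom a0 p -> dom b (f p) -> dom b0 (f p) ->
  \forall x \near coord a p, [/\ (coord a @` (dom a `&` dom a0)) x,
    (coord b0 @` (dom b0 `&` dom b)) (local_rep a0 b0 f ((coord a0 \o param a) x)) &
    local_rep a b f x = ((coord b \o param b0) \o local_rep a0 b0 f \o
                         (coord a0 \o param a)) x].
Proof.
move=> cf ap a0p bfp b0fp.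
have : nbhs p (dom a0 `&` f @^-1` (dom b0 `&` dom b)).
  apply: filterI; first by apply: open_nbhs_nbhs; split=> //; exact: dom_open.
  apply: cf; apply: filterI; apply: open_nbhs_nbhs; split=> //; exact: dom_open.
move=> /(near_coord ap); apply: filterS => x [ax aq qx [a0q [b0q bq]]].
split; first by exists (param a x).
  by exists (f (param a x)) => //; rewrite /local_rep /= coordK.
by rewrite /local_rep /= !coordK.
Qed.

(** [smooth_at] quantifies over all charts; smooth transition maps on both sides reduce it to one
    pair. *)
Lemma smooth_at_chart f a0 b0 p : {for p, continuous f} ->
  dom a0 p -> dom b0 (f p) ->
  (exists2 O : set 'rV[R]_m, open_nbhs (coord a0 p) O & smooth O (local_rep a0 b0 f)) ->
  smooth_at f p.
Proof.
move=> cf a0p b0p [] O [oO Op] sO; split=> // a b ap bp.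
pose T1 := coord a0 \o param a; pose T2 := coord b \o param b0.
pose D1 := coord a @` (dom a `&` dom a0); pose D2 := coord b0 @` (dom b0 `&` dom b).
have oD1 : open D1 by exact: transition_open.
have oD2 : open D2 by exact: transition_open.
have s1 : smooth D1 T1 by exact: transition_smooth.
have s2 : smooth D2 T2 by exact: transition_smooth.
have [Q [oQ Qp QP]] := nbhs_open_sub (filterI
  (near_local_rep cf ap a0p bp b0p) (near_coord ap (near_param a0p (open_nbhs_nbhs (conj oO Op))))).
exists Q => //.
apply: (eq_smooth (f := (T2 \o local_rep a0 b0 f) \o T1)) => //.
  by move=> x /QP[[_ _ ->]].
have O1 x : Q x -> O (T1 x) by move=> /QP[_ [_ _ _ []]].
pose O2 := O `&` local_rep a0 b0 f @^-1` D2.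
have oO2 : open O2.
  rewrite openE => x [Ox D2x]; apply: filterI; first exact: open_nbhs_nbhs.
  by apply: (smooth_continuous sO Ox); exact: open_nbhs_nbhs.
apply: (smooth_comp (O' := O2)) => //.
- by move=> x Qx; split; [exact: O1|have /QP[[]] := Qx].
- by apply: smoothS s1 => x /QP[[]].
- by apply: (smooth_comp (O' := D2)) => //; [move=> x []|apply: smoothS sO => x []].
Qed.

Lemma smooth_at_differentiable f a b p : smooth_at f p -> dom a p -> dom b (f p) ->
  differentiable (local_rep a b f) (coord a p).
Proof.
move=> [_ sf] ap bp; have [Q [oQ Qp] sQ] := sf a b ap bp.
exact: smooth_differentiable sQ Qp.
Qed.

Lemma differential_chart f a b a0 b0 p : smooth_at f p ->
  dom a p -> dom a0 p -> dom b (f p) -> dom b0 (f p) ->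
  differential a b f p = 'J (coord a0 \o param a) (coord a p) *m
    differential a0 b0 f p *m 'J (coord b \o param b0) (coord b0 (f p)).
Proof.
move=> sf ap a0p bp b0p.
have dl := smooth_at_differentiable sf ap bp.
have dl0 := smooth_at_differentiable sf a0p b0p.
have d1 : differentiable (coord a0 \o param a) (coord a p).
  by apply: smooth_differentiable (transition_smooth a a0) _; exists p.
have d2 : differentiable (coord b \o param b0) (coord b0 (f p)).
  by apply: smooth_differentiable (transition_smooth b0 b) _; exists (f p).
have E1 : (coord a0 \o param a) (coord a p) = coord a0 p by rewrite /= coordK.
have E2 : local_rep a0 b0 f (coord a0 p) = coord b0 (f p).
  by rewrite /local_rep /= coordK.
rewrite -E1 in dl0; rewrite -E2 in d2.
have d20 : differentiable ((coord b \o param b0) \o local_rep a0 b0 f)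
    ((coord a0 \o param a) (coord a p)).
  by apply: differentiable_comp => //; rewrite E1.
have nE := near_local_rep sf.1 ap a0p bp b0p.
have {}nE : {near coord a p, local_rep a b f =1
    ((coord b \o param b0) \o local_rep a0 b0 f) \o (coord a0 \o param a)}.
  by apply: filterS nE => x [].
apply: etrans (near_eq_jacobian dl nE) _.
apply: etrans (jacobian_comp d1 d20) _.
rewrite -mulmxA; congr (_ *m _).
apply: etrans (jacobian_comp dl0 _) _; first by rewrite E1.
by rewrite E1 E2.
Qed.

Lemma metric_preserving_chart f a0 b0 p : smooth_at f p ->
  dom a0 p -> dom b0 (f p) ->
  metric a0 (coord a0 p) = differential a0 b0 f p *m metric b0 (coord b0 (f p))
                           *m (differential a0 b0 f p)^T ->
  metric_preserving_at f p.
Proof.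
move=> sf a0p b0p GE a b ap bp /= u v.
rewrite /inner (differential_chart sf ap a0p bp b0p).
rewrite (metric_transition ap a0p) GE (metric_transition b0p bp).
by rewrite !trmx_mul !mulmxA.
Qed.

Lemma metric_preserving_mx f a b p : metric_preserving_at f p ->
  dom a p -> dom b (f p) ->
  metric a (coord a p) = differential a b f p *m metric b (coord b (f p))
                           *m (differential a b f p)^T.
Proof.
move=> fp ap bp; apply: bilinear_mx_inj => u v.
have := fp a b ap bp u v; rewrite /inner => <-.
by rewrite trmx_mul !mulmxA.
Qed.

(** The bridge from coordinates to manifolds: whatever is proved about a coordinate map [phi] holds
    for a map that agrees with [param b \o phi \o coord a] near [p]. *)
Lemma chart_map f a b p (phi : 'rV[R]_m -> 'rV[R]_n) (O : set 'rV[R]_m) :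
  dom a p -> open O -> O (coord a p) -> smooth O phi ->
  chart_image b (phi (coord a p)) ->
  {near p, f =1 param b \o phi \o coord a} ->
  [/\ smooth_at f p, dom b (f p), coord b (f p) = phi (coord a p) &
      differential a b f p = 'J phi (coord a p)].
Proof.
move=> ap oO Op sphi bphi fE.
have fpE : f p = param b (phi (coord a p)) by exact: nbhs_singleton fE.
have [bp cbp] := chart_imageP bphi; rewrite -fpE in bp cbp.
have cphi := smooth_continuous sphi Op.
have cf : {for p, continuous f}.
  move=> A; rewrite fpE => fA.
  have nA : nbhs p ((param b \o phi \o coord a) @^-1` A).
    exact: (coord_continuous_at ap (cphi _ (param_continuous_at bphi fA))).
  by apply: filterS (filterI nA fE) => q /= [? ->].
have nphi : nbhs (coord a p) (O `&` phi @^-1` chart_image b).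
  apply: filterI; first exact: open_nbhs_nbhs.
  by apply: cphi; apply: open_nbhs_nbhs; split=> //; exact: open_chart_image.
have [Q [oQ Qp QP]] := nbhs_open_sub (filterI nphi (near_coord ap fE)).
have repE x : Q x -> phi x = local_rep a b f x.
  move=> /QP[[_ /= bx] [_ _ /= qx qE]].
  by rewrite /local_rep /= qE /= qx (chart_imageP bx).2.
have sQ : smooth Q phi by apply: smoothS sphi => x /QP[[]].
split; [|exact: bp|exact: cbp|].
  apply: (smooth_at_chart cf ap bp); exists Q; first by split.
  exact: eq_smooth repE sQ.
apply: esym; apply: near_eq_jacobian; first exact: smooth_differentiable sQ Qp.
by apply: filterS (open_nbhs_nbhs (conj oQ Qp)).
Qed.

End SmoothMaps.

Lemma exists_left_kernel (R : fieldType) m n (A : 'M[R]_(m, n)) : (n < m)%N ->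
  exists2 v : 'rV[R]_m, v != 0 & v *m A = 0.
Proof.
move=> nm; exists (nz_row (kermx A)).
  rewrite nz_row_eq0 -mxrank_eq0 mxrank_ker subn_eq0 -ltnNge.
  exact: leq_ltn_trans (rank_leq_col A) nm.
by apply/sub_kermxP; exact: nz_row_sub.
Qed.

Section LineCoordinates.
Context {R : realType} {n : nat} (M : riemannian_manifold R n).

Lemma line_chart_image (a : chart M) :
  chart_image (a : chart (product_line M)) = lsubmx @^-1` chart_image a.
Proof. exact: line_image. Qed.

(** Acting from the right, [lproj] and [rproj] are the differentials of the projections of the
    product; the row [rproj^T] is the vector [d_z]. *)
Definition lproj : 'M[R]_(n + 1, n) := col_mx 1%:M 0.
Definition rproj : 'M[R]_(n + 1, 1) := col_mx 0 1%:M.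

Lemma mulmx_lproj m (A : 'M[R]_(m, n + 1)) : A *m lproj = lsubmx A.
Proof. by rewrite -[A in LHS]hsubmxK mul_row_col mulmx1 mulmx0 addr0. Qed.

Lemma mulmx_rproj m (A : 'M[R]_(m, n + 1)) : A *m rproj = rsubmx A.
Proof. by rewrite -[A in LHS]hsubmxK mul_row_col mulmx1 mulmx0 add0r. Qed.

Lemma line_metricE (a : chart M) (x : 'rV[R]_(n + 1)) :
  metric (a : chart (product_line M)) x =
  lproj *m metric a (lsubmx x) *m lproj^T + rproj *m rproj^T.
Proof.
rewrite /lproj /rproj !tr_col_mx !trmx1 !trmx0 !mul_col_mx !mul1mx !mul0mx.
by rewrite mul_mx_row mulmx1 mulmx0 add_col_mx addr0 add0r.
Qed.

(** For [A] the Jacobian of an isometry into the product, its last column is the form pulled back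
    from [dz], and the surface part of the metric is pulled back once more through [B]. *)
Lemma line_pullback_metric m k (A : 'M[R]_(m, n + 1)) (B : 'M[R]_(n, k))
    (g : 'M[R]_n) (h : 'M[R]_k) : g = B *m h *m B^T ->
  A *m (lproj *m g *m lproj^T + rproj *m rproj^T) *m A^T =
  (rsubmx A)^T^T *m (rsubmx A)^T + (A *m lproj *m B) *m h *m (A *m lproj *m B)^T.
Proof.
move=> ->; rewrite trmxK -mulmx_rproj mulmxDr mulmxDl addrC.
by rewrite !trmx_mul !mulmxA.
Qed.

Lemma jacobian_lsubmx (x : 'rV[R]_(n + 1)) :
  'J (lsubmx : 'rV[R]_(n + 1) -> 'rV[R]_n) x = lproj.
Proof.
rewrite -[RHS](jacobian_mulmxr _ x); congr (jacobian _ x).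
by apply/funext => y; rewrite mulmx_lproj.
Qed.

End LineCoordinates.

(** * Maps of the local form have vanishing tension *)

Section LocalFormHarmonic.
Context {R : realType} (M N : riemannian_manifold R 2).
Variables (pi : product_line M -> N) (p : product_line M).
Variables (U V : set (product_line M)) (Phi : product_line M -> product_line M).
Variables (W : set M) (psi : M -> N).
Hypotheses (Up : U p) (oU : open U) (oW : open W).
Hypotheses (sPhi : smooth_on U Phi) (mPhi : forall q, U q -> metric_preserving_at Phi q).
Hypothesis PhiW : forall q, U q -> W (Phi q).1.
Hypotheses (spsi : smooth_on W psi) (mpsi : forall q, W q -> metric_preserving_at psi q).
Hypothesis piE : forall q, U q -> pi q = psi (Phi q).1.
Hypothesis spi : smooth_at pi p.

Lemma local_form_tension (a : chart (product_line M)) (b : chart N) c :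
  dom a p -> dom b (pi p) -> row_full (differential a b pi p) ->
  tension a b pi c (coord a p) = 0.
Proof.
move=> ap bp Jfull; set x := coord a p.
have [a' ap'] := dom_cover (Phi p).1.
have ap'' : dom (a' : chart (product_line M)) (Phi p) by [].
have bp' : dom b (psi (Phi p).1) by rewrite -piE.
pose phi := local_rep a (a' : chart (product_line M)) Phi.
pose Psi := local_rep a' b psi.
pose F := local_rep a b pi.
have [Q1 [oO1 O1x] sphi] := (sPhi Up).2 a a' ap ap''.
have [Q2 [oO2 O2x] sPsi] := (spsi (PhiW Up)).2 a' b ap' bp'.
have [Q3 [oO3 O3x] sF] := spi.2 a b ap bp.
have cPhi := (sPhi Up).1.
(* Shrinks the neighbourhood until [pi], [Phi] and [psi] are all read in fixed charts. *)
have nU : nbhs p (U `&` Phi @^-1` (dom (a' : chart (product_line M)) `&`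
    [set q | Q2 (coord a' q.1)]) `&` pi @^-1` dom b).
  apply: filterI; first apply: filterI.
  - exact: open_nbhs_nbhs.
  - apply: cPhi; apply: filterI; first by apply: open_nbhs_nbhs; split=> //; exact: dom_open.
    have := near_param (L := product_line M) ap'' (open_nbhs_nbhs (conj (open_lsubmx oO2) _)).
    rewrite /= row_mxKl => /(_ O2x); apply: filterS => q [_].
    by rewrite /= row_mxKl.
  - by apply: spi.1; apply: open_nbhs_nbhs; split=> //; exact: dom_open.
have [Q [oQ Qx QP]] := nbhs_open_sub (filterI (near_coord ap nU)
  (filterI (open_nbhs_nbhs (conj oO1 O1x)) (open_nbhs_nbhs (conj oO3 O3x)))).
have phiE y : Q y -> lsubmx (phi y) = coord a' (Phi (param a y)).1.
  by move=> _; rewrite /phi /local_rep /= row_mxKl.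
have Oa y : Q y -> chart_image a y by move=> /QP[[]].
have sphiO : smooth Q phi by apply: smoothS sphi => y /QP[_ []].
have sFO : smooth Q F by apply: smoothS sF => y /QP[_ []].
have FE y : Q y -> F y = (Psi \o lsubmx \o phi) y.
  move=> /[dup] Oy /QP[[ay ady ya [[Uy [ay' _]] _]] _].
  by rewrite /F /Psi /local_rep /= phiE// coordK// piE.
have Fb y : Q y -> chart_image b (F y).
  by move=> /QP[[_ _ _ [_ by_]] _]; exists (pi (param a y)).
have lphi y : Q y -> Q2 (lsubmx (phi y)).
  by move=> /[dup] Oy /QP[[_ _ _ [[_ [_ ?]] _]] _]; rewrite phiE.
have dPsi y : Q y -> differentiable Psi (lsubmx (phi y)).
  by move=> /lphi; exact: smooth_differentiable sPsi.
have dphi y : Q y -> differentiable phi y by exact: smooth_differentiable.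
have dl (y : 'rV[R]_(2 + 1)) : differentiable (lsubmx : 'rV[R]_(2 + 1) -> 'rV[R]_2) y.
  exact: differentiable_lsubmx.
have JF y : Q y -> 'J F y = 'J phi y *m @lproj R 2 *m 'J Psi (lsubmx (phi y)).
  move=> Oy; have nE : {near y, F =1 Psi \o lsubmx \o phi}.
    by apply: filterS (open_nbhs_nbhs (conj oQ Oy)) => z; exact: FE.
  apply: etrans (near_eq_jacobian (smooth_differentiable sFO Oy) nE) _.
  have dlphi : differentiable (lsubmx \o phi) y.
    exact: (differentiable_comp (dphi y Oy) (dl _)).
  apply: etrans (jacobian_comp dlphi (dPsi y Oy)) _; congr (_ *m _).
  apply: etrans (jacobian_comp (dphi y Oy) (dl _)) _; congr (_ *m _).
  exact: jacobian_lsubmx.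
(* The gradient of the last coordinate of [phi]; Schwarz's theorem will make it closed. *)
pose w y := (rsubmx ('J phi y))^T.
have sw : smooth Q w.
  apply: smooth_trmx => //.
  apply: (eq_smooth (f := fun y => 'J phi y *m @rproj R 2)) => //.
    by move=> y _; rewrite mulmx_rproj.
  by apply: smooth_mulmx => //; [exact: smooth_jacobian|exact: smooth_cst].
have GE y : Q y ->
    metric a y = (w y)^T *m w y + 'J F y *m metric b (F y) *m ('J F y)^T.
  move=> Oy; have [[ay ady ya [[Uy [ay' _]] by_]] _] := QP y Oy.
  have E1 := metric_preserving_mx (mPhi Uy) ady ay'.
  have Wy := PhiW Uy; have by' : dom b (psi (Phi (param a y)).1) by rewrite -piE.
  have E2 := metric_preserving_mx (mpsi Wy) ay' by'.
  rewrite ya in E1; rewrite E1 line_metricE.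
  have -> : differential a (a' : chart (product_line M)) Phi (param a y) =
      'J phi y by rewrite /differential ya.
  have -> : lsubmx (coord (a' : chart (product_line M)) (Phi (param a y))) =
      coord a' (Phi (param a y)).1.
    by rewrite /= row_mxKl.
  have -> : metric b (F y) = metric b (coord b (psi (Phi (param a y)).1)).
    by rewrite /F /local_rep /= piE.
  rewrite (JF y Oy); apply: line_pullback_metric.
  by apply: etrans E2 _; rewrite /differential phiE.
(* A vertical vector exists because [2 < 2 + 1], which is what [leqnn 3] states. *)
have [v v0 vJ] := @exists_left_kernel R _ _ ('J F x) (leqnn 3).
apply: (closed_form_tension oQ Oa Qx sFO Fb sw GE c Jfull v0 vJ) => i l.
pose k : 'I_(2 + 1) := rshift 2 0.
have wE j y : Q y -> w y 0 j = partial j (fun z => phi z 0 k : R) y.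
  by move=> Oy; rewrite /w [LHS]mxE [LHS]mxE; exact: jacobianE (dphi y Oy).
have sk : smooth Q (fun z => phi z 0 k : R) by exact: smooth_coord.
apply: etrans (open_eq_partial i oQ Qx (wE l)) _.
apply: etrans (partialC i l oQ sk Qx) _.
exact: esym (open_eq_partial l oQ Qx (wE i)).
Qed.

End LocalFormHarmonic.

(** * The unit vertical field *)

Section SmoothSqrt.
Context {R : realType} {n : nat}.

Lemma differentiable_sqrt (f : 'rV[R]_n -> R) x : 0 < f x ->
  differentiable f x -> differentiable (fun y => Num.sqrt (f y)) x.
Proof.
move=> f0 df; apply: (@differentiable_comp _ _ _ _ f Num.sqrt x df).
apply/derivable1_diffP; have [] := is_derive1_sqrt f0; exact.
Qed.

(** Differentiates [f = sqrt f * sqrt f], valid near [x] since [f] stays positive there. *)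
Lemma partial_sqrt (f : 'rV[R]_n -> R) x i : 0 < f x -> differentiable f x ->
  partial i (fun y => Num.sqrt (f y)) x = (2 * Num.sqrt (f x))^-1 * partial i f x.
Proof.
move=> f0 df; set s := Num.sqrt (f x).
have s0 : 0 < s by rewrite sqrtr_gt0.
have ds := differentiable_sqrt f0 df.
have nf : {near x, f =1 fun y => Num.sqrt (f y) * Num.sqrt (f y)}.
  have cf := differentiable_continuous df.
  have : nbhs x (f @^-1` [set t | 0 < t]).
    by apply: cf; apply: open_nbhs_nbhs; split=> //; exact: open_gt.
  by apply: filterS => y /= /ltW fy; rewrite -expr2 sqr_sqrtr.
rewrite (near_eq_partial i nf) partialM// -/s.
by move: (partial i _ x) => t; field; rewrite gt_eqF.
Qed.

Lemma smooth_sqrt (O : set 'rV[R]_n) (f : 'rV[R]_n -> R) : open O ->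
  (forall x, O x -> 0 < f x) -> smooth O f -> smooth O (fun x => Num.sqrt (f x)).
Proof.
move=> oO f0 sf; elim=> // k IH; split=> [x Ox|i].
  by apply: differentiable_sqrt; [exact: f0|exact: smooth_differentiable sf Ox].
apply: (eq_diff_order (f := fun x => (2 * Num.sqrt (f x))^-1 * partial i f x)) => //.
  by move=> x Ox; rewrite partial_sqrt//; [exact: f0|exact: smooth_differentiable sf Ox].
apply: diff_orderM => //; last exact: smooth_partial sf k.
apply: diff_orderV => //.
  by move=> x Ox; rewrite mulf_neq0// gt_eqF// sqrtr_gt0; exact: f0.
by apply: diff_orderM => //; exact: diff_order_cst.
Qed.

End SmoothSqrt.

Section VerticalVector.
Context {R : realType}.

(** Each vector is its horizontal part plus [al u *: v]. The differential sees only the horizontal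
    part, on which it is isometric, and the product of the coefficients [al] is the square of the
    dual form of [v]. *)
Lemma submersion_metric m n (G : 'M[R]_m) (J : 'M[R]_(m, n)) (h : 'M[R]_n)
    (v : 'rV[R]_m) : G^T = G -> v *m J = 0 -> (v *m G *m v^T) 0 0 = 1 ->
  (forall u : 'rV[R]_m, u *m J = 0 -> exists c, u = c *: v) ->
  (forall u u' : 'rV[R]_m, (forall w : 'rV[R]_m, w *m J = 0 -> (u *m G *m w^T) 0 0 = 0) ->
     (forall w : 'rV[R]_m, w *m J = 0 -> (u' *m G *m w^T) 0 0 = 0) ->
     (u *m J *m h *m (u' *m J)^T) 0 0 = (u *m G *m u'^T) 0 0) ->
  G = (v *m G)^T *m (v *m G) + J *m h *m J^T.
Proof.
move=> Gsym vJ vv kerJ iso; apply: bilinear_mx_inj => u u'.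
pose al (u : 'rV[R]_m) := (u *m G *m v^T) 0 0.
have alE (u0 : 'rV[R]_m) : u0 *m G *m v^T = (al u0)%:M by rewrite -mx11_scalar.
have alT (u0 : 'rV[R]_m) : v *m G *m u0^T = (al u0)%:M.
  by apply: trmx_inj; rewrite tr_scalar_mx -alE !trmx_mul trmxK Gsym mulmxA.
have subZE (A B : 'M[R]_1) c : (A - c *: B) 0 0 = A 0 0 - c * B 0 0 by rewrite !mxE.
pose hor u := u - al u *: v.
have vvE : v *m G *m v^T = 1%:M by rewrite (mx11_scalar (v *m G *m v^T)) vv.
have horP (u0 : 'rV[R]_m) (w : 'rV[R]_m) : w *m J = 0 -> (hor u0 *m G *m w^T) 0 0 = 0.
  move=> /kerJ[c ->]; rewrite linearZ /= -scalemxAr /hor !mulmxBl -!scalemxAl.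
  rewrite mxE subZE alE vvE [_%:M 0 0]mxE [1%:M 0 0]mxE eqxx !mulr1n.
  by rewrite mulr1 subrr mulr0.
have horJ (u0 : 'rV[R]_m) : hor u0 *m J = u0 *m J.
  by rewrite /hor mulmxBl -scalemxAl vJ scaler0 subr0.
have := iso (hor u) (hor u') (horP u) (horP u'); rewrite !horJ.
have -> : (hor u *m G *m (hor u')^T) 0 0 = (u *m G *m u'^T) 0 0 - al u * al u'.
  have -> : (hor u')^T = u'^T - al u' *: v^T by rewrite /hor linearB/= linearZ.
  rewrite mulmxBr -scalemxAr subZE (horP u v vJ) mulr0 subr0.
  by rewrite /hor !mulmxBl -!scalemxAl subZE alT [_%:M 0 0]mxE eqxx mulr1n.
move=> E; rewrite mulmxDr mulmxDl [RHS]mxE.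
have -> : u *m ((v *m G)^T *m (v *m G)) *m u'^T = (al u * al u')%:M.
  rewrite mulmxA -[_ *m _ *m u'^T]mulmxA alT -[u *m _]trmxK trmx_mul trmxK alT.
  by rewrite tr_scalar_mx -scalar_mxM.
have -> : u *m (J *m h *m J^T) *m u'^T = u *m J *m h *m (u' *m J)^T.
  by rewrite trmx_mul !mulmxA.
by rewrite E [_%:M 0 0]mxE eqxx mulr1n subrKC.
Qed.

(** [sp0] and [sp1] are the surface directions and [sp2] is the line; [lshift] and [rshift] match
    the blocks of [row_mx]. *)
Definition sp0 : 'I_(2 + 1) := lshift 1 0.
Definition sp1 : 'I_(2 + 1) := lshift 1 1.
Definition sp2 : 'I_(2 + 1) := rshift 2 0.

Lemma big_ord21 (V : nmodType) (g : 'I_(2 + 1) -> V) :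
  \sum_i g i = g sp0 + g sp1 + g sp2.
Proof. by rewrite big_split_ord /= big_ord1 big_ord2. Qed.

Lemma mulmx21E m (B : 'M[R]_(m, 2 + 1)) (J : 'M[R]_(2 + 1, 2)) i c :
  (B *m J) i c = B i sp0 * J sp0 c + B i sp1 * J sp1 c + B i sp2 * J sp2 c.
Proof. by rewrite mxE big_ord21. Qed.

(** The cross product of the two columns of [J]: a vector in the left kernel that is polynomial in
    [J], so it varies smoothly. *)
Definition cross (J : 'M[R]_(2 + 1, 2)) : 'rV[R]_(2 + 1) :=
  row_mx (\row_(j < 2) (if j == 0 then J sp1 0 * J sp2 1 - J sp2 0 * J sp1 1
                        else J sp2 0 * J sp0 1 - J sp0 0 * J sp2 1))
         (J sp0 0 * J sp1 1 - J sp1 0 * J sp0 1)%:M.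

Lemma crossE0 J : cross J 0 sp0 = J sp1 0 * J sp2 1 - J sp2 0 * J sp1 1.
Proof. by rewrite /cross row_mxEl mxE. Qed.

Lemma crossE1 J : cross J 0 sp1 = J sp2 0 * J sp0 1 - J sp0 0 * J sp2 1.
Proof. by rewrite /cross row_mxEl mxE. Qed.

Lemma crossE2 J : cross J 0 sp2 = J sp0 0 * J sp1 1 - J sp1 0 * J sp0 1.
Proof. by rewrite /cross row_mxEr mxE eqxx mulr1n. Qed.

Lemma ord21P (i : 'I_(2 + 1)) : [\/ i = sp0, i = sp1 | i = sp2].
Proof.
case: (split_ordP i) => j ->; last by rewrite (ord1 j); constructor 3.
by have [->|->] := ord2P j; [constructor 1|constructor 2].
Qed.

Lemma cross_mul J : cross J *m J = 0.
Proof.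
apply/rowP => c; rewrite mulmx21E crossE0 crossE1 crossE2 [RHS]mxE.
by have [->|->] := ord2P c; ring.
Qed.

(** If [B *m J = 1], the Cauchy-Binet formula expands the determinant 1 of the product in the
    components of [cross J], so these cannot all vanish. *)
Lemma cross_neq0 J : row_full J -> cross J != 0.
Proof.
move=> /row_fullP[B BJ]; apply/eqP => J0.
have E c d : (B *m J) c d = (c == d)%:R by rewrite BJ mxE.
have : (B *m J) 0 0 * (B *m J) 1 1 - (B *m J) 0 1 * (B *m J) 1 0 = 1.
  by rewrite !E /= mulr1 mulr0 subr0.
have c0 : cross J 0 sp0 = 0 by rewrite J0 mxE.
have c1 : cross J 0 sp1 = 0 by rewrite J0 mxE.
have c2 : cross J 0 sp2 = 0 by rewrite J0 mxE.
rewrite crossE0 in c0; rewrite crossE1 in c1; rewrite crossE2 in c2.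
rewrite !mulmx21E.
set lhs := LHS; have -> : lhs =
  (B 0 sp1 * B 1 sp2 - B 0 sp2 * B 1 sp1) * (J sp1 0 * J sp2 1 - J sp2 0 * J sp1 1)
  + (B 0 sp2 * B 1 sp0 - B 0 sp0 * B 1 sp2) * (J sp2 0 * J sp0 1 - J sp0 0 * J sp2 1)
  + (B 0 sp0 * B 1 sp1 - B 0 sp1 * B 1 sp0) * (J sp0 0 * J sp1 1 - J sp1 0 * J sp0 1).
  by rewrite /lhs; ring.
by rewrite c0 c1 c2 !mulr0 !addr0 => /esym/eqP; rewrite oner_eq0.
Qed.

(** The left kernel has dimension [3 - 2 = 1]. *)
Lemma left_kernel_line (J : 'M[R]_(2 + 1, 2)) (v u : 'rV[R]_(2 + 1)) : row_full J ->
  v != 0 -> v *m J = 0 -> u *m J = 0 -> exists c, u = c *: v.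
Proof.
move=> Jfull v0 vJ uJ; apply/sub_rVP.
have vker : (v <= kermx J)%MS by apply/sub_kermxP.
have uker : (u <= kermx J)%MS by apply/sub_kermxP.
apply: (submx_trans uker); rewrite -(geq_leqif (mxrank_leqif_sup vker)).
by rewrite mxrank_ker rank_rV v0; move: Jfull => /eqP ->.
Qed.

Lemma smooth_cross n (O : set 'rV[R]_n) (J : 'rV[R]_n -> 'M[R]_(2 + 1, 2)) :
  open O -> smooth O J -> smooth O (fun y => cross (J y)).
Proof.
move=> oO sJ; apply: smooth_mx => // i j; rewrite (ord1 i) {i}.
have s k c : smooth O (fun y => J y k c : R) by exact: smooth_coord.
have [->|->|->] := ord21P j.
- under eq_fun do rewrite crossE0.
  by apply: smoothB => //; apply: smoothM.
- under eq_fun do rewrite crossE1.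
  by apply: smoothB => //; apply: smoothM.
- under eq_fun do rewrite crossE2.
  by apply: smoothB => //; apply: smoothM.
Qed.

(** The cross product of the columns of the Jacobian, nonzero by surjectivity, divided by its
    length; [submersion_metric] then splits the metric. *)
Lemma unit_vertical_field (E : riemannian_manifold R (2 + 1)) (N : riemannian_manifold R 2)
    (a : chart E) (b : chart N) (f : E -> N) (O : set 'rV[R]_(2 + 1)) :
  riemannian_submersion f -> open O -> O `<=` chart_image a ->
  (forall y, O y -> dom b (f (param a y))) -> smooth O (local_rep a b f) ->
  exists V : 'rV[R]_(2 + 1) -> 'rV[R]_(2 + 1), smooth O V /\ forall y, O y ->
    [/\ V y *m 'J (local_rep a b f) y = 0, (V y *m metric a y *m (V y)^T) 0 0 = 1 &
     metric a y = (V y *m metric a y)^T *m (V y *m metric a y)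
       + 'J (local_rep a b f) y *m metric b (local_rep a b f y)
         *m ('J (local_rep a b f) y)^T].
Proof.
move=> [_ subf] oO Oa Ob sF; set F := local_rep a b f in sF *.
pose c y := cross ('J F y).
have sc : smooth O c by apply: smooth_cross => //; exact: smooth_jacobian.
pose q y := (c y *m metric a y *m (c y)^T) 0 0.
have sG : smooth O (metric a) by apply: smoothS Oa _; exact: smooth_metric.
have sq : smooth O q.
  by apply: smooth_coord => //; apply: smooth_mulmx => //; [exact: smooth_mulmx|exact: smooth_trmx].
have dat y : O y -> [/\ dom a (param a y), coord a (param a y) = y & row_full ('J F y)].
  move=> Oy; have [ay ya] := chart_imageP (Oa y Oy); split=> //.
  by have [+ _] := subf _ _ _ ay (Ob y Oy); rewrite /differential ya.
have q0 y : O y -> 0 < q y.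
  move=> Oy; apply: metric_posdef; first exact: Oa.
  by apply: cross_neq0; have [] := dat y Oy.
pose V y := (Num.sqrt (q y))^-1 *: c y.
exists V; split.
  apply: smooth_mx => // i j; under eq_fun do rewrite mxE.
  apply: smoothM => //; last exact: smooth_coord.
  by apply: smoothV => //; [move=> x /q0; rewrite -sqrtr_gt0 => /gt_eqF ->|exact: smooth_sqrt].
move=> y Oy; have [ay ya Jfull] := dat y Oy.
have VJ : V y *m 'J F y = 0 by rewrite /V -scalemxAl cross_mul scaler0.
have VV : (V y *m metric a y *m (V y)^T) 0 0 = 1.
  rewrite /V linearZ/= -!scalemxAl -scalemxAr mxE mxE -/(q y) mulrA -invfM -expr2.
  by rewrite sqr_sqrtr ?mulVf// ?gt_eqF// ?ltW//; exact: q0.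
split=> //.
have V0 : V y != 0.
  by apply: contra_eq_neq VV => ->; rewrite !mul0mx mxE eq_sym oner_eq0.
apply: submersion_metric => //.
- exact/metric_sym/Oa.
- by move=> u uJ; exact: (left_kernel_line Jfull).
move=> u u' hu hu'; have [_ iso] := subf _ _ _ ay (Ob y Oy).
have FE : F y = coord b (f (param a y)) by [].
have := iso u u'; rewrite /horizontal /inner /differential ya -/F FE; apply.
- exact: hu.
- exact: hu'.
Qed.

End VerticalVector.

(** * Killing fields of constant length *)

Section LineKilling.
Context {R : realType} {n : nat}.
Variables (O : set 'rV[R]_n) (oO : open O) (i0 i1 i2 : 'I_n).
Variables (g00 g01 g11 X0 X1 T : 'rV[R]_n -> R).
Hypotheses (sg00 : smooth O g00) (sg01 : smooth O g01) (sg11 : smooth O g11).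
Hypotheses (sX0 : smooth O X0) (sX1 : smooth O X1) (sT : smooth O T).
Hypotheses (dg00 : forall y, O y -> partial i2 g00 y = 0)
  (dg01 : forall y, O y -> partial i2 g01 y = 0)
  (dg11 : forall y, O y -> partial i2 g11 y = 0).
Hypothesis pos : forall y s t, O y ->
  g00 y * s * s + g01 y * s * t + g01 y * t * s + g11 y * t * t = 0 -> s = 0 /\ t = 0.
Hypothesis K22 : forall y, O y -> partial i2 T y = 0.
Hypothesis K20 : forall y, O y ->
  partial i2 X0 y * g00 y + partial i2 X1 y * g01 y + partial i0 T y = 0.
Hypothesis K21 : forall y, O y ->
  partial i2 X0 y * g01 y + partial i2 X1 y * g11 y + partial i1 T y = 0.
Hypothesis unitX : forall y, O y ->
  g00 y * X0 y * X0 y + g01 y * X0 y * X1 y + g01 y * X1 y * X0 y + g11 y * X1 y * X1 y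
  + T y * T y = 1.

Let sd (f : 'rV[R]_n -> R) y : smooth O f -> O y -> differentiable f y.
Proof. exact: smooth_differentiable. Qed.

Let d3 (g f h : 'rV[R]_n -> R) y : smooth O g -> smooth O f -> smooth O h -> O y ->
  partial i2 g y = 0 ->
  partial i2 (fun y => g y * f y * h y) y =
  g y * (partial i2 f y * h y + f y * partial i2 h y).
Proof.
move=> sg sf sh Oy gy; have sgf := smoothM oO sg sf.
rewrite (partialM _ (sd sgf Oy) (sd sh Oy)) (partialM _ (sd sg Oy) (sd sf Oy)) gy.
by rewrite mul0r add0r mulrDr !mulrA.
Qed.

Let s3 (g f h : 'rV[R]_n -> R) : smooth O g -> smooth O f -> smooth O h ->
  smooth O (fun y => g y * f y * h y).
Proof. by move=> sg sf sh; do 2 (apply: smoothM => //). Qed.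

Let form (f f' h h' : 'rV[R]_n -> R) y :=
  g00 y * f y * h y + g01 y * f y * h' y + g01 y * f' y * h y + g11 y * f' y * h' y.

Let dform f f' h h' y : smooth O f -> smooth O f' -> smooth O h -> smooth O h' -> O y ->
  partial i2 (form f f' h h') y =
  form (partial i2 f) (partial i2 f') h h' y + form f f' (partial i2 h) (partial i2 h') y.
Proof.
move=> sf sf' sh sh' Oy; rewrite /form.
have s1 := s3 sg00 sf sh; have s2 := s3 sg01 sf sh'.
have s4 := s3 sg01 sf' sh; have s5 := s3 sg11 sf' sh'.
have s12 := smoothD oO s1 s2; have s124 := smoothD oO s12 s4.
rewrite (partialD _ (sd s124 Oy) (sd s5 Oy)) (partialD _ (sd s12 Oy) (sd s4 Oy)).
rewrite (partialD _ (sd s1 Oy) (sd s2 Oy)).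
rewrite (d3 sg00 sf sh Oy (dg00 Oy)) (d3 sg01 sf sh' Oy (dg01 Oy)).
rewrite (d3 sg01 sf' sh Oy (dg01 Oy)) (d3 sg11 sf' sh' Oy (dg11 Oy)).
move: (partial _ f y) (partial _ f' y) (partial _ h y) (partial _ h' y) => *; ring.
Qed.

Let sform f f' h h' : smooth O f -> smooth O f' -> smooth O h -> smooth O h' ->
  smooth O (form f f' h h').
Proof. by move=> ? ? ? ?; rewrite /form; do 3 (apply: smoothD => //; last exact: s3); exact: s3. Qed.

Let Y0 := partial i2 X0.
Let Y1 := partial i2 X1.
Let sY0 : smooth O Y0. Proof. exact: smooth_partial. Qed.
Let sY1 : smooth O Y1. Proof. exact: smooth_partial. Qed.

Let form_sym f f' h h' y : form f f' h h' y = form h h' f f' y.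
Proof. by rewrite /form; ring. Qed.

(** The derivative of the unit length condition along the line, where [T] and the metric do not
    vary. *)
Let XY0 y : O y -> form X0 X1 Y0 Y1 y = 0.
Proof.
move=> Oy; have sX := sform sX0 sX1 sX0 sX1; have sTT := smoothM oO sT sT.
have := partial_cst 1 i2 y.
rewrite -(open_eq_partial i2 oO Oy (f := fun y => form X0 X1 X0 X1 y + T y * T y))//.
rewrite (partialD _ (sd sX Oy) (sd sTT Oy)) (partialM _ (sd sT Oy) (sd sT Oy)) K22//.
rewrite dform// mul0r mulr0 !addr0 form_sym -mulr2n => /eqP.
by rewrite mulrn_eq0 => /eqP.
Qed.

(* Second derivative along the line: [d_2 d_2 X] is orthogonal to everything, as
   [d_2 d_j T = d_j d_2 T = 0]. *)
Let lin_zero (h0 h1 : 'rV[R]_n -> R) j y : smooth O h0 -> smooth O h1 -> O y ->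
  (forall y, O y -> partial i2 h0 y = 0) -> (forall y, O y -> partial i2 h1 y = 0) ->
  (forall y, O y -> Y0 y * h0 y + Y1 y * h1 y + partial j T y = 0) ->
  partial i2 Y0 y * h0 y + partial i2 Y1 y * h1 y = 0.
Proof.
move=> sh0 sh1 Oy dh0 dh1 K.
have s0 := smoothM oO sY0 sh0; have s1 := smoothM oO sY1 sh1.
have s01 := smoothD oO s0 s1; have sjT := smooth_partial j sT.
have := partial_cst 0 i2 y.
rewrite -(open_eq_partial i2 oO Oy K).
rewrite (partialD _ (sd s01 Oy) (sd sjT Oy)) (partialD _ (sd s0 Oy) (sd s1 Oy)).
rewrite (partialM _ (sd sY0 Oy) (sd sh0 Oy)) (partialM _ (sd sY1 Oy) (sd sh1 Oy)).
rewrite dh0// dh1// !mulr0 !addr0 (partialC i2 j oO sT Oy).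
by rewrite (open_eq_partial j oO Oy K22) partial_cst addr0.
Qed.

(** A further derivative of [XY0] along the line gives [g (Y, Y) + g (X, d_2 Y) = 0]; [lin_zero]
    removes the second term. *)
Let Y_zero y : O y -> Y0 y = 0 /\ Y1 y = 0.
Proof.
move=> Oy; apply: (pos Oy); rewrite -/(form Y0 Y1 Y0 Y1 y).
have := partial_cst 0 i2 y; rewrite -(open_eq_partial i2 oO Oy XY0) dform//.
suff -> : form X0 X1 (partial i2 Y0) (partial i2 Y1) y = 0 by rewrite addr0.
have E0 := lin_zero sg00 sg01 Oy dg00 dg01 K20.
have E1 := lin_zero sg01 sg11 Oy dg01 dg11 K21.
rewrite /form; transitivity (X0 y * (partial i2 Y0 y * g00 y + partial i2 Y1 y * g01 y)
  + X1 y * (partial i2 Y0 y * g01 y + partial i2 Y1 y * g11 y)).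
  by move: (partial i2 Y0 y) (partial i2 Y1 y) => *; ring.
by rewrite E0 E1 !mulr0 addr0.
Qed.

Lemma line_killing_parallel y : O y ->
  [/\ partial i2 X0 y = 0, partial i2 X1 y = 0, partial i0 T y = 0 & partial i1 T y = 0].
Proof.
move=> Oy; have [y0 y1] := Y_zero Oy; rewrite /Y0 in y0; rewrite /Y1 in y1; split=> //.
  by have := K20 Oy; rewrite y0 y1 !mul0r !add0r.
by have := K21 Oy; rewrite y0 y1 !mul0r !add0r.
Qed.

End LineKilling.

(* The logarithmic derivative of the area density is the divergence: [L_X g = 0]
   contracted with the cofactor matrix of [g]. *)
Lemma killing_area (R : comPzRingType) (g00 g01 g11 a00 a01 a10 a11 x0 x1 : R)
    (d : 'I_2 -> 'I_2 -> 'I_2 -> R) :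
  x0 * d 0 0 0 + a00 * g00 + a00 * g00 + (x1 * d 1 0 0 + a01 * g01 + a01 * g01) = 0 ->
  x0 * d 0 1 1 + a10 * g01 + a10 * g01 + (x1 * d 1 1 1 + a11 * g11 + a11 * g11) = 0 ->
  x0 * d 0 0 1 + a00 * g01 + a10 * g00 + (x1 * d 1 0 1 + a01 * g11 + a11 * g01) = 0 ->
  (d 0 0 0 * g11 + g00 * d 0 1 1 - 2 * (g01 * d 0 0 1)) * x0
  + (d 1 0 0 * g11 + g00 * d 1 1 1 - 2 * (g01 * d 1 0 1)) * x1
  + 2 * (g00 * g11 - g01 * g01) * (a00 + a11) = 0.
Proof.
move=> E0 E1 E2.
transitivity (
  g11 * (x0 * d 0 0 0 + a00 * g00 + a00 * g00 + (x1 * d 1 0 0 + a01 * g01 + a01 * g01))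
  + g00 * (x0 * d 0 1 1 + a10 * g01 + a10 * g01 + (x1 * d 1 1 1 + a11 * g11 + a11 * g11))
  - 2 * g01 * (x0 * d 0 0 1 + a00 * g01 + a10 * g00
               + (x1 * d 1 0 1 + a01 * g11 + a11 * g01))).
  by ring.
by rewrite E0 E1 E2 !mulr0 addr0 subr0.
Qed.

(** [a] is the dual form of the unit vector [x / s], and [b] is the contraction of the area form,
    with density [r], by this vector, that is, [a] turned by a right angle. In dimension two such a
    pair is an orthonormal coframe. *)
Lemma flat_frame (R : fieldType) (g00 g01 g11 x0 x1 s r : R) : s != 0 ->
  r * r = g00 * g11 - g01 * g01 ->
  x0 * g00 * x0 + x1 * g01 * x0 + x0 * g01 * x1 + x1 * g11 * x1 = s ^+ 2 ->
  let a0 := (x0 * g00 + x1 * g01) / s in let a1 := (x0 * g01 + x1 * g11) / s in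
  let b0 := - (r * x1) / s in let b1 := r * x0 / s in
  [/\ g00 = a0 * a0 + b0 * b0, g01 = a0 * a1 + b0 * b1, g11 = a1 * a1 + b1 * b1,
      x0 * a0 + x1 * a1 = s & x0 * b0 + x1 * b1 = 0].
Proof.
move=> s0 rr xx a0 a1 b0 b1.
(* Denominators are traded for [s ^ 2], the squared length of [x]; what remains is polynomial. *)
have conv t u : t * s ^+ 2 = u -> t = u / s ^+ 2.
  by move=> <-; rewrite mulfK// expf_neq0.
have r2 u v : (r * u) * (r * v) = (g00 * g11 - g01 * g01) * (u * v).
  by rewrite -rr; ring.
split.
- rewrite [LHS](conv _ ((x0 * g00 + x1 * g01) ^+ 2 + (r * x1) * (r * x1))).
    by rewrite /a0 /b0; field.
  by rewrite -xx r2; ring.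
- rewrite [LHS](conv _ ((x0 * g00 + x1 * g01) * (x0 * g01 + x1 * g11) - (r * x1) * (r * x0))).
    by rewrite /a0 /b0 /a1 /b1; field.
  by rewrite -xx r2; ring.
- rewrite [LHS](conv _ ((x0 * g01 + x1 * g11) ^+ 2 + (r * x0) * (r * x0))).
    by rewrite /a1 /b1; field.
  by rewrite -xx r2; ring.
- transitivity (s ^+ 2 / s); last by field.
  by rewrite -xx /a0 /a1; field.
- by rewrite /b0 /b1; field.
Qed.

(** [A] and [B] stand for the partials of [r * r], so that [(2 * r)^-1 * A] is a partial of [r]:
    this passes from the squared area density to the density. *)
Lemma density_divergence (R : realFieldType) (r A B a b x0 x1 : R) : 0 < r ->
  A * x0 + B * x1 + 2 * (r * r) * (a + b) = 0 ->
  (2 * r)^-1 * A * x0 + r * a + ((2 * r)^-1 * B * x1 + r * b) = 0.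
Proof.
move=> r0 E; transitivity ((2 * r)^-1 * (A * x0 + B * x1 + 2 * (r * r) * (a + b))).
  by field; rewrite gt_eqF.
by rewrite E mulr0.
Qed.

(** * Flat coordinates adapted to a Killing field *)

Section FlatChart.
Context {R : realType}.
Variables (O : set 'rV[R]_2) (oO : open O).
Variables (g : 'rV[R]_2 -> 'M[R]_2) (X : 'rV[R]_2 -> 'rV[R]_2) (s : R).
Hypotheses (sg : smooth O g) (sX : smooth O X) (s0 : 0 < s).
Hypothesis gsym : forall y, O y -> (g y)^T = g y.
Hypothesis gpos : forall y (v : 'rV[R]_2), O y -> v != 0 -> 0 < (v *m g y *m v^T) 0 0.
Hypothesis gX : forall y, O y -> (X y *m g y *m (X y)^T) 0 0 = s ^+ 2.
Hypothesis killX : forall y i j, O y ->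
  \sum_k (X y 0 k * partial k (fun y => g y i j : R) y
    + partial i (fun y => X y 0 k : R) y * g y k j
    + partial j (fun y => X y 0 k : R) y * g y k i) = 0.
Hypothesis closedX : forall y, O y ->
  partial 0 (fun y => (X y *m g y) 0 1 : R) y = partial 1 (fun y => (X y *m g y) 0 0 : R) y.

Let sgij i j : smooth O (fun y => g y i j : R). Proof. exact: smooth_coord. Qed.
Let sXi i : smooth O (fun y => X y 0 i : R). Proof. exact: smooth_coord. Qed.
Let sd (f : 'rV[R]_2 -> R) y : smooth O f -> O y -> differentiable f y.
Proof. exact: smooth_differentiable. Qed.

Let g10 y : O y -> g y 1 0 = g y 0 1.
Proof. by move=> Oy; rewrite -[in LHS](gsym Oy) mxE. Qed.

Let D y := g y 0 0 * g y 1 1 - g y 0 1 * g y 0 1.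

Lemma quadratic_formE (A : 'M[R]_2) (v : 'rV[R]_2) : (v *m A *m v^T) 0 0 =
  v 0 0 * A 0 0 * v 0 0 + v 0 1 * A 1 0 * v 0 0 + v 0 0 * A 0 1 * v 0 1
  + v 0 1 * A 1 1 * v 0 1.
Proof.
rewrite mxE big_ord2 ![_^T _ _]mxE ![(v *m A) _ _]mxE !big_ord2.
by rewrite !mulrDl addrA.
Qed.

Let D_gt0 y : O y -> 0 < D y.
Proof.
move=> Oy; have e0 : delta_mx 0 0 != 0 :> 'rV[R]_2.
  by apply/eqP => /rowP/(_ 0); rewrite !mxE/= => /eqP; rewrite oner_eq0.
have g0 : 0 < g y 0 0.
  have := gpos Oy e0; rewrite quadratic_formE !mxE/=.
  by rewrite !(mul0r, mulr0, mul1r, mulr1, addr0).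
(* The vector [(- g01, g00)] has squared length [g00 * D]. *)
pose v : 'rV[R]_2 := \row_j (if j == 0 then - g y 0 1 else g y 0 0).
have v0 : v != 0.
  by apply/eqP => /rowP/(_ 1); rewrite !mxE/= => /eqP; rewrite gt_eqF.
have := gpos Oy v0; rewrite quadratic_formE !mxE/= g10//.
set e := (X in 0 < X); have -> : e = g y 0 0 * D y by rewrite /e /D; ring.
by rewrite pmulr_rgt0.
Qed.

Let sD : smooth O D.
Proof. by apply: smoothB => //; apply: smoothM. Qed.

Let rD y := Num.sqrt (D y).
Let srD : smooth O rD. Proof. exact: smooth_sqrt. Qed.

Let dD k y : O y -> partial k D y =
  partial k (fun y => g y 0 0 : R) y * g y 1 1
  + g y 0 0 * partial k (fun y => g y 1 1 : R) y
  - 2 * (g y 0 1 * partial k (fun y => g y 0 1 : R) y).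
Proof.
move=> Oy; have s1 := smoothM oO (sgij 0 0) (sgij 1 1).
have s2 := smoothM oO (sgij 0 1) (sgij 0 1).
rewrite /D (partialB _ (sd s1 Oy) (sd s2 Oy)).
rewrite (partialM _ (sd (sgij 0 0) Oy) (sd (sgij 1 1) Oy)).
rewrite (partialM _ (sd (sgij 0 1) Oy) (sd (sgij 0 1) Oy)).
move: (partial _ _ y) (partial _ _ y) (partial _ _ y) => *; ring.
Qed.

(** A Killing field has zero divergence, and the density times the field has zero coordinate
    divergence: exactly the closedness of the rotated form [(b0, b1)]. *)
Let div_free y : O y ->
  partial 0 (fun y => rD y * X y 0 0) y + partial 1 (fun y => rD y * X y 0 1) y = 0.
Proof.
move=> Oy; rewrite (partialM _ (sd srD Oy) (sd (sXi 0) Oy)).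
rewrite (partialM _ (sd srD Oy) (sd (sXi 1) Oy)).
rewrite /rD !(partial_sqrt _ (D_gt0 Oy) (sd sD Oy)) !dD// -/(rD y).
have r0 : 0 < rD y by rewrite sqrtr_gt0; exact: D_gt0.
have rr : D y = rD y * rD y by rewrite -expr2 sqr_sqrtr// ltW// D_gt0.
pose d k i j := partial k (fun y => g y i j : R) y.
have K00 := killX 0 0 Oy; have K11 := killX 1 1 Oy; have K01 := killX 0 1 Oy.
rewrite !big_ord2 !(g10 Oy) in K00 K11 K01.
rewrite -/(d 0 0 0) -/(d 1 0 0) in K00; rewrite -/(d 0 1 1) -/(d 1 1 1) in K11.
rewrite -/(d 0 0 1) -/(d 1 0 1) in K01.
have := killing_area K00 K11 K01; rewrite -/(D y) rr /d.
apply: density_divergence; exact: r0.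
Qed.

(** The two coordinates are Poincare primitives of the dual form of [X / s] and of its rotate,
    closed by [closedX] and [div_free]. They form the columns of the Jacobian, so [flat_frame]
    yields both equations. *)
Lemma flat_chart q : O q -> exists (r : R) (chi : 'rV[R]_2 -> 'rV[R]_2),
  [/\ 0 < r, ball q r `<=` O, smooth (ball q r) chi & forall y, ball q r y ->
    g y = 'J chi y *m ('J chi y)^T /\ X y *m 'J chi y = s *: delta_mx 0 0].
Proof.
move=> Oq; have sN0 : s != 0 by rewrite gt_eqF.
pose al i y := (X y *m g y) 0 i / s.
pose b0 y := - (rD y * X y 0 1) / s; pose b1 y := rD y * X y 0 0 / s.
have sXg i : smooth O (fun y => (X y *m g y) 0 i : R).
  by apply: smooth_coord => //; exact: smooth_mulmx.
have sal i : smooth O (al i) by apply: smoothM => //; exact: smooth_cst.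
have srX i : smooth O (fun y => rD y * X y 0 i) by exact: smoothM.
have sb0 : smooth O b0.
  by apply: smoothM; [|exact: smoothN|exact: smooth_cst].
have sb1 : smooth O b1 by apply: smoothM => //; exact: smooth_cst.
have ds y : differentiable (fun=> s^-1 : R) (y : 'rV[R]_2) by exact: differentiable_cst.
have [|r1 [u [r10 r1O su uP]]] := poincare oO (sal 0) (sal 1) Oq.
  move=> y Oy; rewrite /al (partialM _ (sd (sXg 1) Oy) (ds y)).
  by rewrite (partialM _ (sd (sXg 0) Oy) (ds y)) closedX// !partial_cst !mulr0.
have [|r2 [v [r20 r2O sv vP]]] := poincare oO sb0 sb1 Oq.
  move=> y Oy; rewrite /b1 /b0 (partialM _ (sd (srX 0) Oy) (ds y)).
  rewrite (partialM _ (sd (smoothN oO (srX 1)) Oy) (ds y)) !partial_cst !mulr0 !addr0.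
  rewrite (partialN _ (sd (srX 1) Oy)); congr (_ * _).
  by apply/eqP; rewrite -addr_eq0; apply/eqP; exact: div_free.
pose r := Num.min r1 r2.
have rr1 : ball q r `<=` ball q r1 by apply: le_ball; rewrite ge_min lexx.
have rr2 : ball q r `<=` ball q r2 by apply: le_ball; rewrite ge_min lexx orbT.
pose chi y : 'rV[R]_2 := \row_j (if j == 0 then u y else v y).
have schi : smooth (ball q r) chi.
  apply: smooth_mx; first exact: ball_open.
  move=> i j; under eq_fun do rewrite mxE.
  by case: (j == 0); [exact: smoothS su|exact: smoothS sv].
exists r, chi; split=> //.
- by rewrite lt_min r10.
- by move=> y /rr1/r1O.
move=> y ry; have Oy : O y by exact/r1O/rr1.
have dchi := smooth_differentiable schi ry.
have [u0 u1] := uP y (rr1 y ry); have [v0 v1] := vP y (rr2 y ry).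
have J i j : 'J chi y i j = if j == 0 then (if i == 0 then al 0 y else al 1 y)
                             else (if i == 0 then b0 y else b1 y).
  rewrite (jacobianE _ _ dchi).
  under [X in partial i X]eq_fun do rewrite mxE.
  by have [->|->] := ord2P j; have [->|->] := ord2P i.
have rr : rD y * rD y = g y 0 0 * g y 1 1 - g y 0 1 * g y 0 1.
  by rewrite -expr2 sqr_sqrtr// ltW// D_gt0.
have XX : X y 0 0 * g y 0 0 * X y 0 0 + X y 0 1 * g y 0 1 * X y 0 0
    + X y 0 0 * g y 0 1 * X y 0 1 + X y 0 1 * g y 1 1 * X y 0 1 = s ^+ 2.
  by rewrite -(gX Oy) quadratic_formE g10.
have [] := flat_frame sN0 rr XX.
have al0 : al 0 y = (X y 0 0 * g y 0 0 + X y 0 1 * g y 0 1) / s.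
  by rewrite /al mxE big_ord2 g10.
have al1 : al 1 y = (X y 0 0 * g y 0 1 + X y 0 1 * g y 1 1) / s.
  by rewrite /al mxE big_ord2.
rewrite -al0 -al1 -/(b0 y) -/(b1 y) => E00 E01 E11 Xa Xb; split.
  apply/matrixP => i j; rewrite [RHS]mxE big_ord2 ![_^T _ _]mxE !J/=.
  have [->|->] := ord2P i; have [->|->] := ord2P j => //=.
  by rewrite g10// E01 mulrC [b1 y * _]mulrC.
apply/rowP => j; rewrite [LHS]mxE big_ord2 !J/= [RHS]mxE [_ 0 j]mxE.
by have [->|->] := ord2P j; rewrite /= ?mulr1 ?mulr0.
Qed.

End FlatChart.

Lemma open_smooth_preimage (R : realType) n m (P : set 'rV[R]_n) (Q : set 'rV[R]_m)
    (f : 'rV[R]_n -> 'rV[R]_m) : open P -> open Q -> smooth P f -> open (P `&` f @^-1` Q).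
Proof.
move=> oP oQ sf; rewrite openE => x [Px Qx]; apply: filterI; first exact: open_nbhs_nbhs.
by apply: (smooth_continuous sf Px); exact: open_nbhs_nbhs.
Qed.

Lemma jacobian_cst (R : realType) n m (c : 'rV[R]_m) (x : 'rV[R]_n) :
  'J (fun _ : 'rV[R]_n => c) x = 0.
Proof.
have dc : differentiable (fun _ : 'rV[R]_n => c) x by exact: differentiable_cst.
apply/row_matrixP => i; apply: etrans (row_jacobian i dc) _.
by rewrite row0; exact: derive_cst.
Qed.

(** * Straightening the vertical field *)

Section LineLift.
Context {R : realType} {n : nat}.
Local Notation L := (@lproj R n).
Local Notation Q := (@rproj R n).

Lemma lproj_lproj : L^T *m L = 1%:M.
Proof. by rewrite /lproj tr_col_mx mul_row_col trmx1 trmx0 mulmx1 mul0mx addr0. Qed.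

Lemma rproj_rproj : Q^T *m Q = 1%:M.
Proof. by rewrite /rproj tr_col_mx mul_row_col trmx1 trmx0 mulmx1 mul0mx add0r. Qed.

Lemma lproj_rproj : L^T *m Q = 0.
Proof. by rewrite /lproj /rproj tr_col_mx mul_row_col trmx1 trmx0 mulmx0 mul0mx addr0. Qed.

Lemma rproj_lproj : Q^T *m L = 0.
Proof. by rewrite -[LHS]trmxK trmx_mul trmxK lproj_rproj trmx0. Qed.

Lemma row_mx_proj m (A : 'M[R]_(m, n)) (B : 'M[R]_(m, 1)) :
  row_mx A B = A *m L^T + B *m Q^T.
Proof.
rewrite /lproj /rproj !tr_col_mx !mul_mx_row !trmx1 !trmx0 !mulmx1 !mulmx0.
by rewrite add_row_mx addr0 add0r.
Qed.

Definition line_lift (f : 'rV[R]_n -> 'rV[R]_n) (y : 'rV[R]_(n + 1)) : 'rV[R]_(n + 1) :=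
  row_mx (f (lsubmx y)) (rsubmx y).

(** Written as a difference so that [smoothB] and [jacobianB] apply. *)
Lemma liftE f y : line_lift f y = f (lsubmx y) *m L^T - y *m - (Q *m Q^T).
Proof. by rewrite /line_lift row_mx_proj mulmxN opprK mulmxA mulmx_rproj. Qed.

Lemma smooth_lift (O : set 'rV[R]_n) f : open O -> smooth O f ->
  smooth (lsubmx @^-1` O) (line_lift f).
Proof.
move=> oO sf; have oO' := open_lsubmx oO.
apply: (eq_smooth (f := fun y => f (lsubmx y) *m L^T - y *m - (Q *m Q^T))) => //.
  by move=> y _; rewrite liftE.
apply: smoothB => //; apply: smooth_mulmx => //.
- by move=> k; exact: (diff_order_lsubmx oO (sf k)).
- exact: smooth_cst.
- exact: smooth_id.
- exact: smooth_cst.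
Qed.

Lemma jacobian_lift f y : differentiable f (lsubmx y) ->
  'J (line_lift f) y = L *m 'J f (lsubmx y) *m L^T + Q *m Q^T.
Proof.
move=> df; have -> : line_lift f = (fun y => ((mulmxr L^T) \o (f \o lsubmx)) y - y *m - (Q *m Q^T)).
  by apply/funext => z; rewrite liftE.
have dl : differentiable (lsubmx : 'rV[R]_(n + 1) -> 'rV[R]_n) y.
  exact: differentiable_lsubmx.
have dfl : differentiable (f \o lsubmx) y by exact: differentiable_comp.
have dm m p (B : 'M[R]_(m, p)) z : differentiable (mulmxr B : 'rV[R]_m -> 'rV[R]_p) z.
  by apply: linear_differentiable; exact: mulmxr_continuous.
apply: etrans (jacobianB (differentiable_comp dfl (dm _ _ _ _)) (dm _ _ _ _)) _.
transitivity (L *m 'J f (lsubmx y) *m L^T - - (Q *m Q^T)); last by rewrite opprK.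
congr (_ - _); last exact: jacobian_mulmxr.
apply: etrans (jacobian_comp dfl (dm _ _ _ _)) _.
congr (_ *m _); last exact: jacobian_mulmxr.
apply: etrans (jacobian_comp dl df) _; congr (_ *m _); exact: jacobian_lsubmx.
Qed.

Lemma lift_comp f g y : line_lift f (line_lift g y) = line_lift (f \o g) y.
Proof. by rewrite /line_lift row_mxKl row_mxKr. Qed.

End LineLift.

Section Straighten.
Context {R : realType}.
Variables (U : set 'rV[R]_2) (chi kap : 'rV[R]_2 -> 'rV[R]_2) (xi0 : 'rV[R]_(2 + 1)).
Hypotheses (oU : open U) (oC : open (chi @` U)).
Hypotheses (schi : smooth U chi) (skap : smooth (chi @` U) kap).
Hypothesis kapK : forall m, U m -> kap (chi m) = m.

Let chiK t : (chi @` U) t -> U (kap t) /\ chi (kap t) = t.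
Proof. by move=> [m Um <-]; rewrite kapK. Qed.

(** The affine map [xi0 + (xi - xi0) A]; fixing [xi0] ensures that the base point lies in the domain
    of the rotated map. *)
Definition rot (A : 'M[R]_(2 + 1)) (xi : 'rV[R]_(2 + 1)) := xi *m A - (xi0 *m A - xi0).

Definition rot_dom A : set 'rV[R]_(2 + 1) :=
  (lsubmx @^-1` U) `&` (rot A \o line_lift chi) @^-1` (lsubmx @^-1` (chi @` U)).

Definition rot_map A : 'rV[R]_(2 + 1) -> 'rV[R]_(2 + 1) := line_lift kap \o rot A \o line_lift chi.

Lemma rot_rot A B xi : A *m B = 1%:M -> rot B (rot A xi) = xi.
Proof.
move=> AB; rewrite /rot !mulmxBl -!mulmxA AB !mulmx1.
by rewrite -addrA -opprD addrA subrK subrr subr0.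
Qed.

Lemma rot_center A : rot A xi0 = xi0.
Proof. by rewrite /rot subKr. Qed.

Lemma smooth_rot A : smooth setT (rot A).
Proof.
apply: smoothB; [exact: openT| |exact/smooth_cst/openT].
by apply: smooth_mulmx; [exact: openT|exact/smooth_id/openT|exact/smooth_cst/openT].
Qed.

Lemma jacobian_rot A xi : 'J (rot A) xi = A.
Proof.
have dm z : differentiable (mulmxr A : 'rV[R]_(2 + 1) -> 'rV[R]_(2 + 1)) z.
  by apply: linear_differentiable; exact: mulmxr_continuous.
apply: etrans (jacobianB (dm _) (differentiable_cst _ _)) _.
rewrite -[RHS]subr0; congr (_ - _); last exact: jacobian_cst.
exact: jacobian_mulmxr.
Qed.

Lemma lift_rot_map A y : rot_dom A y -> line_lift chi (rot_map A y) = rot A (line_lift chi y).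
Proof.
move=> [_ /= Cy]; rewrite /rot_map /= lift_comp /line_lift /=.
by rewrite (chiK Cy).2 hsubmxK.
Qed.

Lemma rot_map_dom A B y : A *m B = 1%:M -> rot_dom A y ->
  rot_dom B (rot_map A y) /\ rot_map B (rot_map A y) = y.
Proof.
move=> AB /[dup] Ay [/= Uy Cy]; have E := lift_rot_map Ay.
split.
  split; first by rewrite /rot_map /= /line_lift row_mxKl; exact: (chiK Cy).1.
  by rewrite /= E rot_rot// /line_lift row_mxKl; exists (lsubmx y).
by rewrite {1}/rot_map /= E rot_rot// lift_comp /line_lift /= kapK// hsubmxK.
Qed.

Lemma smooth_lift_chi : smooth (lsubmx @^-1` U) (line_lift chi).
Proof. exact: smooth_lift. Qed.

Lemma smooth_rot_lift A : smooth (lsubmx @^-1` U) (rot A \o line_lift chi).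
Proof.
apply: (smooth_comp (O' := setT)) => //; [exact: open_lsubmx|exact: openT| |].
- exact: smooth_lift_chi.
- exact: smooth_rot.
Qed.

Lemma open_rot_dom A : open (rot_dom A).
Proof.
apply: open_smooth_preimage; [exact: open_lsubmx|exact: open_lsubmx|].
exact: smooth_rot_lift.
Qed.

Lemma smooth_rot_map A : smooth (rot_dom A) (rot_map A).
Proof.
apply: (smooth_comp (O' := lsubmx @^-1` (chi @` U)) (f := rot A \o line_lift chi)
  (g := line_lift kap)).
- exact: open_rot_dom.
- exact: open_lsubmx.
- by move=> y [_ Cy]; exact: Cy.
- by apply: smoothS (smooth_rot_lift A) => y [].
- exact: smooth_lift.
Qed.

(** Differentiating [lift_rot_map] yields a relation between Jacobians in which that of [kap] does
    not occur. *)
Lemma jacobian_rot_map A y : rot_dom A y ->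
  'J (rot_map A) y *m 'J (line_lift chi) (rot_map A y) = 'J (line_lift chi) y *m A.
Proof.
move=> Ay; have [Uy Cy] := Ay.
have Uphi : (lsubmx @^-1` U) (rot_map A y).
  by rewrite /rot_map /= /line_lift row_mxKl; exact: (chiK Cy).1.
have d1 := smooth_differentiable (smooth_rot_map A) Ay.
have d2 := smooth_differentiable smooth_lift_chi Uphi.
have d3 := smooth_differentiable smooth_lift_chi Uy.
have d4 := smooth_differentiable (smooth_rot A) (I : setT (line_lift chi y)).
apply: etrans (esym (jacobian_comp d1 d2)) _.
have nE : {near y, line_lift chi \o rot_map A =1 rot A \o line_lift chi}.
  have nA : nbhs y (rot_dom A) by apply: open_nbhs_nbhs; split=> //; exact: open_rot_dom.
  by apply: filterS nA => z; exact: lift_rot_map.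
apply: etrans (near_eq_jacobian (differentiable_comp d1 d2) nE) _.
apply: etrans (jacobian_comp d3 d4) _; congr (_ *m _); exact: jacobian_rot.
Qed.

Lemma jacobian_lift_chi y : U (lsubmx y) -> 'J (line_lift chi) y =
  @lproj R 2 *m 'J chi (lsubmx y) *m (@lproj R 2)^T + @rproj R 2 *m (@rproj R 2)^T.
Proof. by move=> Uy; apply: jacobian_lift; exact: smooth_differentiable schi Uy. Qed.

End Straighten.

Section LinePartial.
Context {R : realType}.
Implicit Types (f : 'rV[R]_2 -> R) (y : 'rV[R]_(2 + 1)).

Lemma partial_lsubmx f y i : differentiable f (lsubmx y) ->
  partial i (fun z => f (lsubmx z)) y = \sum_j @lproj R 2 i j * partial j f (lsubmx y).
Proof.
move=> df; have dl : differentiable (lsubmx : 'rV[R]_(2 + 1) -> 'rV[R]_2) y.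
  exact: differentiable_lsubmx.
apply: etrans (partial_comp i dl df) _; apply: eq_bigr => j _.
by rewrite jacobian_lsubmx.
Qed.

Lemma partial_lsubmx_line f y : differentiable f (lsubmx y) ->
  partial sp2 (fun z => f (lsubmx z)) y = 0.
Proof.
move=> df; rewrite partial_lsubmx//; apply: big1 => j _.
by rewrite /lproj col_mxEd mxE mul0r.
Qed.

Lemma partial_lsubmx_plane f y k : differentiable f (lsubmx y) ->
  partial (lshift 1 k) (fun z => f (lsubmx z)) y = partial k f (lsubmx y).
Proof.
move=> df; rewrite partial_lsubmx// (bigD1 k)//= /lproj col_mxEu mxE eqxx mul1r.
rewrite big1 ?addr0// => j /negPf jk.
by rewrite col_mxEu mxE eq_sym jk mul0r.
Qed.

Lemma ball_lsubmx (x y : 'rV[R]_(2 + 1)) r : ball x r y -> ball (lsubmx x) r (lsubmx y).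
Proof. by move=> [r0 xy]; split=> // i j; rewrite !mxE; exact: xy. Qed.

(** Balls for the sup norm are products, so the slice through the centre is a ball of the same
    radius. *)
Lemma ball_row_mx (x : 'rV[R]_(2 + 1)) m r : ball (lsubmx x) r m ->
  ball x r (row_mx m (rsubmx x)).
Proof.
move=> [r0 xm]; split=> // i j; case: (split_ordP j) => k ->.
  by have := xm i k; rewrite row_mxEl mxE.
by rewrite row_mxEr mxE; exact: ballxx.
Qed.

Lemma derive0_constant n (f : 'rV[R]_n -> R) (c : 'rV[R]_n) r :
  (forall y : 'rV[R]_n, ball c r y -> differentiable f y) ->
  forall y y' : 'rV[R]_n, ball c r y -> ball c r y' ->
  (forall z, ball c r z -> 'D_(y' - y) f z = 0) -> f y' = f y.
Proof.
move=> df y y' cy cy' d0.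
have [|t /andP[t0 t1]] := mvt_line (f := f) (x := y) (v := y' - y) ltr01.
  by move=> t t01; apply: df; exact: ball_segment.
rewrite d0; last by apply: ball_segment; rewrite // !ltW.
by rewrite scale1r subrKC mulr0 => /eqP; rewrite subr_eq0 => /eqP.
Qed.

End LinePartial.

Section VerticalSplitting.
Context {R : realType} (M N : riemannian_manifold R 2).
Variables (pi : product_line M -> N) (a : chart M) (b : chart N).
Variables (x0 : 'rV[R]_(2 + 1)) (r : R).
Let E := product_line M.
Let a' : chart E := a.
Let O : set 'rV[R]_(2 + 1) := ball x0 r.
Let B : set 'rV[R]_2 := ball (lsubmx x0) r.
Let F := local_rep a' b pi.
Hypothesis r0 : 0 < r.
Hypotheses (subm : riemannian_submersion pi) (harm : harmonic pi).
Hypotheses (Oa : O `<=` chart_image a') (Ob : forall y, O y -> dom b (pi (param a' y))).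
Hypothesis sF : smooth O F.

Let oO : open O. Proof. exact: ball_open. Qed.
Let oB : open B. Proof. exact: ball_open. Qed.

Let Ba m : B m -> chart_image a m.
Proof.
by move=> /ball_row_mx/Oa; rewrite /a' line_chart_image /= row_mxKl.
Qed.

Let g i j (y : 'rV[R]_(2 + 1)) : R := metric a (lsubmx y) i j.

Let GE00 y i j : metric a' y (lshift 1 i) (lshift 1 j) = g i j y.
Proof. exact: block_mxEul. Qed.
Let GE01 y i : metric a' y (lshift 1 i) sp2 = 0.
Proof. by apply: etrans (block_mxEur _ _ _ _ _ _) _; rewrite mxE. Qed.
Let GE10 y i : metric a' y sp2 (lshift 1 i) = 0.
Proof. by apply: etrans (block_mxEdl _ _ _ _ _ _) _; rewrite mxE. Qed.
Let GE11 y : metric a' y sp2 sp2 = 1.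
Proof. by apply: etrans (block_mxEdr _ _ _ _ _ _) _; rewrite mxE eqxx. Qed.

(** The components of Killing's equation are read separately: those involving the line feed
    [line_killing_parallel], the others say that [X] is Killing on the surface. The fourth clause is
    all that [i_V dw = 0] says there; it becomes closedness once [X] is known not to vanish. *)
Lemma vertical_splitting : exists (X : 'rV[R]_2 -> 'rV[R]_2) (theta : R),
  [/\ smooth B X,
   forall m, B m -> (X m *m metric a m *m (X m)^T) 0 0 + theta ^+ 2 = 1,
   forall m i j, B m -> \sum_k (X m 0 k * partial k (fun y => metric a y i j : R) m
    + partial i (fun y => X y 0 k : R) m * metric a m k j
    + partial j (fun y => X y 0 k : R) m * metric a m k i) = 0,
   forall m k, B m -> X m 0 k * (partial 0 (fun y => (X y *m metric a y) 0 1 : R) m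
     - partial 1 (fun y => (X y *m metric a y) 0 0 : R) m) = 0 &
   forall y, O y -> let v := row_mx (X (lsubmx y)) theta%:M in
     v *m 'J F y = 0 /\ metric a' y = (v *m metric a' y)^T *m (v *m metric a' y)
       + 'J F y *m metric b (F y) *m ('J F y)^T].
Proof.
have [V [sV VP]] := unit_vertical_field subm oO Oa Ob sF.
have Fb y : O y -> chart_image b (F y) by move=> /Ob by_; exists (pi (param a' y)).
pose w y := V y *m metric a' y.
have sG : smooth O (metric a') by apply: smoothS Oa _; exact: smooth_metric.
have sw : smooth O w by exact: smooth_mulmx.
have VJ y : O y -> V y *m 'J F y = 0 by move=> /VP[].
have Vw y : O y -> \sum_k V y 0 k * w y 0 k = 1.
  move=> /VP[_ <- _]; rewrite mxE; apply: eq_bigr => k _.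
  by rewrite [_^T _ _]mxE mulrC.
have GE y : O y -> metric a' y = (w y)^T *m w y + 'J F y *m metric b (F y) *m ('J F y)^T.
  by move=> /VP[].
have curlV y l : O y -> \sum_k V y 0 k *
    (partial k (fun y => w y 0 l : R) y - partial l (fun y => w y 0 k : R) y) = 0.
  move=> Oy; apply: (tension_free_curl oO Oa Oy sF Fb sw GE) => //.
  - exact: VJ.
  - exact: Vw.
  - move=> c; have [ay ya] := chart_imageP (Oa Oy).
    by rewrite -[y in tension _ _ _ _ y]ya; apply: harm.2 => //; exact: Ob.
have kill y i j : O y -> \sum_k (V y 0 k * partial k (fun y => metric a' y i j : R) y
    + partial i (fun y => V y 0 k : R) y * metric a' y k j
    + partial j (fun y => V y 0 k : R) y * metric a' y k i) = 0.
  move=> Oy; apply: (killing_equation oO Oy sF Fb sw GE i j sV VJ Vw) => l.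
  exact: curlV.
have sVi i : smooth O (fun y => V y 0 i : R) by exact: smooth_coord.
have gl i j : smooth O (g i j).
  apply: (eq_smooth (f := fun y => metric a' y (lshift 1 i) (lshift 1 j) : R)) => //.
  exact: smooth_coord.
have dg y i j : O y -> differentiable (fun m => metric a m i j : R) (lsubmx y).
  by move=> Oy; apply: differentiable_metric; apply: Ba; exact: ball_lsubmx.
have dzg i j y : O y -> partial sp2 (g i j) y = 0.
  by move=> Oy; exact: (partial_lsubmx_line (f := fun m => metric a m i j) (dg y i j Oy)).
have p01 k i y : partial k (fun y => metric a' y (lshift 1 i) sp2 : R) y = 0.
  rewrite -[RHS](partial_cst 0 k y); congr (partial k _ y).
  by apply/funext => z; exact: GE01.
have p10 k i y : partial k (fun y => metric a' y sp2 (lshift 1 i) : R) y = 0.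
  rewrite -[RHS](partial_cst 0 k y); congr (partial k _ y).
  by apply/funext => z; exact: GE10.
have p11 k y : partial k (fun y => metric a' y sp2 sp2 : R) y = 0.
  rewrite -[RHS](partial_cst 1 k y); congr (partial k _ y).
  by apply/funext => z; exact: GE11.
have gsym i j y : O y -> g i j y = g j i y.
  by move=> Oy; apply: metric_symE; apply: Ba; exact: ball_lsubmx.
(* The line-line component of Killing's equation; the mixed components follow in [K2]. *)
have K22 y : O y -> partial sp2 (fun y => V y 0 sp2 : R) y = 0.
  move=> Oy; have := kill y sp2 sp2 Oy.
  rewrite big_ord21 !p11 !GE01 GE11 !mulr0 !add0r mulr1 -mulr2n => /eqP.
  by rewrite mulrn_eq0 => /eqP.
have K2 j y : O y -> partial sp2 (fun y => V y 0 sp0 : R) y * g 0 j y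
    + partial sp2 (fun y => V y 0 sp1 : R) y * g 1 j y
    + partial (lshift 1 j) (fun y => V y 0 sp2 : R) y = 0.
  move=> Oy; have := kill y sp2 (lshift 1 j) Oy.
  by rewrite big_ord21 !p10 !GE00 !GE01 GE10 GE11 !(mulr0, add0r, addr0, mulr1).
have unitV y : O y -> g 0 0 y * V y 0 sp0 * V y 0 sp0 + g 0 1 y * V y 0 sp0 * V y 0 sp1
    + g 0 1 y * V y 0 sp1 * V y 0 sp0 + g 1 1 y * V y 0 sp1 * V y 0 sp1
    + V y 0 sp2 * V y 0 sp2 = 1.
  move=> Oy; rewrite -[RHS](Vw y Oy) big_ord21 /w.
  have wE k : (V y *m metric a' y) 0 k = V y 0 sp0 * metric a' y sp0 k
      + V y 0 sp1 * metric a' y sp1 k + V y 0 sp2 * metric a' y sp2 k.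
    by rewrite mxE big_ord21.
  rewrite !wE !GE00 !GE01 !GE10 GE11 (gsym 1 0)//.
  by move: (V y 0 sp0) (V y 0 sp1) (V y 0 sp2) (g 0 0 y) (g 0 1 y) (g 1 1 y) => *; ring.
have pos y s t : O y -> g 0 0 y * s * s + g 0 1 y * s * t + g 0 1 y * t * s
    + g 1 1 y * t * t = 0 -> s = 0 /\ t = 0.
  move=> Oy q0; pose v : 'rV[R]_2 := \row_j (if j == 0 then s else t).
  have [v0|v0] := eqVneq v 0.
    by split; [have := congr1 (fun u : 'rV[R]_2 => u 0 0) v0
              |have := congr1 (fun u : 'rV[R]_2 => u 0 1) v0]; rewrite !mxE.
  have := metric_posdef (Ba (ball_lsubmx Oy)) v0.
  rewrite quadratic_formE [v 0 0]mxE [v 0 1]mxE /= -!/(g _ _ y) (gsym 1 0)//.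
  suff -> : s * g 0 0 y * s + t * g 0 1 y * s + s * g 0 1 y * t + t * g 1 1 y * t = 0.
    by rewrite ltxx.
  by rewrite -q0; move: (g 0 0 y) (g 0 1 y) (g 1 1 y) => *; ring.
have K20 y : O y -> partial sp2 (fun y => V y 0 sp0 : R) y * g 0 0 y
    + partial sp2 (fun y => V y 0 sp1 : R) y * g 0 1 y
    + partial sp0 (fun y => V y 0 sp2 : R) y = 0.
  by move=> Oy; rewrite (gsym 0 1)//; exact: K2.
have par y := @line_killing_parallel R _ O oO sp0 sp1 sp2 (g 0 0) (g 0 1) (g 1 1)
  (fun y => V y 0 sp0) (fun y => V y 0 sp1) (fun y => V y 0 sp2) (gl 0 0) (gl 0 1) (gl 1 1)
  (sVi sp0) (sVi sp1) (sVi sp2) (dzg 0 0) (dzg 0 1) (dzg 1 1) pos K22 K20 (K2 1) unitV y.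
have dV i y : O y -> differentiable (fun y => V y 0 i : R) y.
  by move=> Oy; apply: smooth_differentiable (sVi i) Oy.
pose theta : R := V x0 0 sp2.
have Ox0 : O x0 by exact: ballxx.
have thetaE y : O y -> V y 0 sp2 = theta.
  move=> Oy; apply: (derive0_constant (f := fun y => V y 0 sp2) (c := x0) (r := r)) => //.
    by move=> z; exact: dV.
  move=> z Oz; rewrite (derive_partial _ (dV sp2 z Oz)) big_ord21.
  by have [_ _ -> ->] := par z Oz; rewrite K22// !scaler0 !addr0.
(* [X] is read off on the slice at the height of [x0]; [XE] shows that any height would give the
   same. *)
pose iota (m : 'rV[R]_2) : 'rV[R]_(2 + 1) := row_mx m (rsubmx x0).
have Oiota m : B m -> O (iota m) by exact: ball_row_mx.
pose X m : 'rV[R]_2 := \row_k V (iota m) 0 (lshift 1 k).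
have XE y k : O y -> V y 0 (lshift 1 k) = X (lsubmx y) 0 k.
  move=> Oy; rewrite mxE; have Oy' := Oiota _ (ball_lsubmx Oy).
  apply: (derive0_constant (f := fun y => V y 0 (lshift 1 k)) (c := x0) (r := r)) => //.
    by move=> z; exact: dV.
  move=> z Oz; rewrite (derive_partial _ (dV _ z Oz)) big_split_ord /= big_ord1.
  have -> : partial (rshift 2 0) (fun y => V y 0 (lshift 1 k) : R) z = 0.
    by have [Z0 Z1 _ _] := par z Oz; have [->|->] := ord2P k.
  rewrite scaler0 addr0; apply: big1 => j _.
  by rewrite mxBE /iota row_mxEl [lsubmx y 0 j]mxE subrr scale0r.
have Vrow y : O y -> V y = row_mx (X (lsubmx y)) theta%:M.
  move=> Oy; apply/rowP => j; case: (split_ordP j) => k ->.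
    by rewrite XE// row_mxEl.
  by rewrite (ord1 k) row_mxEr mxE eqxx mulr1n; exact: thetaE.
have siota : smooth B iota.
  apply: (eq_smooth (f := fun m => m *m (@lproj R 2)^T + rsubmx x0 *m (@rproj R 2)^T)) => //.
    by move=> m _; rewrite /iota row_mx_proj.
  apply: smoothD => //; last exact: smooth_cst.
  by apply: smooth_mulmx => //; [exact: smooth_id|exact: smooth_cst].
have sX : smooth B X.
  apply: smooth_mx => // i k; under eq_fun do rewrite mxE.
  exact: (smooth_comp_real (g := fun y => V y 0 (lshift 1 k)) oB Oiota siota (sVi _)).
have dX k m : B m -> differentiable (fun m => X m 0 k : R) m.
  by move=> Bm; apply: smooth_differentiable Bm; exact: smooth_coord.
have pX j k y : O y -> partial (lshift 1 j) (fun y => V y 0 (lshift 1 k) : R) y =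
    partial j (fun m => X m 0 k : R) (lsubmx y).
  move=> Oy; apply: etrans (open_eq_partial _ oO Oy (fun z Oz => XE z k Oz)) _.
  by apply: (partial_lsubmx_plane (f := fun m => X m 0 k)); exact/dX/ball_lsubmx.
have lio m : lsubmx (iota m) = m by exact: row_mxKl.
pose Xg j (m : 'rV[R]_2) : R := (X m *m metric a m) 0 j.
have sXg j : smooth B (Xg j).
  apply: smooth_coord => //; apply: smooth_mulmx => //.
  exact: smoothS Ba (smooth_metric a).
have dXg j m : B m -> differentiable (Xg j) m.
  by move=> Bm; exact: smooth_differentiable (sXg j) Bm.
have wE j z : O z -> w z 0 (lshift 1 j) = Xg j (lsubmx z).
  move=> Oz; rewrite /w /Xg !mxE big_split_ord /= big_ord1 -/sp2 GE10 mulr0 addr0.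
  by apply: eq_bigr => k _; rewrite XE// GE00.
have w2E z : O z -> w z 0 sp2 = theta.
  by move=> Oz; rewrite /w mxE big_ord21 !GE01 GE11 !mulr0 !add0r mulr1; exact: thetaE.
have pw0 j l y : O y -> partial (lshift 1 j) (fun y => w y 0 (lshift 1 l) : R) y =
    partial j (Xg l) (lsubmx y).
  move=> Oy; apply: etrans (open_eq_partial _ oO Oy (fun z Oz => wE l z Oz)) _.
  by apply: (partial_lsubmx_plane (f := Xg l)); exact/dXg/ball_lsubmx.
have pwz l y : O y -> partial sp2 (fun y => w y 0 (lshift 1 l) : R) y = 0.
  move=> Oy; apply: etrans (open_eq_partial _ oO Oy (fun z Oz => wE l z Oz)) _.
  by apply: (partial_lsubmx_line (f := Xg l)); exact/dXg/ball_lsubmx.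
have pw2 i y : O y -> partial i (fun y => w y 0 sp2 : R) y = 0.
  by move=> Oy; apply: etrans (open_eq_partial i oO Oy w2E) _; exact: partial_cst.
exists X, theta; split=> //.
- move=> m Bm; have Oy := Oiota m Bm; rewrite -(unitV _ Oy) quadratic_formE expr2.
  rewrite !(XE _ _ Oy) !(thetaE _ Oy) /g lio (metric_symE 1 0 (Ba Bm)).
  by move: (X m 0 0) (X m 0 1) => *; ring.
- move=> m i j Bm; have Oy := Oiota m Bm.
  have := kill _ (lshift 1 i) (lshift 1 j) Oy.
  rewrite big_split_ord /= big_ord1 => K; rewrite -[RHS]K -[LHS]addr0; congr (_ + _).
    apply: eq_bigr => k _.
    rewrite (pX i k _ Oy) (pX j k _ Oy) (GE00 (iota m) k j) (GE00 (iota m) k i).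
    rewrite (XE _ k Oy) /g lio; congr (_ * _ + _ + _).
    apply: esym; apply: etrans (open_eq_partial _ oO Oy (fun z _ => GE00 z i j)) _.
    by apply: etrans (partial_lsubmx_plane k (dg _ i j Oy)) _; rewrite lio.
  rewrite (GE10 (iota m) j) (GE10 (iota m) i) !mulr0 !addr0.
  by rewrite (open_eq_partial _ oO Oy (fun z _ => GE00 z i j)) (dzg i j _ Oy) mulr0.
- move=> m k Bm; have Oy := Oiota m Bm.
  (* In the sum defining [i_V dw] the term with equal indices cancels, and the line term vanishes
     because [w] does not depend on [z] and its last component is constant. One product of [X] with
     the surface curl remains. *)
  have tail (v0 v1 v2 s t u d e : R) : v0 * (s - t) + v1 * (u - u) + v2 * (d - e) = 0 ->
      d = 0 -> e = 0 -> v0 * (s - t) = 0.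
    by move=> + d0 e0; rewrite d0 e0 !subrr !mulr0 !addr0.
  have pw j l : partial (lshift 1 j) (fun y => w y 0 (lshift 1 l) : R) (iota m) =
      partial j (Xg l) m by rewrite (pw0 j l _ Oy) lio.
  have XV j : V (iota m) 0 (lshift 1 j) = X m 0 j by rewrite (XE _ j Oy) lio.
  have [->|->] := ord2P k.
    have := curlV _ (lshift 1 1) Oy; rewrite big_ord21 => E1.
    have {}E1 := tail _ _ _ _ _ _ _ _ E1 (pwz 1 _ Oy) (pw2 (lshift 1 1) _ Oy).
    by apply: etrans E1; rewrite (pw 0 1) (pw 1 0) (XV 0).
  have := curlV _ (lshift 1 0) Oy; rewrite big_ord21 [X in X + _ = 0]addrC => E0.
  have {}E0 := tail _ _ _ _ _ _ _ _ E0 (pwz 0 _ Oy) (pw2 (lshift 1 0) _ Oy).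
  rewrite -opprB mulrN; apply/eqP; rewrite oppr_eq0; apply/eqP.
  by apply: etrans E0; rewrite (pw 0 1) (pw 1 0) (XV 1).
- move=> y Oy /=; rewrite -Vrow//; split; first exact: VJ.
  exact: GE.
Qed.

End VerticalSplitting.

(** * The rotation taking the vertical direction to the line *)

Section Rotation.
Context {R : realType} (s t : R).
Hypothesis st1 : s ^+ 2 + t ^+ 2 = 1.

(** Turns the plane of the first flat coordinate and the line by the angle that sends the row
    [(s, 0, t)] to [d_z]. *)
Definition rotation : 'M[R]_(2 + 1) := \matrix_(i, j)
  if i == sp0 then (if j == sp0 then t else if j == sp2 then s else 0)
  else if i == sp1 then (j == sp1)%:R
  else (if j == sp0 then - s else if j == sp2 then t else 0).

Let eq10 : (sp1 == sp0) = false. Proof. by []. Qed.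
Let eq20 : (sp2 == sp0) = false. Proof. by []. Qed.
Let eq12 : (sp1 == sp2) = false. Proof. by []. Qed.
Let eq21 : (sp2 == sp1) = false. Proof. by []. Qed.
Let eq01 : (sp0 == sp1) = false. Proof. by []. Qed.
Let eq02 : (sp0 == sp2) = false. Proof. by []. Qed.
Let eqs := (eqxx, eq10, eq20, eq12, eq21, eq01, eq02).

Lemma rotation_trmx : rotation *m rotation^T = 1%:M.
Proof.
apply/matrixP => i j; rewrite mxE big_ord21 /rotation !mxE !eqs.
by have [->|->|->] := ord21P i; have [->|->|->] := ord21P j; rewrite !eqs /=;
  rewrite ?mulr1n ?mulr0n; (ring || by rewrite -[RHS]st1; ring).
Qed.

Lemma trmx_rotation : rotation^T *m rotation = 1%:M.
Proof. exact: mulmx1C rotation_trmx. Qed.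

Lemma mulmx_rotation : row_mx (s *: delta_mx 0 0) t%:M *m rotation = (@rproj R 2)^T.
Proof.
have v0 : (row_mx (s *: delta_mx 0 0) t%:M : 'rV[R]_(2 + 1)) 0 sp0 = s.
  by rewrite row_mxEl !mxE eqxx mulr1.
have v1 : (row_mx (s *: delta_mx 0 0) t%:M : 'rV[R]_(2 + 1)) 0 sp1 = 0.
  by rewrite row_mxEl !mxE /= mulr0.
have v2 : (row_mx (s *: delta_mx 0 0) t%:M : 'rV[R]_(2 + 1)) 0 sp2 = t.
  by rewrite row_mxEr mxE eqxx.
have q0 : (@rproj R 2)^T 0 sp0 = 0 by rewrite mxE col_mxEu mxE.
have q1 : (@rproj R 2)^T 0 sp1 = 0 by rewrite mxE col_mxEu mxE.
have q2 : (@rproj R 2)^T 0 sp2 = 1 by rewrite mxE col_mxEd mxE.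
apply/rowP => j; rewrite mxE big_ord21 v0 v1 v2 ![rotation _ _]mxE !eqs.
have [->|->|->] := ord21P j; rewrite ?q0 ?q1 ?q2 !eqs.
- ring.
- ring.
- by rewrite -st1; ring.
Qed.

End Rotation.

Section LiftedJacobian.
Context {R : comUnitRingType} {n : nat}.
Implicit Types (P S T A : 'M[R]_n).

(** [P] is the Jacobian of the straightening, [S] and [T] those of the flat chart at the source and
    at the image, so [S *m S^T] and [T *m T^T] are the metrics there; [A] is the rotation. *)
Lemma isometry_conjugate P S T A : P *m T = S *m A -> A *m A^T = 1%:M ->
  S *m S^T = P *m (T *m T^T) *m P^T.
Proof.
move=> E AA; rewrite mulmxA E -mulmxA -trmx_mul E trmx_mul mulmxA.
by rewrite -[S *m A *m A^T]mulmxA AA mulmx1.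
Qed.

(** The same relation applied to a vector: if the flat chart followed by the rotation sends [v] to
    [q], and [T] fixes [q], then so does the straightening. *)
Lemma pushforward_conjugate P S T A (v q : 'rV[R]_n) : P *m T = S *m A ->
  T \in unitmx -> q *m T = q -> v *m S *m A = q -> v *m P = q.
Proof.
by move=> E TU qT vq; rewrite -(mulmxK TU (v *m P)) -(mulmxA v) E mulmxA vq -{1}qT mulmxK.
Qed.

End LiftedJacobian.

Section LiftedMatrix.
Context {R : realType} {n : nat}.
Local Notation L := (@lproj R n).
Local Notation Q := (@rproj R n).
Implicit Types J : 'M[R]_n.

Lemma lift_mx_gram J : L *m (J *m J^T) *m L^T + Q *m Q^T =
  (L *m J *m L^T + Q *m Q^T) *m (L *m J *m L^T + Q *m Q^T)^T.
Proof.
rewrite linearD/= !trmx_mul !trmxK mulmxDl !mulmxDr !mulmxA.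
rewrite -[L *m J *m L^T *m L]mulmxA lproj_lproj mulmx1.
rewrite -[L *m J *m L^T *m Q]mulmxA lproj_rproj mulmx0 mul0mx addr0.
rewrite -[Q *m Q^T *m L]mulmxA rproj_lproj mulmx0 !mul0mx add0r.
by rewrite -[Q *m Q^T *m Q]mulmxA rproj_rproj mulmx1.
Qed.

Lemma rproj_lift_mx J : Q^T *m (L *m J *m L^T + Q *m Q^T) = Q^T.
Proof. by rewrite mulmxDr !mulmxA rproj_lproj !mul0mx add0r rproj_rproj mul1mx. Qed.

Lemma row_mx_lift_mx J (x : 'rV[R]_n) (c : 'M[R]_1) :
  row_mx x c *m (L *m J *m L^T + Q *m Q^T) = row_mx (x *m J) c.
Proof.
rewrite mulmxDr !mulmxA mulmx_lproj mulmx_rproj row_mxKl row_mxKr.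
by rewrite -row_mx_proj.
Qed.

End LiftedMatrix.

Section StraightenSubmersion.
Context {R : realType} (M N : riemannian_manifold R 2).
Variables (pi : product_line M -> N) (a : chart M) (b : chart N).
Variables (x0 : 'rV[R]_(2 + 1)) (r : R).
Let E := product_line M.
Let a' : chart E := a.
Let O : set 'rV[R]_(2 + 1) := ball x0 r.
Let B : set 'rV[R]_2 := ball (lsubmx x0) r.
Let F := local_rep a' b pi.
Hypothesis r0 : 0 < r.
Hypotheses (subm : riemannian_submersion pi) (harm : harmonic pi).
Hypotheses (Oa : O `<=` chart_image a') (Ob : forall y, O y -> dom b (pi (param a' y))).
Hypothesis sF : smooth O F.
Local Notation L := (@lproj R 2).
Local Notation Q := (@rproj R 2).

(* [phi] pushes the unit vertical vector [v] to [eps] times [d_z], which is the row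
   [Q^T]; the sign is needed when [v] is already [- d_z]. *)
Definition straightening (O1 O2 : set 'rV[R]_(2 + 1))
    (phi gam : 'rV[R]_(2 + 1) -> 'rV[R]_(2 + 1)) : Prop :=
  [/\ open O1, O1 x0, O1 `<=` O, open O2 & O2 `<=` chart_image a'] /\
  [/\ smooth O1 phi, smooth O2 gam, forall y, O1 y -> O2 (phi y) /\ gam (phi y) = y &
      forall y, O2 y -> O1 (gam y) /\ phi (gam y) = y] /\
  forall y, O1 y ->
    metric a' y = 'J phi y *m metric a' (phi y) *m ('J phi y)^T /\
    exists (eps : R) (v : 'rV[R]_(2 + 1)),
      [/\ eps ^+ 2 = 1, v *m 'J phi y = eps *: Q^T, v *m 'J F y = 0 &
       metric a' y = (v *m metric a' y)^T *m (v *m metric a' y)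
         + 'J F y *m metric b (F y) *m ('J F y)^T].

(** The squared length [c] of [X] is constant, which leaves two cases: the identity when [c = 0], a
    rotation in flat coordinates when [c > 0]. *)
Lemma exists_straightening : exists O1 O2 phi gam, straightening O1 O2 phi gam.
Proof.
have [X [theta [sX unitX killX closX VP]]] := vertical_splitting r0 subm harm Oa Ob sF.
have oO : open O by exact: ball_open.
have oB : open B by exact: ball_open.
have Ox0 : O x0 by exact: ballxx.
have Bq : B (lsubmx x0) by exact: ballxx.
have Ba m : B m -> chart_image a m.
  by move=> /ball_row_mx/Oa; rewrite /a' line_chart_image /= row_mxKl.
have sg : smooth B (metric a) by exact: smoothS Ba (smooth_metric a).
pose c := 1 - theta ^+ 2.
have gX m : B m -> (X m *m metric a m *m (X m)^T) 0 0 = c.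
  by move=> Bm; rewrite /c -(unitX m Bm) addrK.
have [c0|cN0] := eqVneq c 0.
  have X0 m : B m -> X m = 0.
    move=> Bm; apply/eqP/negPn/negP => Xm0.
    by have := metric_posdef (Ba m Bm) Xm0; rewrite gX// c0 ltxx.
  (* The vertical vector is already [theta] times [d_z] with [theta ^+ 2 = 1], so [theta] serves as
     the sign. *)
  exists O, O, id, id; split; first by split.
  split; first by split=> //; exact: smooth_id.
  move=> y Oy; rewrite jacobian_id; split; first by rewrite mul1mx trmx1 mulmx1.
  have [vJ GE] := VP y Oy.
  exists theta, (row_mx (X (lsubmx y)) theta%:M); split=> //.
    by move/eqP: c0; rewrite /c subr_eq0 => /eqP.
  rewrite mulmx1 row_mx_proj X0; last exact: ball_lsubmx.
  by rewrite mul0mx add0r mul_scalar_mx.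
have XN0 m : B m -> X m != 0.
  by move=> Bm; apply: contra_neq cN0 => X0; rewrite -(gX m Bm) X0 !mul0mx mxE.
have c0 : 0 < c.
  by rewrite -(gX _ Bq); apply: metric_posdef (XN0 _ Bq); exact: Ba.
pose s := Num.sqrt c.
have s0 : 0 < s by rewrite sqrtr_gt0.
have s2 : s ^+ 2 = c by rewrite sqr_sqrtr// ltW.
have st1 : s ^+ 2 + theta ^+ 2 = 1 by rewrite s2 /c subrK.
have gX2 m : B m -> (X m *m metric a m *m (X m)^T) 0 0 = s ^+ 2 by rewrite s2; exact: gX.
(* A nonzero curl would force every component of [X] to vanish. *)
have clos m : B m -> partial 0 (fun y => (X y *m metric a y) 0 1 : R) m =
    partial 1 (fun y => (X y *m metric a y) 0 0 : R) m.
  move=> Bm; apply/eqP; rewrite -subr_eq0; apply/negPn/negP => dN0.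
  have Xk k : X m 0 k = 0.
    by move/eqP: (closX m k Bm); rewrite mulf_eq0 (negPf dN0) orbF => /eqP.
  by have := XN0 m Bm; apply/negP; rewrite negbK; apply/eqP/rowP => k; rewrite mxE.
have [r1 [chi [r10 r1B schi chiP]]] := flat_chart oB sg sX s0
  (fun m Bm => metric_sym (Ba m Bm)) (fun m v Bm => @metric_posdef _ _ _ a m v (Ba m Bm))
  gX2 killX clos Bq.
have q1 : ball (lsubmx x0) r1 (lsubmx x0) by exact: ballxx.
have Jq : 'J chi (lsubmx x0) \in unitmx.
  have := metric_unit (Ba _ Bq); rewrite (chiP _ q1).1 unitmx_mul.
  by move=> /andP[].
have ob1 : open (ball (lsubmx x0) r1 : set 'rV[R]_2) by exact: ball_open.
have [U [kap [[oU Uq UB oC] [kapK skap _]]]] :=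
  inverse_function ob1 schi q1 Jq.
have schiU : smooth U chi by exact: smoothS schi.
pose A := rotation s theta.
have AT : A *m A^T = 1%:M by exact: rotation_trmx.
have TA : A^T *m A = 1%:M by exact: trmx_rotation.
pose xi0 := line_lift chi x0.
pose D A := rot_dom U chi xi0 A; pose phi A := rot_map chi kap xi0 A.
have UB' m : U m -> B m by move=> /UB/r1B.
have oD A0 : open (D A0) by exact: open_rot_dom.
have sphi A0 : smooth (D A0) (phi A0) by exact: smooth_rot_map.
have phiD A0 B0 y : A0 *m B0 = 1%:M -> D A0 y -> D B0 (phi A0 y) /\ phi B0 (phi A0 y) = y.
  by move=> AB; exact: rot_map_dom.
(* The inverse is the map for [A^T]; pulling the condition [O] back through it makes the two
   restrictions mutually inverse. *)
exists (D A `&` O), (D A^T `&` phi A^T @^-1` O), (phi A), (phi A^T).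
split.
  split.
  - exact: openI.
  - split=> //; split; first exact: Uq.
    by rewrite /= rot_center /xi0 /line_lift row_mxKl; exists (lsubmx x0).
  - by move=> y [].
  - exact: open_smooth_preimage.
  - by move=> y [[Uy _] _]; rewrite /a' line_chart_image; exact/Ba/UB'.
split.
  split.
  - by apply: smoothS (sphi A) => y [].
  - by apply: smoothS (sphi A^T) => y [].
  - by move=> y [/(phiD _ _ _ AT)[DT phiK] Oy]; rewrite phiK; split=> //; split; rewrite //= phiK.
  - by move=> y [/(phiD _ _ _ TA)[DA phiK] Oy].
move=> y [DAy Oy]; have [DT _] := phiD _ _ _ AT DAy.
have gE z : U (lsubmx z) -> metric a' z = 'J (line_lift chi) z *m ('J (line_lift chi) z)^T.
  move=> Uz; rewrite (jacobian_lift_chi schiU Uz) -lift_mx_gram.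
  by apply: etrans (line_metricE _ _) _; rewrite (chiP _ (UB _ Uz)).1.
have Uy : U (lsubmx y) by case: DAy.
have Uphi : U (lsubmx (phi A y)) by case: DT.
have JE : 'J (phi A) y *m 'J (line_lift chi) (phi A y) = 'J (line_lift chi) y *m A.
  exact: (jacobian_rot_map oU oC schiU skap kapK DAy).
split.
  apply: etrans (gE _ Uy) _; apply: etrans (isometry_conjugate JE AT) _.
  exact: (congr1 (fun G => 'J (phi A) y *m G *m ('J (phi A) y)^T) (esym (gE _ Uphi))).
have [vJ GE] := VP y Oy.
exists 1, (row_mx (X (lsubmx y)) theta%:M); split; [by rewrite expr1n| |exact: vJ|exact: GE].
have TU : 'J (line_lift chi) (phi A y) \in unitmx.
  have : metric a' (phi A y) \in unitmx.
    by apply: metric_unit; rewrite /a' line_chart_image; exact/Ba/UB'.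
  by rewrite (gE _ Uphi) unitmx_mul => /andP[].
rewrite scale1r; apply: (pushforward_conjugate JE TU).
  by rewrite (jacobian_lift_chi schiU Uphi) rproj_lift_mx.
rewrite (jacobian_lift_chi schiU Uy) row_mx_lift_mx (chiP _ (UB _ Uy)).2.
exact: mulmx_rotation.
Qed.

End StraightenSubmersion.

(** * Descent to the surface *)

Section Descent.
Context {R : realType} (M N : riemannian_manifold R 2).
Variables (pi : product_line M -> N) (a : chart M) (b : chart N).
Variables (x0 : 'rV[R]_(2 + 1)) (r : R).
Let a' : chart (product_line M) := a.
Let O : set 'rV[R]_(2 + 1) := ball x0 r.
Let F := local_rep a' b pi.
Hypothesis sF : smooth O F.
Hypothesis Oa : O `<=` chart_image a'.
Hypothesis Ob : forall y, O y -> dom b (pi (param a' y)).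
Variables (O1 O2 : set 'rV[R]_(2 + 1)) (phi gam : 'rV[R]_(2 + 1) -> 'rV[R]_(2 + 1)).
Hypothesis st : straightening pi a b x0 r O1 O2 phi gam.
Local Notation L := (@lproj R 2).
Local Notation Q := (@rproj R 2).

Lemma trmx_rproj_mul m (A : 'M[R]_(2 + 1, m)) : Q^T *m A = dsubmx A.
Proof.
rewrite -[A in LHS]vsubmxK /rproj tr_col_mx mul_row_col trmx0 trmx1.
by rewrite mul0mx add0r mul1mx.
Qed.

(** [P] and [S] are the Jacobians of the straightening and of its inverse. In straightened
    coordinates the vertical form is [eps] times [dz]; the sign disappears in its square, which
    cancels against [dz^2] in the product metric and leaves the surface metric as a pullback. *)
Lemma pullback_along_inverse (G G' P S : 'M[R]_(2 + 1)) (J : 'M[R]_(2 + 1, 2))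
    (h g : 'M[R]_2) (v : 'rV[R]_(2 + 1)) (eps : R) : G^T = G ->
  G' = L *m g *m L^T + Q *m Q^T -> S *m P = 1%:M ->
  G = P *m G' *m P^T -> eps ^+ 2 = 1 -> v *m P = eps *: Q^T -> v *m J = 0 ->
  G = (v *m G)^T *m (v *m G) + J *m h *m J^T ->
  Q^T *m (S *m J) = 0 /\ g = (L^T *m (S *m J)) *m h *m (L^T *m (S *m J))^T.
Proof.
move=> Gsym G'E SP GE eps2 vP vJ Gv.
have PS : P *m S = 1%:M by exact: mulmx1C.
have eps0 : eps != 0.
  by apply: contra_eq_neq eps2 => ->; rewrite expr0n eq_sym oner_eq0.
have vE : v = eps *: (Q^T *m S) by rewrite scalemxAl -vP -mulmxA PS mulmx1.
split.
  apply: (scalerI eps0); rewrite scaler0 -vJ [in RHS]vE -scalemxAl.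
  by rewrite mulmxA.
have G'S : G' = S *m G *m S^T.
  by rewrite GE !mulmxA SP mul1mx -mulmxA -trmx_mul SP trmx1 mulmx1.
have G'Q : G' *m Q = Q.
  by rewrite G'E mulmxDl -!mulmxA lproj_rproj !mulmx0 add0r rproj_rproj mulmx1.
have wS : S *m (v *m G)^T = eps *: Q.
  rewrite trmx_mul Gsym {1}vE linearZ/= -scalemxAr -scalemxAr trmx_mul trmxK.
  by rewrite !mulmxA -G'S G'Q.
have wS' : v *m G *m S^T = eps *: Q^T.
  by apply: trmx_inj; rewrite trmx_mul trmxK wS linearZ/= trmxK.
have E : G' = Q *m Q^T + (S *m J) *m h *m (S *m J)^T.
  rewrite {1}G'S {1}Gv mulmxDr mulmxDl; congr (_ + _); last by rewrite trmx_mul !mulmxA.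
  rewrite mulmxA wS -mulmxA wS' -scalemxAl -scalemxAr scalerA -expr2 eps2.
  by rewrite scale1r.
(* Both expressions of [G'] contain [Q *m Q^T], the square of [dz]. *)
have E2 : L *m g *m L^T = (S *m J) *m h *m (S *m J)^T.
  by move: E; rewrite G'E addrC => /addrI.
have := congr1 (fun Z => L^T *m Z *m L) E2.
rewrite !mulmxA lproj_lproj mul1mx -mulmxA lproj_lproj mulmx1 => ->.
by rewrite !trmx_mul !trmxK !mulmxA.
Qed.

(** In straightened coordinates the map has zero derivative along the line, so on a ball it factors
    through its restriction [f] to the slice through the centre. *)
Lemma descended_map : exists (r2 : R) (f : 'rV[R]_2 -> 'rV[R]_2),
  let x1 := phi x0 in
  [/\ 0 < r2, ball x1 r2 `<=` O2, smooth (ball (lsubmx x1) r2) f,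
     forall y, ball x1 r2 y -> F (gam y) = f (lsubmx y) &
     forall m, ball (lsubmx x1) r2 m -> chart_image b (f m) /\
       metric a m = 'J f m *m metric b (f m) *m ('J f m)^T].
Proof.
have [[oO1 O1x O1O oO2 O2a] [[sphi sgam phiK gamK] H]] := st.
have [x1O2 _] := phiK _ O1x; set x1 := phi x0 in x1O2 *.
have /nbhs_ballP[r2 /= r20 r2O] : nbhs x1 O2 by exact: open_nbhs_nbhs.
pose Fh := F \o gam.
have oC : open (ball x1 r2 : set 'rV[R]_(2 + 1)) by exact: ball_open.
have oD : open (ball (lsubmx x1) r2 : set 'rV[R]_2) by exact: ball_open.
have gamO y : ball x1 r2 y -> O (gam y) by move=> /r2O/gamK[/O1O].
have sgamC : smooth (ball x1 r2) gam by exact: smoothS r2O sgam.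
have oO : open O by exact: ball_open.
have sFh : smooth (ball x1 r2) Fh by exact: (smooth_comp oC oO gamO sgamC sF).
have key y : ball x1 r2 y -> Q^T *m 'J Fh y = 0 /\
    metric a (lsubmx y) = (L^T *m 'J Fh y) *m metric b (Fh y) *m (L^T *m 'J Fh y)^T.
  move=> Cy; have [gO1 phig] := gamK y (r2O y Cy).
  have [GE [eps [v [eps2 vP vJ Gv]]]] := H _ gO1.
  have dg := smooth_differentiable sgamC Cy.
  have dF := smooth_differentiable sF (gamO y Cy).
  have dphi := smooth_differentiable sphi gO1.
  have JFh : 'J Fh y = 'J gam y *m 'J F (gam y) by exact: jacobian_comp.
  have SP : 'J gam y *m 'J phi (gam y) = 1%:M.
    rewrite -(jacobian_id y); apply: etrans (esym (jacobian_comp dg dphi)) _.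
    apply: near_eq_jacobian; first exact: differentiable_comp.
    have nC : nbhs y (ball x1 r2 : set 'rV[R]_(2 + 1)) by exact: open_nbhs_nbhs.
    by apply: filterS nC => z /r2O/gamK[].
  rewrite phig in GE.
  have Gsym : (metric a' (gam y))^T = metric a' (gam y).
    by apply: metric_sym; exact/Oa/gamO.
  rewrite JFh.
  exact: (pullback_along_inverse Gsym (line_metricE a y) SP GE eps2 vP vJ Gv).
pose iota (m : 'rV[R]_2) : 'rV[R]_(2 + 1) := row_mx m (rsubmx x1).
have iotaC m : ball (lsubmx x1) r2 m -> ball x1 r2 (iota m) by exact: ball_row_mx.
have lio m : lsubmx (iota m) = m by exact: row_mxKl.
have iotaE : iota = fun m => m *m L^T - - (rsubmx x1 *m Q^T).
  by apply/funext => m; rewrite opprK /iota row_mx_proj.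
have siota A : open A -> smooth A iota.
  move=> oA; rewrite iotaE; apply: smoothB => //; last exact: smooth_cst.
  by apply: smooth_mulmx => //; [exact: smooth_id|exact: smooth_cst].
have Jiota m : 'J iota m = L^T.
  rewrite iotaE.
  have dm z : differentiable (mulmxr L^T : 'rV[R]_2 -> 'rV[R]_(2 + 1)) z.
    by apply: linear_differentiable; exact: mulmxr_continuous.
  apply: etrans (jacobianB (dm _) (differentiable_cst _ _)) _.
  rewrite -[RHS]subr0; congr (_ - _); last exact: jacobian_cst.
  exact: jacobian_mulmxr.
pose f := Fh \o iota.
have sf : smooth (ball (lsubmx x1) r2) f.
  exact: (smooth_comp oD oC iotaC (siota _ oD) sFh).
exists r2, f; split=> //.
  move=> y Cy; have Cy' := iotaC _ (ball_lsubmx Cy).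
  apply/rowP => j; rewrite -/(Fh y).
  have dFh z : ball x1 r2 z -> differentiable (fun z => Fh z 0 j : R) z.
    by move=> Cz; apply: smooth_differentiable Cz; exact: smooth_coord.
  apply: (derive0_constant (f := fun z => Fh z 0 j) (c := x1) (r := r2)) => //.
  move=> z Cz; rewrite (derive_partial _ (dFh z Cz)) big_split_ord /= big_ord1.
  have -> : partial (rshift 2 0) (fun z => Fh z 0 j : R) z = 0.
    rewrite -(jacobianE _ _ (smooth_differentiable sFh Cz)).
    have := congr1 (fun Z : 'rV[R]_2 => Z 0 j) (key z Cz).1.
    by rewrite [RHS]mxE trmx_rproj_mul [LHS]mxE.
  rewrite scaler0 addr0; apply: big1 => k _.
  by rewrite mxBE /iota row_mxEl [lsubmx y 0 k]mxE subrr scale0r.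
move=> m Bm; have Cm := iotaC m Bm.
split.
  by exists (pi (param a' (gam (iota m)))) => //; exact/Ob/gamO.
have := (key _ Cm).2; rewrite lio.
suff -> : 'J f m = L^T *m 'J Fh (iota m) by [].
rewrite -(Jiota m); apply: jacobian_comp; last exact: smooth_differentiable sFh Cm.
exact: smooth_differentiable (siota _ oD) Bm.
Qed.

End Descent.

(** * From coordinate maps to coverings and isometries *)

Section InverseCharts.
Context {R : realType} {n : nat} (M N : riemannian_manifold R n).
Variables (a : chart M) (b : chart N) (U : set 'rV[R]_n) (f k : 'rV[R]_n -> 'rV[R]_n).
Hypotheses (oU : open U) (oV : open (f @` U)) (sf : smooth U f) (sk : smooth (f @` U) k).
Hypotheses (Ua : U `<=` chart_image a) (fb : forall m, U m -> chart_image b (f m)).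
Hypothesis kf : forall m, U m -> k (f m) = m.
Hypothesis gE : forall m, U m -> metric a m = 'J f m *m metric b (f m) *m ('J f m)^T.

Definition chart_push : M -> N := param b \o f \o coord a.

Let W : set M := [set p | dom a p /\ U (coord a p)].
Let B : set N := [set q | dom b q /\ (f @` U) (coord b q)].
Let inv : N -> M := param a \o k \o coord b.

Let pushP p : W p -> [/\ smooth_at chart_push p, dom b (chart_push p),
  coord b (chart_push p) = f (coord a p) &
  differential a b chart_push p = 'J f (coord a p)].
Proof. by move=> [ap Up]; apply: (chart_map ap oU Up sf (fb Up) _); apply: nearW. Qed.

Let pushB p : W p -> B (chart_push p).
Proof.
by move=> Wp; have [_ bp bE _] := pushP Wp; split=> //; rewrite bE; exists (coord a p) => //; case: Wp.
Qed.

Let invP q : B q -> W (inv q) /\ chart_push (inv q) = q.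
Proof.
move=> [bq [m Um mE]]; have [am ma] := chart_imageP (Ua Um).
have invE : inv q = param a m by rewrite /inv /= -mE kf.
split; first by rewrite invE; split; rewrite ?ma.
by rewrite invE /chart_push /= ma mE coordK.
Qed.

Let pushK p : W p -> inv (chart_push p) = p.
Proof.
move=> Wp; have [_ _ bE _] := pushP Wp; have [ap Up] := Wp.
by rewrite /inv /= bE kf// coordK.
Qed.

(** The map is a homeomorphism from [W] onto [B], with inverse [inv] coming from [k]; continuity of
    [inv] gives the openness of images. *)
Lemma chart_push_covering : riemannian_covering W B chart_push.
Proof.
have oB : open B by exact: open_param.
have fW : chart_push @` W = B.
  apply/seteqP; split=> [_ [p Wp <-]|q Bq]; first exact: pushB.
  by have [Wq qE] := invP Bq; exists (inv q).
split=> //.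
- exact: open_param.
- by move=> p /pushP[].
- move=> p Wp; have [sp bp bE dE] := pushP Wp; have [ap Up] := Wp.
  apply: (metric_preserving_chart sp ap bp); rewrite dE bE; exact: gE.
(* A single sheet: [B] is evenly covered by [W] itself, indexed by [unit]. *)
split=> // q Bq; exists B; split=> //; exists unit, (fun=> W); split.
- apply/seteqP; split=> [p [Wp _]|p [_ _ Wp]]; first by exists tt.
  by split=> //; exact: pushB.
- by move=> [] [].
- by move=> _; exact: open_param.
move=> _; split.
- split; first by move=> p; exact: pushB.
    by move=> p p'; rewrite !inE => Wp Wp' E; rewrite -(pushK Wp) E pushK.
  by move=> p Bp; rewrite fW.
- apply: continuous_in_subspaceT => p; rewrite inE => Wp.
  by have [[]] := pushP Wp.
move=> A oA AW; rewrite openE => _ [p Ap <-].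
have Bp := pushB (AW p Ap).
have cinv : {for chart_push p, continuous inv}.
  have [bp Vp] := Bp.
  have [] : [/\ smooth_at inv (chart_push p), dom a (inv (chart_push p)),
     coord a (inv (chart_push p)) = k (coord b (chart_push p)) &
     differential b a inv (chart_push p) = 'J k (coord b (chart_push p))].
    apply: (chart_map bp oV Vp sk _ _); last exact: nearW.
    by have [m Um <-] := Vp; rewrite kf//; exact: Ua.
  by move=> [].
have nA : nbhs (chart_push p) (inv @^-1` A).
  by apply: cinv; apply: open_nbhs_nbhs; split=> //; rewrite (pushK (AW p Ap)).
have nB : nbhs (chart_push p) B by exact: open_nbhs_nbhs.
apply: filterS (filterI nA nB) => t [/= At Bt]; exists (inv t) => //.
exact: (invP Bt).2.
Qed.

End InverseCharts.

Section ChartIsometry.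
Context {R : realType} {n : nat} (E : riemannian_manifold R n).
Variables (a : chart E) (O1 O2 : set 'rV[R]_n) (phi gam : 'rV[R]_n -> 'rV[R]_n).
Hypotheses (oO1 : open O1) (oO2 : open O2).
Hypotheses (O1a : O1 `<=` chart_image a) (O2a : O2 `<=` chart_image a).
Hypotheses (sphi : smooth O1 phi) (sgam : smooth O2 gam).
Hypothesis phiK : forall y, O1 y -> O2 (phi y) /\ gam (phi y) = y.
Hypothesis gamK : forall y, O2 y -> O1 (gam y) /\ phi (gam y) = y.
Hypothesis gE : forall y, O1 y -> metric a y = 'J phi y *m metric a (phi y) *m ('J phi y)^T.

Lemma chart_isometry :
  isometry_between [set p | dom a p /\ O1 (coord a p)] [set p | dom a p /\ O2 (coord a p)]
    (param a \o phi \o coord a).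
Proof.
have phiP p : dom a p -> O1 (coord a p) -> [/\ smooth_at (param a \o phi \o coord a) p,
    dom a (param a (phi (coord a p))), coord a (param a (phi (coord a p))) = phi (coord a p) &
    differential a a (param a \o phi \o coord a) p = 'J phi (coord a p)].
  move=> ap Op; apply: (chart_map ap oO1 Op sphi _ _); last exact: nearW.
  by apply: O2a; exact: (phiK Op).1.
have gamP p : dom a p -> O2 (coord a p) -> [/\ smooth_at (param a \o gam \o coord a) p,
    dom a (param a (gam (coord a p))), coord a (param a (gam (coord a p))) = gam (coord a p) &
    differential a a (param a \o gam \o coord a) p = 'J gam (coord a p)].
  move=> ap Op; apply: (chart_map ap oO2 Op sgam _ _); last exact: nearW.
  by apply: O1a; exact: (gamK Op).1.
split.
- exact: open_param.
- exact: open_param.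
- by move=> p [ap Op]; have [] := phiP p ap Op.
- move=> p [ap Op]; have [sp ap' E' dE] := phiP p ap Op.
  apply: (metric_preserving_chart sp ap ap'); rewrite dE /= E'; exact: gE.
exists (param a \o gam \o coord a); split.
- move=> p [ap Op]; have [_ ap' E' _] := phiP p ap Op.
  by split; rewrite //= E'; exact: (phiK Op).1.
- move=> p [ap Op]; have [_ ap' E' _] := gamP p ap Op.
  by split; rewrite //= E'; exact: (gamK Op).1.
- move=> p; rewrite inE => -[ap Op]; have [_ ap' E' _] := phiP p ap Op.
  by rewrite /= E' (phiK Op).2 coordK.
- move=> p; rewrite inE => -[ap Op]; have [_ ap' E' _] := gamP p ap Op.
  by rewrite /= E' (gamK Op).2 coordK.
- by move=> p [ap Op]; have [] := gamP p ap Op.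
Qed.

End ChartIsometry.

(** * Assembling the local form *)

Section LocalForm.
Context {R : realType} (M N : riemannian_manifold R 2) (pi : product_line M -> N).
Hypothesis subm : riemannian_submersion pi.

Lemma harmonic_local_form (harm : harmonic pi) (p : product_line M) :
  exists (U V : set (product_line M)) (Phi : product_line M -> product_line M)
            (W : set M) (B : set N) (psi : M -> N),
       [/\ U p, isometry_between U V Phi, W = [set q.1 | q in V],
           riemannian_covering W B psi & forall q, U q -> pi q = psi (Phi q).1].
Proof.
have [a ap1] := dom_cover p.1; have [b bp] := dom_cover (pi p).
pose a' : chart (product_line M) := a; have ap : dom a' p by [].
have spi := subm.1 p I; have [Q [oQ Qp] sQ] := spi.2 a' b ap bp.
pose x0 : 'rV[R]_(2 + 1) := coord a' p.
have npb : nbhs p (pi @^-1` dom b).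
  by apply: spi.1; apply: open_nbhs_nbhs; split=> //; exact: dom_open.
have : nbhs x0 (Q `&` [set y | [/\ chart_image a' y, dom a' (param a' y),
    coord a' (param a' y) = y & (pi @^-1` dom b) (param a' y)]]).
  by apply: filterI (near_coord ap npb); exact: open_nbhs_nbhs.
move=> /nbhs_ballP[r /= r0 rP].
have Oa : ball x0 r `<=` chart_image a' by move=> y /rP[_ []].
have Ob y : ball x0 r y -> dom b (pi (param a' y)) by move=> /rP[_ []].
have sF : smooth (ball x0 r) (local_rep a' b pi) by apply: smoothS sQ => y /rP[].
have [P1 [P2 [phi [gam st]]]] := exists_straightening r0 subm harm Oa Ob sF.
have [r2 [f]] := descended_map sF Oa Ob st.
set x1 := phi x0 => -[r20 r2O sf Ff fP].
have [[oO1 xO1 O1O oO2 O2a] [[sphi sgam phiK gamK] H]] := st.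
have C1 : ball x1 r2 x1 by exact: ballxx.
have D1 : ball (lsubmx x1) r2 (lsubmx x1) by exact: ballxx.
have oD : open (ball (lsubmx x1) r2 : set 'rV[R]_2) by exact: ball_open.
have Da m : ball (lsubmx x1) r2 m -> chart_image a m.
  by move=> /ball_row_mx/r2O/O2a; rewrite /a' line_chart_image /= row_mxKl.
have J1 : 'J f (lsubmx x1) \in unitmx.
  have := metric_unit (Da _ D1); rewrite (fP _ D1).2 !unitmx_mul.
  by move=> /andP[/andP[]].
have [U0 [k [[oU0 U0x U0D oV0] [kf sk _]]]] := inverse_function oD sf D1 J1.
(* Cut down to the cylinder over [U0], so that the projection of the image of the isometry is
   exactly the domain on which [f] is invertible. *)
pose C2 : set 'rV[R]_(2 + 1) := ball x1 r2 `&` lsubmx @^-1` U0.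
have oC2 : open C2 by apply: openI; [exact: ball_open|exact: open_lsubmx].
pose C1' := P1 `&` phi @^-1` C2.
have oC1' : open C1' by exact: open_smooth_preimage.
have C2O y : C2 y -> P2 y by move=> [/r2O].
have iso := @chart_isometry _ _ (product_line M) a' C1' C2 phi gam oC1' oC2.
exists [set q | dom a' q /\ C1' (coord a' q)], [set q | dom a' q /\ C2 (coord a' q)].
exists (param a' \o phi \o coord a').
exists [set m | dom a m /\ U0 (coord a m)], [set q | dom b q /\ (f @` U0) (coord b q)].
exists (chart_push a b f); split.
- by split.
- apply: iso.
  + by move=> y [/O1O/Oa].
  + by move=> y /C2O/O2a.
  + by apply: smoothS sphi => y [].
  + by apply: smoothS sgam => y /C2O.
  + by move=> y [Oy Cy]; split=> //; exact: (phiK y Oy).2.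
  + by move=> y /[dup] Cy /C2O/gamK[Oy E']; split=> //; split=> //=; rewrite E'.
  + by move=> y [Oy _]; exact: (H y Oy).1.
- apply/seteqP; split=> [m [am Um]|_ [q [aq [_ Uq]] <-]].
    (* The lift of [m] to the height of [x1], which stays in the ball because the ball is a
       product. *)
    exists (m, rsubmx x1 0 0) => //; split=> //; rewrite /C2 /= /line_coord /=.
    rewrite -mx11_scalar; split; last by rewrite /= row_mxKl.
    exact/ball_row_mx/U0D.
  by split=> //; move: Uq; rewrite /= row_mxKl.
- apply: (chart_push_covering (k := k)) => //.
  + exact: smoothS sf.
  + by move=> m /U0D/Da.
  + by move=> m /U0D/fP[].
  + by move=> m /U0D/fP[].
- move=> q [aq [Oq [Cq Uq]]].
  have aphi : chart_image a (lsubmx (phi (coord a' q))).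
    exact/Da/U0D.
  rewrite /chart_push /= (chart_imageP aphi).2 -(Ff _ Cq) (phiK _ Oq).2.
  have bq := Ob _ (O1O _ Oq).
  rewrite /local_rep /= coordK//.
    by rewrite -[q in LHS](coordK (r := product_line M) aq).
Qed.

End LocalForm.

Theorem theorem2p2 (R : realType) (M N : riemannian_manifold R 2)
    (pi : product_line M -> N) (hpi : riemannian_submersion pi) :
  harmonic pi <->
  (forall p : product_line M,
     exists (U V : set (product_line M)) (Phi : product_line M -> product_line M)
            (W : set M) (B : set N) (psi : M -> N),
       [/\ U p,
           isometry_between U V Phi,
           W = [set q.1 | q in V],
           riemannian_covering W B psi &
           forall q, U q -> pi q = psi (Phi q).1]).
Proof.
split=> [harm p|loc]; first exact: harmonic_local_form.
split=> [|p a b c ap bp]; first exact: hpi.1.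
have [U [V [Phi [W [B [psi [Up [oU oV sPhi mPhi [g [UV _ _ _ _]]] WE [oW _ spsi mpsi _] piE]]]]]]] :=
  loc p.
apply: (local_form_tension (U := U) (Phi := Phi) (W := W) (psi := psi)) => //.
- by move=> q Uq; rewrite WE; exists (Phi q) => //; exact: UV.
- exact: hpi.1.
- by have [] := hpi.2 p a b ap bp.
Qed.
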